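(* Let $n\ge5$ and let $\boldsymbol\lambda\in K_n$ be such that $G_{\boldsymbol\lambda}$ is isomorphic to the icosahedral group $I\simeq A_5$. According to the type of $\boldsymbol\lambda$ (with $m\in\mathbb{N}=\{0,1,2,\dots\}$), its multiplicity vector is: 1. type F+mB: $(m,\,1+4m,\,1+5m,\,3m,\,3m)$; 2. type V+mB: $(m,\,1+4m,\,2+5m,\,3m,\,1+3m)$; 3. type E+mB: $(m,\,2+4m,\,2+5m,\,1+3m,\,2+3m)$; 4. type FV+mB: $(m,\,2+4m,\,3+5m,\,1+3m,\,1+3m)$; 5. type VE+mB: $(m,\,3+4m,\,4+5m,\,2+3m,\,3+3m)$; 6. type EF+mB: $(m,\,3+4m,\,3+5m,\,2+3m,\,2+3m)$; 7. type FVE+mB: $(m,\,4+4m,\,5+5m,\,3+3m,\,3+3m)$; 8. type (1+m)B: $(1+m,\,4+4m,\,5+5m,\,2+3m,\,3+3m)$.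
   Context: $K_n=\{\boldsymbol\lambda=(\lambda^1,\dots,\lambda^{n-3})\in\mathbb{C}^{n-3}\mid \lambda^i\neq 0,1,\ \lambda^i\neq\lambda^j \text{ for } i\neq j\}$. For $\boldsymbol\lambda\in K_n$ put $z^{\boldsymbol\lambda}_1=0$, $z^{\boldsymbol\lambda}_2=1$, $z^{\boldsymbol\lambda}_3=\infty$, $z^{\boldsymbol\lambda}_{i+3}=\lambda^i$, and $[\boldsymbol\lambda]=\{z^{\boldsymbol\lambda}_1,\dots,z^{\boldsymbol\lambda}_n\}\subset\widehat{\mathbb{C}}$. For $\sigma\in S_n$, $f^{\boldsymbol\lambda}_\sigma$ is the unique linear fractional transformation (LFT) sending $z^{\boldsymbol\lambda}_{\sigma^{-1}(1)},z^{\boldsymbol\lambda}_{\sigma^{-1}(2)},z^{\boldsymbol\lambda}_{\sigma^{-1}(3)}$ to $0,1,\infty$, and $g_\sigma:K_n\to K_n$, $g_\sigma(\boldsymbol\lambda)=(f^{\boldsymbol\lambda}_\sigma(z^{\boldsymbol\lambda}_{\sigma^{-1}(4)}),\dots,f^{\boldsymbol\lambda}_\sigma(z^{\boldsymbol\lambda}_{\sigma^{-1}(n)}))$. $G=\{g_\sigma\}$ is a group under composition ($g_\pi g_\sigma=g_{\pi\sigma}$; for $n\ge5$, $\sigma\mapsto g_\sigma$ is injective), $G_{\boldsymbol\lambda}$ is the stabilizer of $\boldsymbol\lambda$ in $G$, $\mathcal{A}_{\alpha}$ is the group of LFTs preserving a set $\alpha$, and $\Phi_{\boldsymbol\lambda}:G_{\boldsymbol\lambda}\to\mathcal{A}_{[\boldsymbol\lambda]}$,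 $g_\sigma\mapsto f^{\boldsymbol\lambda}_\sigma$, is a group isomorphism. $X_{\boldsymbol\lambda}:G_{\boldsymbol\lambda}\to \mathrm{GL}_{n-3}(\mathbb{C})$ is the representation sending $g_\sigma$ to the Jacobian matrix of $g_\sigma$ at $\boldsymbol\lambda$. Types. Two subsets of $\widehat{\mathbb{C}}\cong S^2$ (stereographic projection) are equivalent if an LFT carries one onto the other. Fix a regular dodecahedron inscribed in $S^2$ with rotation group $I$; $V_I$ is its vertex set, $F_I$ and $E_I$ the radial projections to $S^2$ of its face centers and edge midpoints; $B_I(a)$ denotes an $I$-orbit of order $60$. $\boldsymbol\lambda$ is of type F+mB, V+mB, E+mB, FV+mB, VE+mB, EF+mB, FVE+mB if $[\boldsymbol\lambda]$ is equivalent to the union of, respectively, $F_I$; $V_I$; $E_I$; $F_I\cup V_I$; $V_I\cup E_I$; $E_I\cup F_I$; $F_I\cup V_I\cup E_I$ with $m$ distinct orbits $B_I(a_1),\dots,B_I(a_m)$ of order $60$; it is of type (1+m)B if $[\boldsymbol\lambda]$ is equivalent to a union of $m+1$ distinct orbits $B_I(a_0),\dots,B_I(a_m)$ of order $60$. (Every $\boldsymbol\lambda$ with $G_{\boldsymbol\lambda}\simeq I$ is of one of these types.) Multiplicity vector. Conjugacy classes of $G_{\boldsymbol\lambda}$: $K^{(1)}$ the identity; $K^{(2)},K^{(3)},K^{(4)},K^{(5)}$ the elements whose images under $\Phi_{\boldsymbol\lambda}$ are conjugate (in the group of LFTs) to a rotation of $\frac{2\pi}{5},\frac{4\pi}{5},\frac{2\pi}{3},\pi$,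 respectively. The irreducible representations $X^{(1)},\dots,X^{(5)}$ have characters with values on $(K^{(1)},\dots,K^{(5)})$: $\chi^{(1)}=(1,1,1,1,1)$, $\chi^{(2)}=(4,-1,-1,1,0)$, $\chi^{(3)}=(5,0,0,-1,1)$, $\chi^{(4)}=(3,\frac{1+\sqrt5}{2},\frac{1-\sqrt5}{2},0,-1)$, $\chi^{(5)}=(3,\frac{1-\sqrt5}{2},\frac{1+\sqrt5}{2},0,-1)$. If $X_{\boldsymbol\lambda}\cong p_1X^{(1)}\oplus\cdots\oplus p_5X^{(5)}$, the multiplicity vector of $\boldsymbol\lambda$ is $(p_1,\dots,p_5)$. *)

(* Defs.v *)
From HB Require Import structures.
From mathcomp Require Import all_boot all_order all_algebra.
From mathcomp Require Import all_fingroup all_solvable.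
From mathcomp Require Import mxrepresentation character.
From mathcomp Require Import complex.
From mathcomp Require Import all_classical all_reals all_analysis.

Set Implicit Arguments.
Unset Strict Implicit.
Unset Printing Implicit Defensive.

Import Order.TTheory GRing.Theory Num.Theory.
Import numFieldNormedType.Exports.

Local Open Scope classical_set_scope.
Local Open Scope complex_scope.
Local Open Scope ring_scope.

Section LinearFractionalTransformations.
Variable R : realType.
Local Notation C := R[i].

(* The Riemann S2 is [option C], with [None] the point at infinity. *)
Definition lft (M : 'M[C]_2) (w : option C) : option C :=
  let a := M 0 0 in let b := M 0 1 in let c := M 1 0 in let d := M 1 1 in
  match w with
  | Some z => if c * z + d == 0 then None else Some ((a * z + b) / (c * z + d))
  | None => if c == 0 then None else Some (a / c)
  end.

Definition is_lft (f : option C -> option C) : Prop :=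
  exists2 M : 'M[C]_2, M \in unitmx & f = lft M.

Definition lft_equivalent (A B : set (option C)) : Prop :=
  exists2 f, is_lft f & f @` A = B.

Definition lft_conjugate (f g : option C -> option C) : Prop :=
  exists2 h, is_lft h & h \o f = g \o h.

(* The unique LFT sending three distinct points to 0, 1, infinity; the default
   value [id] is only taken when the points are not distinct. *)
Definition lft_to01oo (p0 p1 p2 : option C) : option C -> option C :=
  xget (fun w : option C => w) [set f : option C -> option C | [/\ is_lft f, f p0 = Some 0, f p1 = Some 1 & f p2 = None]].

Definition rotation (theta : R) (w : option C) : option C :=
  omap (fun z => (cos theta +i* sin theta) * z) w.

End LinearFractionalTransformations.

Section Configurations.
Variables (R : realType) (d : nat).
Local Notation C := R[i].

(* Here [d] is n - 3. *)
Definition Kn : set 'rV[C]_d :=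
  [set l | [/\ forall i, l 0 i != 0, forall i, l 0 i != 1
             & forall i j, i != j -> l 0 i != l 0 j]].

Definition zpt (l : 'rV[C]_d) (k : 'I_(3 + d)) : option C :=
  match fintype.split k with
  | inl j => nth None [:: Some 0; Some 1; None] j
  | inr i => Some (l 0 i)
  end.

Definition zset (l : 'rV[C]_d) : set (option C) := range (zpt l).

Definition f_sigma (s : 'S_(3 + d)) (l : 'rV[C]_d) : option C -> option C :=
  let p (j : 'I_3) := zpt l ((s^-1)%g (lshift d j)) in
  lft_to01oo (p (inord 0)) (p (inord 1)) (p (inord 2)).

(* [g_s] as a total function; on [Kn] the values of [f_sigma s l] used here are
   finite, so that the default value [0] plays no role. *)
Definition g_sigma (s : 'S_(3 + d)) (l : 'rV[C]_d) : 'rV[C]_d :=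
  \row_i odflt 0 (f_sigma s l (zpt l ((s^-1)%g (rshift 3 i)))).

(* On [Kn], the maps [g_s] satisfy [g_p \o g_s = g_(p \o s)] and, for n >= 5,
   [s |-> g_s] is injective, so that the group of these maps is ['S_n] with
   composition of functions.  As the product [s * t] in ['S_n] is [t \o s], the
   element [s] of ['S_n] has to stand for the map [g_(s^-1)]: this makes
   [G_elt (s * t) = G_elt s \o G_elt t]. *)
Definition G_elt (s : 'S_(3 + d)) : 'rV[C]_d -> 'rV[C]_d := g_sigma s^-1%g.

Definition Phi_ (l : 'rV[C]_d) (s : 'S_(3 + d)) : option C -> option C :=
  f_sigma s^-1%g l.

Definition stabG (l : 'rV[C]_d) : {set 'S_(3 + d)} :=
  [set s | G_elt s l == l]%SET.

(* [jacobian] acts on row vectors, hence the transposition: the (i, j) entry is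
   the derivative of the i-th component along the j-th coordinate. *)
Definition X_mx (l : 'rV[C]_d) (s : 'S_(3 + d)) : 'M[C]_d :=
  (jacobian (G_elt s) l)^T.

Definition in_class (l : 'rV[C]_d) (j : 'I_5) (s : 'S_(3 + d)) : Prop :=
  s \in stabG l /\
  match val j with
  | 0%N => s = 1%g
  | k.+1 => lft_conjugate (Phi_ l s) (rotation
      (nth 0 [:: 2 * pi / 5; 4 * pi / 5; 2 * pi / 3; pi] k))
  end.

Definition golden : R := (1 + Num.sqrt 5) / 2.
Definition golden' : R := (1 - Num.sqrt 5) / 2.

(* Row [i]: the irreducible character; column [j]: the class of [in_class]. *)
Definition chi_I (i j : 'I_5) : C :=
  (nth 0 (nth [::] [:: [:: 1;  1;       1;        1; 1];
                       [:: 4; -1;      -1;        1; 0];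
                       [:: 5;  0;       0;       -1; 1];
                       [:: 3;  golden;  golden';  0; -1];
                       [:: 3;  golden'; golden;   0; -1]] i) j)%:C.

Definition has_multiplicity_vector (l : 'rV[C]_d) (p : 5.-tuple nat) : Prop :=
  exists (G : {group 'S_(3 + d)}) (X : mx_representation C G d)
         (Y : 'I_5 -> representation C G),
  [/\ stabG l = G :> {set _},
      forall s, s \in G -> X s = X_mx l s,
      forall i, mx_irreducible (Y i),
      forall i j s, in_class l j s -> \tr (Y i s) = chi_I i j
    & mx_rsim X (\big[dadd_grepr/grepr0]_(i < 5) muln_grepr (Y i) (tnth p i))].

End Configurations.

Section Dodecahedron.
Variable R : realType.
Local Notation C := R[i].

Definition vec3 (x y z : R) : 'rV[R]_3 := \row_j nth 0 [:: x; y; z] j.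

Definition dotp (u v : 'rV[R]_3) : R := (u *m v^T) 0 0.

Definition S2 : set 'rV[R]_3 := [set v | dotp v v = 1].

Definition radial (v : 'rV[R]_3) : 'rV[R]_3 := (Num.sqrt (dotp v v))^-1 *: v.

Definition stereo (v : 'rV[R]_3) : option C :=
  let x := v 0 0 in let y := v 0 1 in let z := v 0 (inord 2) in
  if z == 1 then None else Some ((x / (1 - z)) +i* (y / (1 - z))).

(* The 20 vertices (+-1, +-1, +-1), (0, +-1/phi, +-phi) and the cyclic
   permutations of the latter have norm [sqrt 3] before scaling. *)
Definition dodecahedron : seq 'rV[R]_3 :=
  let phi := golden R in
  let signs := [:: 1; -1] : seq R in
  [seq (Num.sqrt 3)^-1 *: v | v <-
    [seq vec3 p.1 p.2 c | p <- [seq (a, b) | a <- signs, b <- signs], c <- signs]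
    ++ [seq vec3 0 (a / phi) (b * phi) | a <- signs, b <- signs]
    ++ [seq vec3 (b * phi) 0 (a / phi) | a <- signs, b <- signs]
    ++ [seq vec3 (a / phi) (b * phi) 0 | a <- signs, b <- signs]].

(* The vertices of the face of the dodecahedron exposed by the direction [u]:
   for [u != 0] these form a vertex, an edge or a pentagon. *)
Definition exposed (u : 'rV[R]_3) : seq 'rV[R]_3 :=
  [seq v <- dodecahedron | all (fun w => dotp u w <= dotp u v) dodecahedron].

Definition barycenter (s : seq 'rV[R]_3) : 'rV[R]_3 :=
  (size s)%:R^-1 *: \sum_(v <- s) v.

Definition V_I : set 'rV[R]_3 := [set` dodecahedron].

Definition E_I : set 'rV[R]_3 :=
  [set radial (barycenter (exposed u)) | u in
     [set u | u != 0 /\ size (exposed u) = 2%N]].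

Definition F_I : set 'rV[R]_3 :=
  [set radial (barycenter (exposed u)) | u in
     [set u | u != 0 /\ (3 <= size (exposed u))%N]].

Definition rotation_group : set 'M[R]_3 :=
  [set A | [/\ A *m A^T = 1%:M, \det A = 1 & (fun v => v *m A) @` V_I = V_I]].

Definition B_I (a : 'rV[R]_3) : set 'rV[R]_3 :=
  [set a *m A | A in rotation_group].

(* [zset l] is LFT-equivalent to the union of [base] and of [m] distinct
   orbits of order 60. *)
Definition has_type (base : set 'rV[R]_3) (m : nat) (d : nat) (l : 'rV[C]_d) :
    Prop :=
  exists a : 'I_m -> 'rV[R]_3,
  [/\ forall i, S2 (a i),
      forall i, (B_I (a i) #= `I_60)%card,
      injective (fun i => B_I (a i))
    & lft_equivalent (zset l)
        (stereo @` (base `|` \bigcup_(i in [set: 'I_m]) B_I (a i)))].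

End Dodecahedron.

Arguments V_I {R}.
Arguments E_I {R}.
Arguments F_I {R}.

(* Main.v *)
Require Import Defs.
From HB Require Import structures.
From mathcomp Require Import all_boot all_order all_algebra.
From mathcomp Require Import all_fingroup all_solvable.
From mathcomp Require Import mxrepresentation character.
From mathcomp Require Import complex ring lra zify.
From mathcomp Require Import all_classical all_reals all_analysis.

Set Implicit Arguments.
Unset Strict Implicit.
Unset Printing Implicit Defensive.

Import Order.TTheory GRing.Theory Num.Theory.
Import numFieldNormedType.Exports.

Local Open Scope classical_set_scope.
Local Open Scope complex_scope.
Local Open Scope ring_scope.

(** The differential at [l] of the action on [Kn] is the action on the tangent
    space of the moduli space of n = 3 + d distinct points of the projective line:
    the tangent vectors at the marked points, modulo the three-dimensional space of
    global vector fields on the line ([jac_mx], [X_mxE]). On the first space, the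
    trace of an element s is the sum of its derivatives at the marked points that
    it fixes. The second one is the adjoint representation, where the trace is
    y + 1 with y the sum of the multipliers of s at its two fixed points; if M is a
    matrix of s, then y = (tr M)^2 / det M - 2. Hence the Jacobian matrix has trace
    -1 if s fixes two marked points, and -(y + 1) if it fixes none
    ([trace_jac_mx], [trace_jac2], [trace_jac0]).

    The dodecahedron enters only through the number of points. The sets [F_I],
    [V_I] and [E_I] are disjoint, stable under rotations, and have 12, 20 and 30
    elements ([F_IE], [V_IE], [E_IE], [size_FVE]); they are too small to meet an
    orbit of order 60, so that n = 12 a + 20 b + 30 c + 60 m, where a, b, c are 0 or
    1 according to the type ([has_type_card]). By congruences modulo 5 and 3 and by
    Burnside's lemma, this number alone implies that the elements of order 5, 3 and
    2 fix respectively 2 a, 2 b and 2 c marked points ([card_fixed_marks]). Thus the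
    character of the Jacobian representation is known.

    The irreducible representations with the prescribed characters are obtained from
    the stabilizer itself. Its action by conjugation on 2 x 2 matrices has character
    y + 2; by Cayley-Hamilton, y is 2, -2, -1 on the elements of order 1, 2, 3 and a
    root of x^2 + x - 1 on those of order 5 ([multiplier_sum2], [multiplier_sum3],
    [multiplier_sum5]). Removing the trivial representation gives one representation
    of degree 3, and the outer automorphism of the alternating group gives the other
    one; the tensor square of the first, minus itself and the trivial one, has degree
    5; the permutation representation minus the trivial one has degree 4. All these
    are virtual characters of norm 1 and positive degree, hence irreducible
    characters ([irr_of_virtual_char]). For an element conjugate to a rotation of
    angle t we have y = 2 cos t, which relates them to the given classes
    ([in_class_chars]).

    Since representations with the same character are similar ([eq_chi_rsim]), it
    remains to check linear equations for the multiplicities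
    ([multiplicity_vector_of_card]). *)

(** * Characters over an algebraically closed field of characteristic 0 *)

Section CharacterTheory.
Variables (F : numClosedFieldType) (gT : finGroupType) (G : {group gT}).
Local Notation reprG := (mx_representation F G).
Local Notation representation := (representation F G).

(** The inner product of characters, without division by the order of the group;
    the inverse plays the role of complex conjugation. *)
Definition char_dot (phi psi : gT -> F) : F := \sum_(g in G) phi g * psi g^-1%g.

Definition chi_of n (rG : reprG n) (g : gT) : F := \tr (rG g).

(** Schur's lemma: the kernel and the image of an intertwiner are submodules. *)
Lemma mx_hom_irr_rsim n1 n2 (rG1 : reprG n1) (rG2 : reprG n2) f :
    mx_irreducible rG1 -> mx_irreducible rG2 ->
    {in G, forall x, rG1 x *m f = f *m rG2 x} -> f != 0 ->
  mx_rsim rG1 rG2.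
Proof.
move=> /mx_irrP[n1_gt0 irr1] /mx_irrP[n2_gt0 irr2] homf nzf.
have free_f: row_free f.
  rewrite -kermx_eq0; apply/negPn/negP => nzK.
  have modK: mxmodule rG1 (kermx f).
    apply/mxmoduleP => x Gx; apply/sub_kermxP.
    by rewrite -mulmxA homf // mulmxA mulmx_ker mul0mx.
  have := irr1 _ modK nzK; rewrite -sub1mx => /sub_kermxP.
  by rewrite mul1mx => f0; rewrite f0 eqxx in nzf.
have full_f: row_full f.
  rewrite /row_full -(mxrank_gen f) -/(row_full _); apply: irr2; last first.
    by rewrite -mxrank_eq0 mxrank_gen mxrank_eq0.
  apply/mxmoduleP => x Gx.
  by rewrite (eqmxMr _ (genmxE f)) genmxE -homf // submxMl.
exists f => //; rewrite -(eqP free_f); exact/eqP.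
Qed.

Lemma averaging_hom n1 n2 (rG1 : reprG n1) (rG2 : reprG n2) E :
  let P := \sum_(g in G) rG1 g *m E *m rG2 g^-1%g in
  {in G, forall x, rG1 x *m P = P *m rG2 x}.
Proof.
move=> P x Gx; rewrite /P mulmx_sumr mulmx_suml.
rewrite [RHS](reindex_inj (mulgI x)) /=.
apply: eq_big => [y|y Gy]; first by rewrite groupMl.
rewrite invMg !repr_mxM ?groupV // -!mulmxA -repr_mxM ?groupV //.
by rewrite mulVg repr_mx1 mulmx1.
Qed.

(** The inner product in terms of averaged elementary matrices, to which Schur's
    lemma applies. *)
Lemma char_dotE n1 n2 (rG1 : reprG n1) (rG2 : reprG n2) :
  char_dot (chi_of rG1) (chi_of rG2) =
  \sum_i \sum_j (\sum_(g in G) rG1 g *m delta_mx i j *m rG2 g^-1%g) i j.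
Proof.
rewrite /char_dot (eq_bigr (fun g =>
   \sum_i \sum_j (rG1 g *m delta_mx i j *m rG2 g^-1%g) i j)); last first.
  move=> g Gg; rewrite /chi_of /mxtrace big_distrlr /=.
  apply: eq_bigr => i _; apply: eq_bigr => j _.
  rewrite mxE (bigD1 j) //= big1 ?addr0 => [|k nkj].
    rewrite mxE (bigD1 i) //= big1 ?addr0 => [|k nki].
      by rewrite mxE !eqxx mulr1.
    by rewrite mxE (negPf nki) mulr0.
  rewrite mxE big1 ?mul0r // => k' _.
  by rewrite mxE (negPf nkj) andbF mulr0.
rewrite exchange_big; apply: eq_bigr => i _; rewrite exchange_big.
by apply: eq_bigr => j _; rewrite summxE.
Qed.

(** Schur orthogonality: the average of a matrix over the group is an
    intertwiner, which is zero between dissimilar irreducible representations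
    and, for [char_dot_irr1], scalar on a single one. *)
Lemma char_dot_irr0 n1 n2 (rG1 : reprG n1) (rG2 : reprG n2) :
    mx_irreducible rG1 -> mx_irreducible rG2 -> ~ mx_rsim rG1 rG2 ->
  char_dot (chi_of rG1) (chi_of rG2) = 0.
Proof.
move=> irr1 irr2 nsim; rewrite char_dotE big1 // => i _; rewrite big1 // => j _.
set P := \sum_(g in G) _; suff /eqP -> : P == 0 by rewrite mxE.
apply: contra_notT nsim; apply: mx_hom_irr_rsim => //; exact: averaging_hom.
Qed.

Lemma char_dot_irr1 n (rG : reprG n) :
  mx_irreducible rG -> char_dot (chi_of rG) (chi_of rG) = #|G|%:R.
Proof.
move=> irr; have n_gt0 : (0 < n)%N by have /mx_irrP[] := irr.
have n_neq0 : n%:R != 0 :> F by rewrite pnatr_eq0 -lt0n.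
have absirr : mx_absolutely_irreducible rG.
  exact: (@group_closure_closed_field F gT G n rG irr).
pose P i j := \sum_(g in G) rG g *m delta_mx i j *m rG g^-1%g.
have PE i j : P i j = (#|G|%:R / n%:R *+ (i == j))%:M.
  have /is_scalar_mxP[c Pc] : is_scalar_mx (P i j).
    apply: mx_abs_irr_cent_scalar absirr _ _; apply/centgmxP => x Gx.
    by rewrite -(averaging_hom _ _ _ Gx).
  have trP : \tr (P i j) = #|G|%:R *+ (i == j).
    rewrite /P raddf_sum /= (eq_bigr (fun=> (i == j)%:R)) => [|g Gg].
      by rewrite sumr_const mulrnAC.
    rewrite mxtrace_mulC mulmxA -repr_mxM ?groupV // mulVg repr_mx1 mul1mx.
    rewrite /mxtrace (bigD1 i) //= mxE eqxx andTb big1 ?addr0 => [//|k nki].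
    by rewrite mxE (negPf nki).
  move: trP; rewrite Pc mxtrace_scalar => trc; congr (_ %:M).
  by rewrite -mulrnAl -trc -[c *+ n]mulr_natr mulfK.
transitivity (\sum_i \sum_j (P i j) i j); first by rewrite char_dotE.
rewrite (eq_bigr (fun=> #|G|%:R / n%:R)) => [|i _].
  by rewrite sumr_const card_ord -[LHS]mulr_natr divfK.
rewrite (bigD1 i) //= big1 ?addr0 => [|j nji].
  by rewrite PE mxE !eqxx.
by rewrite PE mxE eq_sym (negPf nji).
Qed.

Lemma chi_of_rsim n1 n2 (rG1 : reprG n1) (rG2 : reprG n2) :
  mx_rsim rG1 rG2 -> {in G, chi_of rG1 =1 chi_of rG2}.
Proof. by move=> sim g Gg; apply: mxtrace_rsim. Qed.

Lemma eq_char_dot phi phi' psi psi' :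
  {in G, phi =1 phi'} -> {in G, psi =1 psi'} ->
  char_dot phi psi = char_dot phi' psi'.
Proof.
by move=> e1 e2; apply: eq_bigr => g Gg; rewrite e1 ?e2 // groupV.
Qed.

Lemma rsim_dadd (A A' B B' : representation) :
  mx_rsim A A' -> mx_rsim B B' -> mx_rsim (dadd_grepr A B) (dadd_grepr A' B').
Proof.
case=> f eqA freef homf [h eqB freeh homh].
exists (block_mx f 0 0 h) => [/=||x Gx]; first by rewrite eqA eqB.
  have [f' ff'] := row_freeP freef; have [h' hh'] := row_freeP freeh.
  apply/row_freeP; exists (block_mx f' 0 0 h').
  by rewrite mulmx_block !mulmx0 !mul0mx !addr0 !add0r ff' hh' -scalar_mx_block.
by rewrite !mulmx_block !mulmx0 !mul0mx !addr0 !add0r homf ?homh.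
Qed.

(** With [rsim_dadd], this reorders the terms of a direct sum. *)
Lemma rsim_daddCA (A B D : representation) :
  mx_rsim (dadd_grepr A (dadd_grepr B D)) (dadd_grepr B (dadd_grepr A D)).
Proof.
pose T (a b c : nat) : 'M[F]_(a + (b + c), b + (a + c)) :=
  block_mx 0 (row_mx 1%:M 0) (col_mx 1%:M 0) (block_mx 0 0 0 1%:M).
exists (T (rdegree A) (rdegree B) (rdegree D)) => [/=||x Gx]; first by lia.
  apply/row_freeP; exists (T (rdegree B) (rdegree A) (rdegree D)).
  rewrite /T mulmx_block ?mul0mx ?mulmx0 ?add0r mul_row_col mul_mx_row.
  rewrite mul_col_mx ?(mul_col_row, mul_row_block, mul_block_col, mulmx_block).
  rewrite ?(mulmx1, mul1mx, mulmx0, mul0mx, addr0, add0r).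
  rewrite mul_row_col ?(mulmx1, mul1mx, mulmx0, mul0mx, addr0, add0r).
  rewrite mul_row_col ?(mulmx1, mul1mx, mulmx0, mul0mx, addr0, add0r).
  rewrite row_mx0 col_mx0 -[X in row_mx _ X]col_mx0 -block_mxEh.
  rewrite -[X in col_mx X _]row_mx0 -block_mxEv.
  by rewrite add_block_mx ?(addr0, add0r) -!scalar_mx_block.
rewrite /= /T !mulmx_block ?(mulmx1, mul1mx, mulmx0, mul0mx, addr0, add0r).
rewrite !mul_mx_row !mul_col_mx !mul_row_block !mul_row_col.
by rewrite ?(mulmx1, mul1mx, mulmx0, mul0mx, addr0, add0r).
Qed.

Let sG : irrType F G := DecSocleType _.

Lemma pcharG' : ([pchar F]^'.-group G)%g.
Proof.
apply/pgroupP => p _ _; have /= p'F := @pchar_num F p; rewrite inE /= in p'F.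
by rewrite inE /= unfold_in /= p'F.
Qed.

Definition irr_grepr (i : sG) : representation := Representation (irr_repr i).

Definition dsum_irr (s : seq sG) : representation :=
  \big[dadd_grepr/grepr0]_(i <- s) irr_grepr i.

Lemma irr_grepr_irr i : mx_irreducible (irr_grepr i).
Proof. exact: socle_irr. Qed.

Lemma irr_grepr_rsim i j : mx_rsim (irr_grepr i) (irr_grepr j) -> i = j.
Proof. by move/socle_rsimP/eqP. Qed.

Lemma char_dot_irr i j :
  char_dot (chi_of (irr_grepr i)) (chi_of (irr_grepr j)) = #|G|%:R *+ (i == j).
Proof.
have [->|neq_ij] := eqVneq i j.
  exact/char_dot_irr1/irr_grepr_irr.
apply: char_dot_irr0; try exact: irr_grepr_irr.
by move=> /irr_grepr_rsim/eqP; apply/negP.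
Qed.

(** Maschke's theorem; a list of constituents has multiplicities that can be
    compared by counting. *)
Lemma rsim_dsum_irr n (rG : reprG n) : exists s, mx_rsim rG (dsum_irr s).
Proof.
have redG := mx_Maschke_pchar rG pcharG'.
apply/asboolP; apply: (mx_reducible_semisimple (mxmodule1 rG) redG).
case=> I U W simU defU dxU; apply/asboolP.
pose rU i := submod_repr (mxsimple_module (simU i)).
exists [seq irr_comp sG (rU i) | i <- index_enum I].
rewrite /dsum_irr big_map; apply: mx_rsim_trans.
  exact: mx_rsim_sym (rsim_submod1 (mxmodule1 rG) (eqmx_refl _)).
apply: (@mx_rsim_dsum _ _ _ _ rG I xpredT U _ _
  (fun i => mxsimple_module (simU i)) (mxmodule1 rG) defU dxU) => i.
by apply: (rsim_irr_comp_pchar sG pcharG'); apply/submod_mx_irr.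
Qed.

Lemma dsum_irr_rem i s : i \in s ->
  mx_rsim (dsum_irr s) (dadd_grepr (irr_grepr i) (dsum_irr (rem i s))).
Proof.
elim: s => // j s IHs; rewrite inE.
have -> : rem i (j :: s) = if j == i then s else j :: rem i s by [].
rewrite [j == i]eq_sym; have [-> _|neq_ij] := eqVneq i j.
  rewrite /dsum_irr big_cons; exact: mx_rsim_refl.
rewrite orFb => s_i; rewrite /dsum_irr !big_cons.
apply: mx_rsim_trans (rsim_daddCA _ _ _).
by apply: rsim_dadd; [apply: mx_rsim_refl | apply: IHs].
Qed.

Lemma dsum_irr_perm s t : perm_eq s t -> mx_rsim (dsum_irr s) (dsum_irr t).
Proof.
elim: s t => [|i s IHs] t; first by rewrite perm_sym => /perm_nilP->; apply: mx_rsim_refl.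
move=> perm_st; have t_i : i \in t by rewrite -(perm_mem perm_st) mem_head.
apply: mx_rsim_trans (mx_rsim_sym (dsum_irr_rem t_i)).
rewrite (_ : dsum_irr (i :: s) = dadd_grepr (irr_grepr i) (dsum_irr s)).
  apply: rsim_dadd; first exact: mx_rsim_refl.
  apply: IHs; rewrite -(perm_cons i).
  by rewrite (perm_trans perm_st) // perm_to_rem.
by rewrite /dsum_irr big_cons.
Qed.

Lemma chi_of_dadd (A B : representation) g :
  chi_of (dadd_grepr A B) g = chi_of A g + chi_of B g.
Proof. by rewrite /chi_of mxtrace_block. Qed.

Lemma chi_of_bigdadd (I : Type) (r : seq I) (Y : I -> representation) g :
  chi_of (\big[dadd_grepr/grepr0]_(i <- r) Y i) g = \sum_(i <- r) chi_of (Y i) g.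
Proof.
elim: r => [|i r IHr]; last by rewrite !big_cons chi_of_dadd IHr.
by rewrite !big_nil /chi_of mxtrace1.
Qed.

Lemma chi_of_muln (Y : representation) k g :
  chi_of (muln_grepr Y k) g = chi_of Y g *+ k.
Proof. by rewrite chi_of_bigdadd sumr_const card_ord. Qed.

Lemma chi_of_dsum_irr s g :
  chi_of (dsum_irr s) g = \sum_i chi_of (irr_grepr i) g *+ count_mem i s.
Proof.
rewrite chi_of_bigdadd; elim: s => [|j s IHs]; first by rewrite big_nil big1.
have countE i : count_mem i (j :: s) = ((j == i) + count_mem i s)%N by [].
rewrite big_cons IHs; under [RHS]eq_bigr do rewrite countE mulrnDr.
rewrite big_split; congr (_ + _); rewrite (bigD1 j) //= eqxx mulr1n.
rewrite big1 ?addr0 // => i; by rewrite eq_sym => /negPf->.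
Qed.

Lemma char_dot_dsum_irr s i :
  char_dot (chi_of (dsum_irr s)) (chi_of (irr_grepr i)) =
  #|G|%:R *+ count_mem i s.
Proof.
transitivity (\sum_j
  char_dot (chi_of (irr_grepr j)) (chi_of (irr_grepr i)) *+ count_mem j s).
  rewrite /char_dot; under eq_bigr do rewrite chi_of_dsum_irr mulr_suml.
  rewrite exchange_big; apply: eq_bigr => j _; rewrite -sumrMnl.
  by apply: eq_bigr => g _; rewrite mulrnAl.
rewrite (bigD1 i) // char_dot_irr eqxx big1 => [|j neq_ji].
  exact: addr0.
by rewrite char_dot_irr (negPf neq_ji) mul0rn.
Qed.

Lemma cardG_neq0 : #|G|%:R != 0 :> F.
Proof. by rewrite pnatr_eq0 -lt0n cardG_gt0. Qed.

(** The multiplicities of the irreducible constituents can be read off the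
    character, by orthogonality. *)
Lemma eq_chi_rsim n1 n2 (rG1 : reprG n1) (rG2 : reprG n2) :
  {in G, chi_of rG1 =1 chi_of rG2} -> mx_rsim rG1 rG2.
Proof.
move=> eq_chi; have [s1 sim1] := rsim_dsum_irr rG1.
have [s2 sim2] := rsim_dsum_irr rG2.
apply: (mx_rsim_trans sim1 (mx_rsim_trans _ (mx_rsim_sym sim2))).
apply: dsum_irr_perm; apply/allP => i _ /=; apply/eqP.
have /eqP : #|G|%:R *+ count_mem i s1 = #|G|%:R *+ count_mem i s2 :> F.
  rewrite -!char_dot_dsum_irr; apply: eq_char_dot => // g Gg.
  by rewrite -(chi_of_rsim sim1) // eq_chi // (chi_of_rsim sim2).
rewrite -[_ *+ count_mem i s1]mulr_natr -[_ *+ count_mem i s2]mulr_natr.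
by rewrite (inj_eq (mulfI cardG_neq0)) eqr_nat => /eqP.
Qed.

(** A virtual character of norm 1 and positive degree is an irreducible
    character: by orthogonality, its norm is the sum of the squares of its
    integral coordinates on the irreducible characters. *)
Lemma irr_of_virtual_char n1 n2 (rG1 : reprG n1) (rG2 : reprG n2) :
    let phi g := chi_of rG1 g - chi_of rG2 g in
    char_dot phi phi = #|G|%:R -> (n2 < n1)%N ->
  exists Y : representation, mx_irreducible Y /\ {in G, chi_of Y =1 phi}.
Proof.
move=> phi norm_phi lt_n21.
have [s1 sim1] := rsim_dsum_irr rG1; have [s2 sim2] := rsim_dsum_irr rG2.
pose k i : int := (count_mem i s1)%:Z - (count_mem i s2)%:Z.
have phiE : {in G, phi =1 fun g => \sum_i chi_of (irr_grepr i) g *~ k i}.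
  move=> g Gg; rewrite /phi (chi_of_rsim sim1) // (chi_of_rsim sim2) //.
  rewrite !chi_of_dsum_irr -sumrB; apply: eq_bigr => i _.
  by rewrite /k mulrzBr !pmulrn.
have dot_irr i : char_dot phi (chi_of (irr_grepr i)) = #|G|%:R *~ k i.
  rewrite /k mulrzBr -!pmulrn -!char_dot_dsum_irr /char_dot -sumrB.
  apply: eq_bigr => g Gg; rewrite -mulrBl /phi.
  by rewrite (chi_of_rsim sim1) // (chi_of_rsim sim2).
have dot_phi : char_dot phi phi = \sum_i #|G|%:R * (k i ^+ 2)%:~R.
  rewrite (eq_char_dot (fun _ _ => erefl) phiE) /char_dot.
  under eq_bigr do rewrite mulr_sumr; rewrite exchange_big.
  apply: eq_bigr => i _; transitivity (char_dot phi (chi_of (irr_grepr i)) *~ k i).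
    rewrite -mulrzr mulr_suml; apply: eq_bigr => g Gg.
    by rewrite -mulrzr mulrA.
  by rewrite dot_irr -mulrzA -mulrzr expr2.
have sum_k2 : \sum_i k i ^+ 2 = 1.
  apply: (@intr_inj F); apply: (mulfI cardG_neq0).
  by rewrite mulr1 -[RHS]norm_phi dot_phi raddf_sum mulr_sumr.
have [i0 k_i0|k0] := pickP (fun i => k i != 0); last first.
  have := sum_k2; rewrite big1 ?(eq_sym 0) // => i _.
  by have /negbFE/eqP-> := k0 i; rewrite expr0n.
have k2_ge0 i : 0 <= k i ^+ 2 by apply: sqr_ge0.
have := sum_k2; rewrite (bigD1 i0) //= => sumE.
have rest_ge0 : 0 <= \sum_(i | i != i0) k i ^+ 2 by apply: sumr_ge0.
have k_i0_gt0 : 0 < k i0 ^+ 2 by rewrite exprn_even_gt0.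
have [k_i0_1 rest0] : k i0 ^+ 2 = 1 /\ \sum_(i | i != i0) k i ^+ 2 = 0.
  move: sumE rest_ge0 k_i0_gt0.
  by move: (k i0 ^+ 2) (\sum_(i | _) _) => a b; lia.
have k_rest i : i != i0 -> k i = 0.
  move=> ni0; move/eqP: rest0; rewrite psumr_eq0 // => /allP/(_ i); rewrite mem_index_enum ni0 /=.
  by move=> /(_ isT); rewrite sqrf_eq0 => /eqP.
have phi_i0 : {in G, phi =1 fun g => chi_of (irr_grepr i0) g *~ k i0}.
  move=> g Gg; rewrite phiE // (bigD1 i0) //= big1 ?addr0 // => i ni0.
  by rewrite k_rest ?mulr0z.
have k1 : k i0 = 1.
  move/eqP: k_i0_1; rewrite sqrf_eq1 => /orP[/eqP//|/eqP km1]; have := phi_i0 1%g (group1 G).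
  rewrite /phi /chi_of !repr_mx1 !mxtrace1 km1 mulrN1z => /eqP.
  rewrite eq_sym -subr_eq0 -opprD oppr_eq0.
  by rewrite gt_eqF // ltr_wpDl ?ler0n // subr_gt0 ltr_nat.
exists (irr_grepr i0); split=> [|g Gg]; first exact: irr_grepr_irr.
by rewrite phi_i0 // k1 mulr1z.
Qed.

End CharacterTheory.

(** * The alternating group of degree 5 *)

Section AlternatingGroup5.
Local Open Scope nat_scope.
Local Notation Alt5 := ('Alt_('I_5))%g.

(** A permutation is coded by the list of its values; the facts about the group
    are then decided by evaluation over the 60 codes of even permutations. *)
Definition perm_code (s : 'S_5) : seq nat :=
  [seq val (s (inord i)) | i <- iota 0 5].

Definition code_mul (l1 l2 : seq nat) : seq nat := [seq nth 0 l2 i | i <- l1].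

Definition codes5 := permutations (iota 0 5).

(** In degree 5 the even permutations are exactly the squares. *)
Definition square_codes := undup [seq code_mul l l | l <- codes5].

Lemma nth_perm_code s (i : 'I_5) : nth 0 (perm_code s) i = s i.
Proof. by rewrite (nth_map 0) ?size_iota // nth_iota // add0n inord_val. Qed.

Lemma perm_code_inj : injective perm_code.
Proof.
move=> s t eq_st; apply/permP => i; apply: val_inj.
by rewrite /= -!nth_perm_code eq_st.
Qed.

Lemma perm_codeM s t : perm_code (s * t)%g = code_mul (perm_code s) (perm_code t).
Proof.
rewrite /code_mul -map_comp; apply: eq_map => i /=.
by rewrite permM nth_perm_code.
Qed.

Lemma perm_code1 : perm_code 1 = iota 0 5.
Proof.
rewrite -[RHS]map_id; apply/eq_in_map => i; rewrite mem_iota => /andP[_ lti].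
by rewrite perm1 /= inordK.
Qed.

Lemma perm_codeP l : reflect (exists s, l = perm_code s) (l \in codes5).
Proof.
rewrite mem_permutations; apply: (iffP idP) => [perm_l | [s ->]]; last first.
  apply: uniq_perm; rewrite ?iota_uniq //.
    rewrite map_inj_in_uniq ?iota_uniq // => i j; rewrite !mem_iota !add0n.
    move=> /andP[_ lti] /andP[_ ltj] /val_inj/perm_inj/(congr1 val) /=.
    by rewrite !inordK.
  move=> k; rewrite mem_iota; apply/mapP/idP => [[i _ ->] | /andP[_ ltk]].
    by rewrite /= ltn_ord.
  exists (val (s^-1%g (inord k))); first by rewrite mem_iota /=.
  by rewrite inord_val permKV /= inordK.
have size_l : size l = 5 by rewrite (perm_size perm_l).
have uniq_l : uniq l by rewrite (perm_uniq perm_l) iota_uniq.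
have ltl i : i < 5 -> nth 0 l i < 5.
  move=> lti; have : nth 0 l i \in l by rewrite mem_nth ?size_l.
  by rewrite (perm_mem perm_l) mem_iota.
have inj_l : injective (fun i : 'I_5 => inord (nth 0 l i) : 'I_5).
  move=> i j /(congr1 val); rewrite /= !inordK ?ltl // => /eqP.
  by rewrite nth_uniq ?size_l // => /eqP/val_inj.
exists (perm inj_l); apply: (@eq_from_nth _ 0) => [|k].
  by rewrite size_map size_iota.
rewrite size_l => ltk; rewrite -[k]/(val (Ordinal ltk)) nth_perm_code permE.
by rewrite /= inordK ?ltl.
Qed.

Lemma card_perm_code (L : seq (seq nat)) : uniq L -> {subset L <= codes5} ->
  #|[set s | perm_code s \in L]%SET| = size L.
Proof.
move=> uniq_L sub_L; rewrite cardsE cardE -(size_map perm_code); apply: perm_size.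
apply: uniq_perm => // [|l].
  by rewrite (map_inj_uniq perm_code_inj) enum_uniq.
apply/mapP/idP => [[s] | Ll]; first by rewrite mem_enum => Ls ->.
have /perm_codeP[s def_l] := sub_L l Ll.
by exists s => //; rewrite mem_enum unfold_in -def_l.
Qed.

Lemma sub_square_codes : {subset square_codes <= codes5}.
Proof. by apply/allP; vm_compute. Qed.

(** Squares are even, and there are 60 of them. *)
Lemma mem_Alt5 s : (s \in Alt5) = (perm_code s \in square_codes).
Proof.
have -> : Alt5 = [set s | perm_code s \in square_codes]%SET :> {set _}.
  apply/esym/eqP; rewrite eqEcard card_perm_code ?undup_uniq //; last first.
    exact: sub_square_codes.
  apply/andP; split; last first.
    have := @card_Alt 'I_5; rewrite card_ord => /(_ isT) /= cardA.
    by rewrite -(leq_pmul2l (_ : 0 < 2)) // cardA.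
  apply/fintype.subsetP => t; rewrite inE mem_undup => /mapP[l /perm_codeP[u ->]].
  rewrite -perm_codeM => /perm_code_inj->.
  by rewrite Alt_even odd_permM addbb.
by rewrite inE.
Qed.

Lemma Alt5_forall (P : pred (seq nat)) : all P square_codes ->
  forall s, s \in Alt5 -> P (perm_code s).
Proof. by move=> /allP allP s; rewrite mem_Alt5 => /allP. Qed.

Lemma Alt5_exists (P : pred (seq nat)) : has P square_codes ->
  exists2 s, s \in Alt5 & P (perm_code s).
Proof.
case/hasP=> l Ll Pl; have /perm_codeP[s def_l] := sub_square_codes Ll.
by exists s; rewrite ?mem_Alt5 -def_l.
Qed.

(** The value 0 is a default for the other orders. *)
Definition code_order l :=
  let e := iota 0 5 in let l2 := code_mul l l in
  if l == e then 1 else if l2 == e then 2 else if code_mul l l2 == e then 3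
  else if code_mul l (code_mul l2 l2) == e then 5 else 0.

Lemma code_orderE s : s \in Alt5 -> #[s]%g = code_order (perm_code s).
Proof.
move=> As; have : code_order (perm_code s) != 0.
  by apply: (Alt5_forall (P := fun l => code_order l != 0)) As; vm_compute.
rewrite /code_order -perm_code1 -!perm_codeM !(inj_eq perm_code_inj).
have [->|nt_s] := eqVneq s 1%g; first by rewrite order1.
have [s2 _|_] := eqVneq (s * s)%g 1%g; first exact: nt_prime_order.
have [s3 _|_] := eqVneq (s * (s * s))%g 1%g; first exact: nt_prime_order.
have [s5 _|//] := eqVneq (s * (s * s * (s * s)))%g 1%g.
by apply: nt_prime_order => //; rewrite -s5 !expgS expg0 mulg1 !mulgA.
Qed.

Lemma Alt5_order s : s \in Alt5 -> #[s]%g \in [:: 1; 2; 3; 5].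
Proof.
move=> As; rewrite code_orderE //; move: s As.
by apply: (Alt5_forall (P := fun l => code_order l \in [:: 1; 2; 3; 5])); vm_compute.
Qed.

Lemma card_Alt5_order k :
  #|[set s in Alt5 | #[s]%g == k]%SET| =
  count (fun l => code_order l == k) square_codes.
Proof.
rewrite -size_filter -card_perm_code ?filter_uniq ?undup_uniq //; last first.
  by move=> l; rewrite mem_filter => /andP[_ /sub_square_codes].
apply: eq_card => s; rewrite finset.in_set [RHS]finset.in_set mem_filter -mem_Alt5.
by case As: (s \in Alt5); rewrite ?andbF // code_orderE ?andbT.
Qed.

(** In the table, indexed by the order, the entries at 0 and 4 are defaults. *)
Lemma Alt5_fix s : s \in Alt5 ->
  #|[set i | s i == i]%SET| = nth 0 [:: 0; 5; 1; 2; 0; 0] #[s]%g.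
Proof.
move=> As; rewrite code_orderE //.
have -> : #|[set i | s i == i]%SET| =
    count (fun i => nth 0 (perm_code s) i == i) (iota 0 5).
  rewrite -val_enum_ord count_map cardsE cardE size_filter -enumT.
  by apply: eq_count => i; rewrite /= nth_perm_code.
apply/eqP; move: s As.
by apply: (Alt5_forall (P := fun l => count (fun i => nth 0 l i == i) (iota 0 5)
  == nth 0 [:: 0; 5; 1; 2; 0; 0] (code_order l))); vm_compute.
Qed.

Lemma Alt5_involutions_conj s t : s \in Alt5 -> t \in Alt5 ->
  #[s]%g = 2 -> #[t]%g = 2 -> exists2 c, c \in Alt5 & t = (s ^ c)%g.
Proof.
move=> As At; rewrite !code_orderE // => /eqP os /eqP ot.
pose P l1 l2 l := code_mul l1 l == code_mul l l2.
have : has (P (perm_code s) (perm_code t)) square_codes.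
  move: t At ot; move: s As os; have allP :
     all (fun l => (code_order l == 2) ==>
       all (fun m => (code_order m == 2) ==> has (P l m) square_codes)
           square_codes) square_codes by vm_compute.
  move=> s As os t At ot; have /implyP/(_ os) := Alt5_forall allP As.
  by move=> /Alt5_forall/(_ t At)/implyP/(_ ot).
case/Alt5_exists=> c Ac; rewrite /P -!perm_codeM (inj_eq perm_code_inj).
by move=> /eqP sc; exists c => //; rewrite conjgE sc mulKg.
Qed.

(** Conjugation by a transposition exchanges the two classes of 5-cycles. *)
Lemma Alt5_odd_conj_square (s := tperm (inord 0) (inord 1) : 'S_5) t :
    t \in Alt5 -> #[t]%g = 5 ->
  exists2 c, c \in Alt5 & ((t ^+ 2) ^ c)%g = (t ^ s)%g.
Proof.
move=> At; rewrite code_orderE // => /eqP ot.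
have codes : perm_code s = [:: 1; 0; 2; 3; 4].
  rewrite /perm_code /s /= !permE /=.
  by rewrite -!val_eqE /= !inordK.
pose P m l := code_mul (code_mul m m) l ==
  code_mul l (code_mul (perm_code s) (code_mul m (perm_code s))).
have : has (P (perm_code t)) square_codes.
  move: t At ot; have allP : all (fun m => (code_order m == 5) ==>
     has (P m) square_codes) square_codes by rewrite /P codes; vm_compute.
  by move=> t At; apply/implyP: (Alt5_forall allP At).
case/Alt5_exists=> c Ac; rewrite /P -!perm_codeM (inj_eq perm_code_inj).
by move=> /eqP sc; exists c => //; rewrite !conjgE tpermV -expg2 in sc *; rewrite sc mulKg.
Qed.

End AlternatingGroup5.

(** * Linear fractional transformations in homogeneous coordinates *)

Section Matrix2.
Variable F : fieldType.
Implicit Types (M N : 'M[F]_2) (v : 'cV[F]_2).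

Lemma ord2P (P : 'I_2 -> Prop) : P 0 -> P 1 -> forall i, P i.
Proof.
move=> P0 P1 [[|[|//]] i_lt]; first by rewrite (_ : Ordinal _ = 0) //; apply: val_inj.
by rewrite (_ : Ordinal _ = 1) //; apply: val_inj.
Qed.

Lemma matrix2P M N :
  M 0 0 = N 0 0 -> M 0 1 = N 0 1 -> M 1 0 = N 1 0 -> M 1 1 = N 1 1 -> M = N.
Proof.
move=> e00 e01 e10 e11; apply/matrixP.
by apply: ord2P; apply: ord2P.
Qed.

Lemma sum_ord2 (f : 'I_2 -> F) : \sum_i f i = f 0 + f 1.
Proof. by rewrite !big_ord_recl big_ord0 addr0; congr (f _ + f _); apply: val_inj. Qed.

Lemma mul_mx2E n M (N : 'M[F]_(2, n)) i j : (M *m N) i j = M i 0 * N 0 j + M i 1 * N 1 j.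
Proof. by rewrite mxE sum_ord2. Qed.

Lemma mxtrace2 M : \tr M = M 0 0 + M 1 1.
Proof. exact: sum_ord2. Qed.

Lemma det_mx2 M : \det M = M 0 0 * M 1 1 - M 0 1 * M 1 0.
Proof.
rewrite (expand_det_row _ 0) sum_ord2 /cofactor !det_mx11 !mxE /=.
have -> : lift 0 0 = 1 :> 'I_2 by apply: val_inj.
have -> : lift 1 0 = 0 :> 'I_2 by apply: val_inj.
by rewrite /= addn0 expr0 expr1 mul1r mulN1r mulrN.
Qed.

(** Cayley-Hamilton, iterated: every power of [M] is a combination of [M] and 1,
    so that for a matrix [M] that is not scalar, the power is scalar only if its
    coefficient on [M] vanishes. *)
Lemma mx2_powers M (t := \tr M) (u := \det M) :
  [/\ M *m M = t *: M - u%:M,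
      M *m (M *m M) = (t ^+ 2 - u) *: M - (t * u)%:M
    & M *m (M *m (M *m (M *m M))) =
        (t ^+ 4 - 3%:R * t ^+ 2 * u + u ^+ 2) *: M -
        ((t ^+ 3 - 2%:R * t * u) * u)%:M].
Proof.
rewrite /t /u mxtrace2 det_mx2.
by split; apply: matrix2P; rewrite !mul_mx2E !mxE /= ?mulr1n ?mulr0n; ring.
Qed.

Lemma scale_nonscalar M a b : (a *: M - b%:M = 0 -> ~~ is_scalar_mx M -> a = 0)%R.
Proof.
move=> /eqP; rewrite subr_eq0 => /eqP aM; apply: contraNeq => nz_a.
apply/is_scalar_mxP; exists (a^-1 * b).
by rewrite -scale_scalar_mx -aM scalerA mulVf ?scale1r.
Qed.

(** The sum of the multipliers, i.e. derivatives, at the two fixed points of the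
    linear fractional transformation; it is a conjugacy invariant that does not
    change when the matrix is scaled. *)
Definition multiplier_sum M : F := \tr M ^+ 2 / \det M - 2%:R.

Lemma multiplier_sum_scale M c : c != 0 ->
  multiplier_sum (c *: M) = multiplier_sum M.
Proof.
move=> nz_c; rewrite /multiplier_sum linearZ /= detZ exprMn invfM.
by rewrite mulrACA divff ?mul1r // expf_neq0.
Qed.

(** For a transformation of order 2, 3 or 5, the multipliers are two inverse
    roots of unity of this order; [mx2_powers] gives the equation of their sum
    without diagonalization. *)
Lemma multiplier_sum2 M : \det M != 0 -> ~~ is_scalar_mx M ->
  is_scalar_mx (M *m M) -> multiplier_sum M = - 2%:R.
Proof.
move=> nz_det nscM /is_scalar_mxP[c]; have [-> _ _] := mx2_powers M.
move/eqP; rewrite -subr_eq0 -addrA -opprD -raddfD /= => /eqP.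
by move/scale_nonscalar/(_ nscM) => t0; rewrite /multiplier_sum t0 expr0n mul0r sub0r.
Qed.

Lemma multiplier_sum3 M : \det M != 0 -> ~~ is_scalar_mx M ->
  is_scalar_mx (M *m (M *m M)) -> multiplier_sum M = - 1.
Proof.
move=> nz_det nscM /is_scalar_mxP[c]; have [_ -> _] := mx2_powers M.
move/eqP; rewrite -subr_eq0 -addrA -opprD -raddfD /= => /eqP.
move/scale_nonscalar/(_ nscM)/eqP; rewrite subr_eq0 => /eqP t0.
by rewrite /multiplier_sum t0 divff //; ring.
Qed.

Lemma multiplier_sum5 M (y := multiplier_sum M) : \det M != 0 ->
    ~~ is_scalar_mx M -> is_scalar_mx (M *m (M *m (M *m (M *m M)))) ->
  y ^+ 2 + y = 1.
Proof.
move=> nz_det nscM /is_scalar_mxP[c]; have [_ _ ->] := mx2_powers M.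
move/eqP; rewrite -subr_eq0 -addrA -opprD -raddfD /= => /eqP.
move/scale_nonscalar/(_ nscM) => t0.
rewrite /y /multiplier_sum; apply/eqP; rewrite -subr_eq0; apply/eqP.
by rewrite -[RHS](mul0r (\det M ^- 2)) -t0; field.
Qed.

End Matrix2.

Section HomogeneousCoordinates.
Variable F : fieldType.
Implicit Types (p q r : option F) (M N : 'M[F]_2).

Definition hx p : F := if p is Some z then z else 1.
Definition hy p : F := if p is Some _ then 1 else 0.

Definition hvec p : 'cV[F]_2 := \col_i (if i == 0 then hx p else hy p).

(** The determinant of the homogeneous coordinates of two points. *)
Definition bracket p q : F := hx p * hy q - hx q * hy p.

Lemma bracket_eq0 p q : (bracket p q == 0) = (p == q).
Proof.
rewrite /bracket; case: p q => [z|] [w|] /=.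
- by rewrite !mulr1 subr_eq0; apply/eqP/eqP => [->|[]].
- by rewrite mulr0 mulr1 sub0r oppr_eq0 oner_eq0.
- by rewrite mulr0 mulr1 subr0 oner_eq0.
- by rewrite !mulr0 subr0 !eqxx.
Qed.

Lemma cV2P (u v : 'cV[F]_2) : u 0 0 = v 0 0 -> u 1 0 = v 1 0 -> u = v.
Proof.
by move=> e0 e1; apply/colP; apply: ord2P; rewrite ?e0 ?e1.
Qed.

(** The factor is recorded because it determines the derivative of the
    transformation at [p], at infinity as elsewhere. *)
Definition maps_to M c p q := c != 0 /\ M *m hvec p = c *: hvec q.

Lemma maps_toE M c p q : maps_to M c p q <->
  [/\ c != 0, M 0 0 * hx p + M 0 1 * hy p = c * hx q
    & M 1 0 * hx p + M 1 1 * hy p = c * hy q].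
Proof.
split=> [[nz_c /matrixP E]|[nz_c E0 E1]].
  have := (E 0 0, E 1 0); rewrite !mul_mx2E !mxE /=.
  by case=> E0 E1; split.
by split=> //; apply: cV2P; rewrite !mul_mx2E !mxE.
Qed.

Lemma maps_to_fun M c c' p q q' : maps_to M c p q -> maps_to M c' p q' -> q = q'.
Proof.
move=> /maps_toE[nz_c E0 E1] /maps_toE[nz_c' E0' E1'].
apply/eqP; rewrite -bracket_eq0 -(mulrI_eq0 _ (mulfI nz_c)).
rewrite -(mulrI_eq0 _ (mulfI nz_c')) /bracket.
apply/eqP; transitivity ((c * hx q) * (c' * hy q') - (c' * hx q') * (c * hy q)).
  by ring.
by rewrite -E0 -E1 -E0' -E1'; ring.
Qed.

Lemma maps_to_factor M c c' p q : maps_to M c p q -> maps_to M c' p q -> c = c'.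
Proof.
move=> /maps_toE[_ E0 E1] /maps_toE[_ E0' E1']; move: E0 E1; rewrite E0' E1'.
by case: q {E0' E1'} => [z|] /=; rewrite !mulr1.
Qed.

Lemma maps_to_comp M N c c' p q r :
  maps_to N c p q -> maps_to M c' q r -> maps_to (M *m N) (c * c') p r.
Proof.
move=> [nz_c E] [nz_c' E']; split; first by rewrite mulf_neq0.
by rewrite -mulmxA E -scalemxAr E' scalerA.
Qed.

Lemma maps_to_scale M a c p q : a != 0 ->
  maps_to M c p q -> maps_to (a *: M) (a * c) p q.
Proof.
move=> nz_a [nz_c E]; split; first by rewrite mulf_neq0.
by rewrite -scalemxAl E scalerA.
Qed.

Lemma maps_to_inv M c p q : M \in unitmx ->
  maps_to M c p q -> maps_to (invmx M) c^-1 q p.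
Proof.
move=> Mu [nz_c E]; split; first by rewrite invr_eq0.
by rewrite -[hvec p](mulKmx Mu) E -scalemxAr scalerA mulVf ?scale1r.
Qed.

(** Cramer's rule. *)
Lemma maps_to_preim M c p q : \det M != 0 -> maps_to M c p q ->
  hx p = c * (M 1 1 * hx q - M 0 1 * hy q) / \det M /\
  hy p = c * (M 0 0 * hy q - M 1 0 * hx q) / \det M.
Proof.
move=> nz_u /maps_toE[nz_c E0 E1]; split; apply: (mulIf nz_u); rewrite divfK // det_mx2.
  transitivity (M 1 1 * (c * hx q) - M 0 1 * (c * hy q)); last by ring.
  by rewrite -E0 -E1; ring.
transitivity (M 0 0 * (c * hy q) - M 1 0 * (c * hx q)); last by ring.
by rewrite -E0 -E1; ring.
Qed.

Lemma bracket_maps_to M c c' p p' q q' : maps_to M c p p' -> maps_to M c' q q' ->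
  \det M * bracket p q = c * c' * bracket p' q'.
Proof.
move=> /maps_toE[_ E0 E1] /maps_toE[_ E0' E1'].
transitivity ((c * hx p') * (c' * hy q') - (c' * hx q') * (c * hy p')).
  by rewrite -E0 -E1 -E0' -E1' det_mx2 /bracket; ring.
by rewrite /bracket; ring.
Qed.

(** Distinct fixed points are independent eigenvectors. *)
Lemma fixed2_trace M c c' p q : p != q -> maps_to M c p p -> maps_to M c' q q ->
  \tr M = c + c' /\ \det M = c * c'.
Proof.
rewrite -bracket_eq0 => nz_b Mp Mq; split; last first.
  by apply: (mulIf nz_b); apply: bracket_maps_to.
move: Mp Mq => /maps_toE[_ E0 E1] /maps_toE[_ E0' E1'].
apply: (mulIf nz_b); rewrite mxtrace2 /bracket.
transitivity ((M 0 0 * hx p + M 0 1 * hy p) * hy q -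
              (M 0 0 * hx q + M 0 1 * hy q) * hy p
            + (M 1 0 * hx q + M 1 1 * hy q) * hx p
            - (M 1 0 * hx p + M 1 1 * hy p) * hx q); first by ring.
by rewrite E0 E1 E0' E1'; ring.
Qed.

Lemma eigen2_scalar M c p q : p != q -> maps_to M c p p -> maps_to M c q q ->
  M = c%:M.
Proof.
rewrite -bracket_eq0 => nz_b /maps_toE[_ E0 E1] /maps_toE[_ E0' E1'].
apply: matrix2P; rewrite !mxE /= ?mulr1n ?mulr0n;
  apply: (mulIf nz_b); rewrite /bracket.
- transitivity ((M 0 0 * hx p + M 0 1 * hy p) * hy q -
    (M 0 0 * hx q + M 0 1 * hy q) * hy p); first by ring.
  by rewrite E0 E0'; ring.
- transitivity ((M 0 0 * hx q + M 0 1 * hy q) * hx p -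
    (M 0 0 * hx p + M 0 1 * hy p) * hx q); first by ring.
  by rewrite E0 E0'; ring.
- transitivity ((M 1 0 * hx p + M 1 1 * hy p) * hy q -
    (M 1 0 * hx q + M 1 1 * hy q) * hy p); first by ring.
  by rewrite E1 E1'; ring.
- transitivity ((M 1 0 * hx q + M 1 1 * hy q) * hx p -
    (M 1 0 * hx p + M 1 1 * hy p) * hx q); first by ring.
  by rewrite E1 E1'; ring.
Qed.

(** A projective transformation of the line with three fixed points is trivial:
    three pairwise sums of the eigenvalues are equal to the trace. *)
Lemma fixed3_scalar M c c' c'' p q r : p != q -> p != r -> q != r ->
  maps_to M c p p -> maps_to M c' q q -> maps_to M c'' r r -> M = c%:M.
Proof.
move=> npq npr nqr Mp Mq Mr.
have [tpq _] := fixed2_trace npq Mp Mq.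
have [tpr _] := fixed2_trace npr Mp Mr.
have [tqr _] := fixed2_trace nqr Mq Mr.
have eq_c : c = c' by apply: (addIr c''); rewrite -tpr -tqr.
by rewrite eq_c in Mp *; apply: eigen2_scalar Mp Mq.
Qed.

(** The multiplier at a fixed point is the other eigenvalue divided by the one
    there, which is the determinant divided by the square of the latter. *)
Lemma fixed2_multiplier_sum M c c' p q :
    p != q -> maps_to M c p p -> maps_to M c' q q ->
  \det M / c ^+ 2 + \det M / c' ^+ 2 = multiplier_sum M.
Proof.
move=> npq Mp Mq; have [tM dM] := fixed2_trace npq Mp Mq.
have [nz_c _] := Mp; have [nz_c' _] := Mq.
by rewrite /multiplier_sum tM dM; field; rewrite nz_c nz_c'.
Qed.

(** The matrix of the cross ratio that sends [p0], [p1], [p2] to 0, 1, infinity. *)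
Definition cross_mx p0 p1 p2 : 'M[F]_2 :=
  \matrix_(i, j)
   if i == 0 then
     if j == 0 then bracket p1 p2 * hy p0 else - (bracket p1 p2 * hx p0)
   else if j == 0 then bracket p1 p0 * hy p2 else - (bracket p1 p0 * hx p2).

Lemma cross_mxE p0 p1 p2 p :
  cross_mx p0 p1 p2 *m hvec p =
  \col_i (if i == 0 then bracket p1 p2 * bracket p p0
                    else bracket p1 p0 * bracket p p2).
Proof. by apply: cV2P; rewrite mul_mx2E !mxE /= /bracket; ring. Qed.

Lemma det_cross_mx p0 p1 p2 :
  \det (cross_mx p0 p1 p2) = bracket p1 p2 * bracket p1 p0 * bracket p0 p2.
Proof. by rewrite det_mx2 !mxE /= /bracket; ring. Qed.

Lemma cross_mx_unit p0 p1 p2 : p0 != p1 -> p0 != p2 -> p1 != p2 ->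
  cross_mx p0 p1 p2 \in unitmx.
Proof.
move=> n01 n02 n12; rewrite unitmxE unitfE det_cross_mx.
by rewrite !mulf_neq0 // bracket_eq0 // eq_sym.
Qed.

End HomogeneousCoordinates.

Section LFTs.
Variable R : realType.
Local Notation C := R[i].
Implicit Types (p q r : option C) (M N : 'M[C]_2).

Lemma lft_maps_to M p : M \in unitmx -> exists c, maps_to M c p (lft M p).
Proof.
rewrite unitmxE unitfE det_mx2 => nz_det.
suff [c [nz_c E0 E1]] : exists c, [/\ c != 0,
    M 0 0 * hx p + M 0 1 * hy p = c * hx (lft M p)
    & M 1 0 * hx p + M 1 1 * hy p = c * hy (lft M p)].
  by exists c; apply/maps_toE.
case: p => [z|] /=.
  case: ifPn => [/eqP dz|nz_d]; last first.
    by exists (M 1 0 * z + M 1 1); split => //=; rewrite !mulr1 // [RHS]mulrC divfK.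
  exists (M 0 0 * z + M 0 1); rewrite /= !mulr1 mulr0 dz; split=> //.
  apply: contraNneq nz_det => nz0.
  have [c0|nz_c] := eqVneq (M 1 0) 0.
    by move/eqP: dz; rewrite c0 mul0r add0r => /eqP->; rewrite !mulr0 subrr.
  have -> : M 0 0 * M 1 1 - M 0 1 * M 1 0 =
    M 0 0 * (M 1 0 * z + M 1 1) - (M 0 0 * z + M 0 1) * M 1 0 by ring.
  by rewrite dz nz0 mulr0 mul0r subrr.
rewrite !mulr1 !mulr0 !addr0; case: ifPn => [/eqP c0|nz_c].
  exists (M 0 0); rewrite /= c0 mulr1 mulr0; split=> //.
  by apply: contraNneq nz_det => ->; rewrite c0 mul0r mulr0 subrr.
by exists (M 1 0); rewrite /= mulr1 [M 1 0 * _]mulrC divfK.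
Qed.

Lemma maps_to_lft M c p q : M \in unitmx -> maps_to M c p q -> lft M p = q.
Proof. by move=> /(lft_maps_to p)[c' Mp'] /(maps_to_fun Mp'). Qed.

Lemma lftM M N : M \in unitmx -> N \in unitmx -> lft (M *m N) = lft M \o lft N.
Proof.
move=> Mu Nu; apply/funext => p /=; have [c Np] := lft_maps_to p Nu.
have [c' MNp] := lft_maps_to (lft N p) Mu.
by apply: maps_to_lft (maps_to_comp Np MNp); rewrite unitmx_mul Mu.
Qed.

Lemma lft_scale M a : a != 0 -> M \in unitmx -> lft (a *: M) = lft M.
Proof.
move=> nz_a Mu; apply/funext => p; have [c Mp] := lft_maps_to p Mu.
by apply: maps_to_lft (maps_to_scale nz_a Mp); rewrite unitmxZ // unitfE.
Qed.

Lemma lft_inj M : M \in unitmx -> injective (lft M).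
Proof.
move=> Mu p q eq_pq; have [c Mp] := lft_maps_to p Mu.
have [c' Mq] := lft_maps_to q Mu; rewrite -eq_pq in Mq.
exact: maps_to_fun (maps_to_inv Mu Mp) (maps_to_inv Mu Mq).
Qed.

(** Apply [fixed3_scalar] to the quotient of the two transformations. *)
Lemma lft3_scale M N p q r : M \in unitmx -> N \in unitmx ->
    p != q -> p != r -> q != r ->
    lft M p = lft N p -> lft M q = lft N q -> lft M r = lft N r ->
  exists2 a, a != 0 & N = a *: M.
Proof.
move=> Mu Nu npq npr nqr ep eq er.
have fix_pt t : lft M t = lft N t -> exists c, maps_to (invmx M *m N) c t t.
  move=> et; have [c Nt] := lft_maps_to t Nu; have [c' Mt] := lft_maps_to t Mu.
  by exists (c * c'^-1); apply: maps_to_comp Nt _; rewrite -et; apply: maps_to_inv.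
have [c Tp] := fix_pt p ep; have [c' Tq] := fix_pt q eq.
have [c'' Tr] := fix_pt r er.
exists c; first by case: Tp.
by rewrite -mul_mx_scalar -(fixed3_scalar npq npr nqr Tp Tq Tr) mulmxA mulmxV // mul1mx.
Qed.

Lemma lft_eq_scale M N : M \in unitmx -> N \in unitmx -> lft M = lft N ->
  exists2 a, a != 0 & N = a *: M.
Proof.
move=> Mu Nu eqMN; apply: (@lft3_scale M N (Some 0) (Some 1) None) => //;
  rewrite ?eqMN //.
by apply/eqP => -[] /eqP; rewrite eq_sym oner_eq0.
Qed.

Lemma lft_cross_mx p0 p1 p2 (M := cross_mx p0 p1 p2) :
    p0 != p1 -> p0 != p2 -> p1 != p2 ->
  [/\ lft M p0 = Some 0, lft M p1 = Some 1 & lft M p2 = None].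
Proof.
move=> n01 n02 n12; have Mu : M \in unitmx by apply: cross_mx_unit.
have bxx p : bracket p p = 0 by apply/eqP; rewrite bracket_eq0.
have nz01 : bracket p1 p0 != 0 by rewrite bracket_eq0 eq_sym.
have nz02 : bracket p0 p2 != 0 by rewrite bracket_eq0.
have nz20 : bracket p2 p0 != 0 by rewrite bracket_eq0 eq_sym.
have nz12 : bracket p1 p2 != 0 by rewrite bracket_eq0.
split.
- apply: (@maps_to_lft M (bracket p1 p0 * bracket p0 p2)) => //.
  split; first by rewrite mulf_neq0.
  by rewrite /M cross_mxE; apply: cV2P; rewrite !mxE /= ?bxx ?mulr0 ?mulr1.
- apply: (@maps_to_lft M (bracket p1 p0 * bracket p1 p2)) => //.
  split; first by rewrite mulf_neq0.
  by rewrite /M cross_mxE; apply: cV2P; rewrite !mxE /= mulr1 // mulrC.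
- apply: (@maps_to_lft M (bracket p1 p2 * bracket p2 p0)) => //.
  split; first by rewrite mulf_neq0.
  by rewrite /M cross_mxE; apply: cV2P; rewrite !mxE /= ?bxx ?mulr0 ?mulr1.
Qed.

(** By [lft3_scale], the cross ratio is the only transformation with the property
    by which it is chosen. *)
Lemma lft_to01ooE p0 p1 p2 : p0 != p1 -> p0 != p2 -> p1 != p2 ->
  lft_to01oo p0 p1 p2 = lft (cross_mx p0 p1 p2).
Proof.
move=> n01 n02 n12; have Mu := cross_mx_unit n01 n02 n12.
have [M0 M1 M2] := lft_cross_mx n01 n02 n12.
rewrite /lft_to01oo; set X := xget _ _.
have [[N Nu ->] N0 N1 N2] :
    [/\ is_lft X, X p0 = Some 0, X p1 = Some 1 & X p2 = None].
  apply: (@xgetPex _ _ [set f | [/\ is_lft f, f p0 = Some 0, f p1 = Some 1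
                                   & f p2 = None]]).
  by exists (lft (cross_mx p0 p1 p2)); split=> //; exists (cross_mx p0 p1 p2).
have [|||a nz_a ->] := lft3_scale Mu Nu n01 n02 n12; rewrite ?M0 ?M1 ?M2 //.
by rewrite lft_scale.
Qed.

End LFTs.

(** * Derivatives of cross ratios *)

Section Derivatives.
Variables (K : numFieldType).

(** The maps of interest are given by cross ratios only near a configuration of
    distinct points. *)
Lemma near_eq_differentiable (V W : normedModType K) (f g : V -> W) (a : V) :
    (\near a, f a = g a) -> differentiable g a ->
  differentiable f a /\ 'd f a = 'd g a :> (V -> W).
Proof.
move=> fg /diff_locallyP[cont_dg /eqaddoP g_o].
have fa : f a = g a by exact: nbhs_singleton fg.
have fg0 : \forall y \near (0 : V), f (y + a) = g (y + a).
  by move: fg; rewrite (near_shift 0 a) subr0.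
have f_o : f \o shift a = cst (f a) + 'd g a +o_ (0 : V) id.
  apply/eqaddoP => e e_gt0; near=> y.
  have fgy : f (y + a) = g (y + a) by near: y.
  rewrite /= /shift /= -[(_ - _) y]/(f (y + a) - (f a + 'd g a y)) fgy fa.
  by near: y; exact: g_o.
have df : 'd f a = 'd g a :> (V -> W) by apply: diff_unique.
by split=> //; apply/diff_locallyP; rewrite df.
Unshelve. all: by end_near. Qed.

Variables (V : normedModType K) (d : nat).

Lemma differentiable_row (f : 'I_d -> V -> K) (a : V) :
  (forall i, differentiable (f i) a) ->
  differentiable (fun x => \row_i f i x) a /\
  forall v, 'd (fun x => \row_i f i x) a v = \row_i 'D_v (f i) a.
Proof.
move=> diff_f.
have rowE : (fun x => \row_i f i x) =
    \sum_(i < d) (fun x => f i x *: (delta_mx 0 i : 'rV[K]_d)).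
  apply/funext => x; rewrite fct_sumE; apply/rowP => j.
  rewrite summxE (bigD1 j) //= !mxE !eqxx mulr1 big1 ?addr0 // => i nij.
  by rewrite !mxE eq_sym (negPf nij) mulr0.
have diff_i i : differentiable (fun x => f i x *: (delta_mx 0 i : 'rV[K]_d)) a.
  exact: differentiableZl.
have diff_row : differentiable (fun x => \row_i f i x) a.
  by rewrite rowE; apply: differentiable_sum.
split=> // v; rewrite -deriveE // rowE derive_sum => [|i]; last first.
  exact: diff_derivable.
apply/rowP => j; rewrite summxE (bigD1 j) //= deriveE // diffZl // -deriveE //.
rewrite !mxE !eqxx mulr1 big1 ?addr0 // => i nij.
by rewrite deriveE // diffZl // !mxE eq_sym (negPf nij) mulr0.
Qed.

End Derivatives.

(** A point moves with one coordinate of the parameter or is fixed, and its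
    second homogeneous coordinate is constant, which includes infinity. The field
    is abstract so that its topology is the one of its norm. *)
Section CrossRatioDerivative.
Variables (K : numFieldType) (d n : nat).
Variables (coord : 'I_n -> option 'I_d) (x0 y : 'I_n -> K).
Implicit Types (l v : 'rV[K]_d).

Definition moving_x k l : K := if coord k is Some i then l 0 i else x0 k.

Definition velocity v k : K := if coord k is Some i then v 0 i else 0.

Definition moving_bracket j k l := moving_x j l * y k - moving_x k l * y j.

Definition moving_cross a b c e l :=
  moving_bracket c e l * moving_bracket a b l /
  (moving_bracket c b l * moving_bracket a e l).

Lemma derive_moving_x l v k :
  differentiable (moving_x k) l /\ 'D_v (moving_x k) l = velocity v k.
Proof.
rewrite /moving_x /velocity; case: (coord k) => [i|]; last first.
  by split; [exact: differentiable_cst | exact: derive_cst].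
have dc := differentiable_coord l 0 i; split=> //; rewrite deriveE //.
(* The projection as a bundled linear map, which is its own differential. *)
have @f : {linear 'rV[K]_d -> K}.
  by exists (fun N : 'rV[K]_d => N 0 i); do 2![eexists]; do ?[constructor];
     rewrite ?mxE// => ? *; rewrite ?mxE//; move=> ?; rewrite !mxE.
rewrite (_ : (fun _ => _) = f) // diff_lin //; exact/coord_continuous.
Qed.

Lemma derive_moving_bracket l v j k :
  differentiable (moving_bracket j k) l /\
  'D_v (moving_bracket j k) l = velocity v j * y k - velocity v k * y j.
Proof.
have [dj vj] := derive_moving_x l v j; have [dk vk] := derive_moving_x l v k.
have -> : moving_bracket j k = y k *: moving_x j - y j *: moving_x k.
  apply/funext => l'; rewrite /moving_bracket mulrC [X in _ - X]mulrC.
  by [].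
split; first by apply: differentiableB; apply: differentiableZ.
have {}dj : derivable (moving_x j) l v by exact: diff_derivable.
have {}dk : derivable (moving_x k) l v by exact: diff_derivable.
rewrite deriveB; [|exact: derivableZ|exact: derivableZ].
by rewrite !deriveZ // vj vk [_ * y k]mulrC [_ * y j]mulrC.
Qed.

(** The logarithmic derivative: a product of brackets, two of them inverted. *)
Lemma derive_moving_cross l v a b c e :
    moving_bracket a b l != 0 -> moving_bracket c e l != 0 ->
    moving_bracket c b l != 0 -> moving_bracket a e l != 0 ->
  differentiable (moving_cross a b c e) l /\
  'D_v (moving_cross a b c e) l = moving_cross a b c e l *
   ((velocity v a * y b - velocity v b * y a) / moving_bracket a b l
    + (velocity v c * y e - velocity v e * y c) / moving_bracket c e l
    - (velocity v c * y b - velocity v b * y c) / moving_bracket c b l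
    - (velocity v a * y e - velocity v e * y a) / moving_bracket a e l).
Proof.
move=> nzab nzce nzcb nzae.
have [dab vab] := derive_moving_bracket l v a b.
have [dce vce] := derive_moving_bracket l v c e.
have [dcb vcb] := derive_moving_bracket l v c b.
have [dae vae] := derive_moving_bracket l v a e.
have crE : moving_cross a b c e = (moving_bracket c e * moving_bracket a b) *
  (fun l' => ((moving_bracket c b * moving_bracket a e) l')^-1) by [].
have dnum : differentiable (moving_bracket c e * moving_bracket a b) l.
  exact: differentiableM.
have dden : differentiable (moving_bracket c b * moving_bracket a e) l.
  exact: differentiableM.
have nzden : (moving_bracket c b * moving_bracket a e) l != 0.
  by rewrite mulf_neq0.
have dinv := differentiableV dden nzden.
split; first by rewrite crE; apply: differentiableM.
have dD f : differentiable f l -> derivable f l v by exact: diff_derivable.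
rewrite [in LHS]crE deriveM; [|exact: dD|exact: dD].
rewrite deriveV //; last exact: dD.
rewrite !deriveM; [|exact: dD ..].
rewrite vab vce vcb vae /moving_cross.
rewrite !(_ : forall f g : 'rV[K]_d -> K, (f * g) l = f l * g l) //.
rewrite !(_ : forall x z : K, x *: (z : K^o) = x * z) //.
move: nzab nzce nzcb nzae.
move: (moving_bracket a b l) (moving_bracket c e l) (moving_bracket c b l)
  (moving_bracket a e l) => ab ce cb ae nzab nzce nzcb nzae.
by field; rewrite nzab nzce nzcb nzae.
Qed.

(** Configurations of distinct points form an open set. *)
Lemma near_moving_bracket l :
    (forall j k, j != k -> moving_bracket j k l != 0) ->
  \forall l' \near l, forall j k, j != k -> moving_bracket j k l' != 0.
Proof.
move=> nz; apply: (@filter_forall _ _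
  (fun j l' => forall k, j != k -> moving_bracket j k l' != 0) _ (nbhs_filter l)) => j.
apply: (@filter_forall _ _
  (fun k l' => j != k -> moving_bracket j k l' != 0) _ (nbhs_filter l)) => k.
have [->|njk] := eqVneq j k; first by near=> l'.
have [dj _] := derive_moving_bracket l 0 j k.
near=> l' => _; near: l'.
apply: (cvgr_neq0 (moving_bracket j k l)); last exact: nz.
exact: (differentiable_continuous dj).
Unshelve. all: by end_near. Qed.

Lemma jacobian_moving_cross l (F : 'rV[K]_d -> 'rV[K]_d) (a b c e : 'I_d -> 'I_n) :
    (forall j k, j != k -> moving_bracket j k l != 0) ->
    (forall l', (forall j k, j != k -> moving_bracket j k l' != 0) ->
       forall i, F l' 0 i = moving_cross (a i) (b i) (c i) (e i) l') ->
    (forall i, [/\ a i != b i, c i != e i, c i != b i & a i != e i]) ->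
  forall v i, (v *m jacobian F l) 0 i = moving_cross (a i) (b i) (c i) (e i) l *
   ((velocity v (a i) * y (b i) - velocity v (b i) * y (a i)) /
      moving_bracket (a i) (b i) l
    + (velocity v (c i) * y (e i) - velocity v (e i) * y (c i)) /
      moving_bracket (c i) (e i) l
    - (velocity v (c i) * y (b i) - velocity v (b i) * y (c i)) /
      moving_bracket (c i) (b i) l
    - (velocity v (a i) * y (e i) - velocity v (e i) * y (a i)) /
      moving_bracket (a i) (e i) l).
Proof.
move=> nz FE neq v i.
pose f i := moving_cross (a i) (b i) (c i) (e i).
have df u j := let: And4 nab nce ncb nae := neq j in
  derive_moving_cross u (nz _ _ nab) (nz _ _ nce) (nz _ _ ncb) (nz _ _ nae).
have near_F : \near l, F l = \row_i f i l.
  apply: filterS (near_moving_bracket nz) => l' nz'.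
  by apply/rowP => j; rewrite mxE FE.
have [drow rowE] := differentiable_row (fun j => (df v j).1).
have [_ dFE] := near_eq_differentiable near_F drow.
by rewrite /jacobian mul_rV_lin1 dFE rowE mxE (df v i).2.
Qed.

End CrossRatioDerivative.

(** * The Jacobian representation of the stabilizer *)

Section MarkedPoints.
Variables (R : realType) (d : nat).
Local Notation C := R[i].
Implicit Types (l : 'rV[C]_d) (s t : 'S_(3 + d)) (k : 'I_(3 + d)).

Definition base_pt (j : nat) : 'I_(3 + d) := lshift d (inord j).

Definition coordpt (i : 'I_d) : 'I_(3 + d) := rshift 3 i.

Lemma split_lshift n1 n2 (j : 'I_n1) : fintype.split (lshift n2 j) = inl j.
Proof. exact: (unsplitK (inl j)). Qed.

Lemma split_rshift n1 n2 (j : 'I_n2) : fintype.split (rshift n1 j) = inr j.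
Proof. exact: (unsplitK (inr j)). Qed.

Lemma zpt0 l : zpt l (base_pt 0) = Some 0.
Proof. by rewrite /zpt split_lshift inordK. Qed.

Lemma zpt1 l : zpt l (base_pt 1) = Some 1.
Proof. by rewrite /zpt split_lshift inordK. Qed.

Lemma zpt2 l : zpt l (base_pt 2) = None.
Proof. by rewrite /zpt split_lshift inordK. Qed.

Lemma zpt_coord l i : zpt l (coordpt i) = Some (l 0 i).
Proof. by rewrite /zpt split_rshift. Qed.

Lemma marked_ptP (P : 'I_(3 + d) -> Prop) :
  P (base_pt 0) -> P (base_pt 1) -> P (base_pt 2) -> (forall i, P (coordpt i)) ->
  forall k, P k.
Proof.
move=> P0 P1 P2 Pi k; rewrite -(splitK k); case: fintype.split => //= j.
  case: j => [[|[|[|//]]] lt_j].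
  - by rewrite (_ : Ordinal lt_j = inord 0) //; apply: val_inj; rewrite /= inordK.
  - by rewrite (_ : Ordinal lt_j = inord 1) //; apply: val_inj; rewrite /= inordK.
  - by rewrite (_ : Ordinal lt_j = inord 2) //; apply: val_inj; rewrite /= inordK.
Qed.

Lemma sum_marked_pt (V : nmodType) (f : 'I_(3 + d) -> V) :
  \sum_k f k =
  f (base_pt 0) + f (base_pt 1) + f (base_pt 2) + \sum_i f (coordpt i).
Proof.
rewrite big_split_ord /=; congr (_ + _).
rewrite !big_ord_recl big_ord0 addr0 addrA.
by congr (f _ + f _ + f _); apply: val_inj; rewrite /= inordK.
Qed.

Lemma zpt_inj l : Kn l -> injective (zpt l).
Proof.
case=> l0 l1 ldist k k'; move: k k'.
have neqS (x y : C) : x != y -> Some x <> Some y by move=> /eqP nxy [].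
have zero_one : (0 : C) != 1 by rewrite eq_sym oner_eq0.
apply: marked_ptP => [|||i]; apply: marked_ptP => [|||i']; rewrite ?(zpt0, zpt1, zpt2, zpt_coord) //;
 try (by move/neqS => []); try by move/neqS => []; rewrite eq_sym.
case=> eq_l; congr coordpt; apply: contra_eq eq_l; exact: ldist.
Qed.

Definition cfg_mx l s : 'M[C]_2 :=
  cross_mx (zpt l (s (base_pt 0))) (zpt l (s (base_pt 1))) (zpt l (s (base_pt 2))).

Section InjectivePoints.
Variable l : 'rV[C]_d.
Hypothesis inj_l : injective (zpt l).

Lemma base_pt_neq : (base_pt 0 != base_pt 1) * (base_pt 0 != base_pt 2) *
  (base_pt 1 != base_pt 2).
Proof. by rewrite -!val_eqE /= !inordK. Qed.

Lemma zpt_perm_neq s k k' : k != k' -> zpt l (s k) != zpt l (s k').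
Proof. by rewrite !(inj_eq inj_l) !(inj_eq perm_inj). Qed.

Lemma cfg_mx_unit s : cfg_mx l s \in unitmx.
Proof. by apply: cross_mx_unit; rewrite zpt_perm_neq // base_pt_neq. Qed.

Lemma Phi_E s : Phi_ l s = lft (cfg_mx l s).
Proof.
by rewrite /Phi_ /f_sigma invgK lft_to01ooE // zpt_perm_neq // base_pt_neq.
Qed.

Lemma cfg_mx_base s : [/\ lft (cfg_mx l s) (zpt l (s (base_pt 0))) = Some 0,
  lft (cfg_mx l s) (zpt l (s (base_pt 1))) = Some 1 &
  lft (cfg_mx l s) (zpt l (s (base_pt 2))) = None].
Proof. by apply: lft_cross_mx; rewrite zpt_perm_neq // base_pt_neq. Qed.

Lemma G_eltE s i :
  G_elt s l 0 i = odflt 0 (lft (cfg_mx l s) (zpt l (s (coordpt i)))).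
Proof.
by rewrite mxE /f_sigma invgK lft_to01ooE // zpt_perm_neq // base_pt_neq.
Qed.

Definition zbracket (j k : 'I_(3 + d)) l := bracket (zpt l j) (zpt l k).

Definition cross_ratio s i l :=
  zbracket (s (base_pt 1)) (s (base_pt 2)) l * zbracket (s (coordpt i)) (s (base_pt 0)) l /
  (zbracket (s (base_pt 1)) (s (base_pt 0)) l * zbracket (s (coordpt i)) (s (base_pt 2)) l).

Lemma coordpt_neq i : (coordpt i != base_pt 0) * (coordpt i != base_pt 1) *
  (coordpt i != base_pt 2).
Proof. by rewrite -!val_eqE /= !inordK. Qed.

Lemma zbracket_neq0 s k k' : k != k' -> zbracket (s k) (s k') l != 0.
Proof. by move=> nkk'; rewrite bracket_eq0 zpt_perm_neq. Qed.

Lemma lft_coordpt s i :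
  lft (cfg_mx l s) (zpt l (s (coordpt i))) = Some (cross_ratio s i l).
Proof.
have nz1 : zbracket (s (base_pt 1)) (s (base_pt 0)) l != 0.
  by rewrite zbracket_neq0 // eq_sym base_pt_neq.
have nz2 : zbracket (s (coordpt i)) (s (base_pt 2)) l != 0.
  by rewrite zbracket_neq0 // coordpt_neq.
set c := zbracket (s (base_pt 1)) (s (base_pt 0)) l *
  zbracket (s (coordpt i)) (s (base_pt 2)) l.
have nz_c : c != 0 by rewrite mulf_neq0.
apply: (@maps_to_lft _ _ c) (cfg_mx_unit s) _; split=> //.
rewrite cross_mxE; apply: cV2P; rewrite !mxE /= ?mulr1 //.
by rewrite /cross_ratio -/c [RHS]mulrC divfK.
Qed.

Lemma G_elt_cross_ratio s i : G_elt s l 0 i = cross_ratio s i l.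
Proof. by rewrite G_eltE lft_coordpt. Qed.

(** The conditions on the first three points hold by construction; the other ones
    say that the coordinates are fixed. *)
Lemma stabGP s :
  reflect (forall k, lft (cfg_mx l s) (zpt l (s k)) = zpt l k) (s \in stabG l).
Proof.
rewrite finset.inE; apply: (iffP eqP) => [Gs|Ms]; last first.
  by apply/rowP => i; rewrite G_eltE Ms zpt_coord.
have [M0 M1 M2] := cfg_mx_base s.
apply: marked_ptP.
- by rewrite M0 zpt0.
- by rewrite M1 zpt1.
- by rewrite M2 zpt2.
move=> i.
by rewrite lft_coordpt zpt_coord -[in RHS]Gs G_elt_cross_ratio.
Qed.

(** Three points determine the transformation, so every matrix that induces the
    permutation [s] of the marked points is proportional to [cfg_mx l s]. *)
Lemma cfg_mx_scale s M : M \in unitmx ->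
  (forall k, lft M (zpt l (s k)) = zpt l k) ->
  exists2 a, a != 0 & cfg_mx l s = a *: M.
Proof.
move=> Mu Ms; have [M0 M1 M2] := cfg_mx_base s.
apply: (@lft3_scale _ _ _ (zpt l (s (base_pt 0))) (zpt l (s (base_pt 1)))
  (zpt l (s (base_pt 2)))) => //; rewrite ?cfg_mx_unit ?zpt_perm_neq ?base_pt_neq //.
- by rewrite M0 Ms zpt0.
- by rewrite M1 Ms zpt1.
- by rewrite M2 Ms zpt2.
Qed.

Lemma stabG_lft s M : M \in unitmx ->
  (forall k, lft M (zpt l (s k)) = zpt l k) -> s \in stabG l.
Proof.
move=> Mu Ms; have [a nz_a Ma] := cfg_mx_scale Mu Ms.
by apply/stabGP => k; rewrite Ma lft_scale.
Qed.

Lemma stabG_comp s t k : s \in stabG l -> t \in stabG l ->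
  lft (cfg_mx l s *m cfg_mx l t) (zpt l ((s * t)%g k)) = zpt l k.
Proof.
move=> /stabGP Ms /stabGP Mt.
by rewrite lftM ?cfg_mx_unit //= permM Mt Ms.
Qed.

Lemma stabG_group_set : group_set (stabG l).
Proof.
apply/group_setP; split=> [|s t stab_s stab_t].
  apply: (@stabG_lft _ 1%:M) => [|k]; first exact: unitmx1.
  rewrite perm1; apply: (maps_to_lft (unitmx1 _ _)).
  by split; [exact: oner_neq0 | rewrite mul1mx scale1r].
apply: (@stabG_lft _ (cfg_mx l s *m cfg_mx l t)) => [|k].
  by rewrite unitmx_mul !cfg_mx_unit.
exact: stabG_comp.
Qed.

Lemma cfg_mxM s t : s \in stabG l -> t \in stabG l ->
  exists2 a, a != 0 & cfg_mx l (s * t)%g = a *: (cfg_mx l s *m cfg_mx l t).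
Proof.
move=> stab_s stab_t; apply: cfg_mx_scale => [|k].
  by rewrite unitmx_mul !cfg_mx_unit.
exact: stabG_comp.
Qed.

Lemma cfg_mx1 : exists2 a, a != 0 & cfg_mx l 1 = a%:M.
Proof.
have [|k|a nz_a ->] := @cfg_mx_scale 1%g 1%:M; first exact: unitmx1.
  rewrite perm1; apply: (maps_to_lft (unitmx1 _ _)).
  by split; [exact: oner_neq0 | rewrite mul1mx scale1r].
by exists a => //; rewrite scalemx1.
Qed.

Lemma cfg_mx_scalar s : s \in stabG l -> is_scalar_mx (cfg_mx l s) -> s = 1%g.
Proof.
move=> /stabGP Ms /is_scalar_mxP[c Mc]; apply/permP => k; rewrite perm1.
have Mu := cfg_mx_unit s; apply: inj_l; rewrite -[RHS]Ms.
have nz_c : c != 0.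
  by move: Mu; rewrite Mc unitmxE det_scalar unitfE expf_eq0.
apply/esym/(maps_to_lft Mu); split; first exact: nz_c.
by rewrite Mc mul_scalar_mx.
Qed.

(** ** The linearized action on the tangent space of the marked points *)

(** The coordinate of [zpt l k] that is read off is equal to 1. *)
Definition mult_factor s k : C :=
  let v := cfg_mx l s *m hvec (zpt l (s k)) in
  if zpt l k is Some _ then v 1 0 else v 0 0.

Lemma cfg_maps_to s k : s \in stabG l ->
  maps_to (cfg_mx l s) (mult_factor s k) (zpt l (s k)) (zpt l k).
Proof.
move=> /stabGP/(_ k) Ms; have [c] := lft_maps_to (zpt l (s k)) (cfg_mx_unit s).
rewrite Ms => -[nz_c E]; suff -> : mult_factor s k = c by [].
by rewrite /mult_factor E; case: (zpt l k) => [z|]; rewrite !mxE /= mulr1.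
Qed.

(** The derivative of the transformation at the marked point [s k], with respect
    to the trivializations of the tangent lines by homogeneous coordinates. *)
Definition tangent_weight s k : C := \det (cfg_mx l s) / mult_factor s k ^+ 2.

(** The determinant and the square of the factor scale in the same way, so any
    matrix of the transformation computes the weight. *)
Lemma tangent_weightE s k M c a : s \in stabG l -> a != 0 ->
    cfg_mx l s = a *: M -> maps_to M c (zpt l (s k)) (zpt l k) ->
  tangent_weight s k = \det M / c ^+ 2.
Proof.
move=> stab_s nz_a Ma Mk; have [nz_c _] := Mk.
have := maps_to_scale nz_a Mk; rewrite -Ma => /(maps_to_factor (cfg_maps_to k stab_s)).
by rewrite /tangent_weight => ->; rewrite Ma detZ; field; rewrite nz_a nz_c.
Qed.

(** The chain rule. *)
Lemma tangent_weightM s t k : s \in stabG l -> t \in stabG l ->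
  tangent_weight (s * t)%g k = tangent_weight s k * tangent_weight t (s k).
Proof.
move=> stab_s stab_t; have [a nz_a Ma] := cfg_mxM stab_s stab_t.
have stab_st : (s * t)%g \in stabG l by apply: (group_setP stabG_group_set).2.
have Ms := cfg_maps_to k stab_s; have Mt := cfg_maps_to (s k) stab_t.
rewrite (tangent_weightE (c := mult_factor t (s k) * mult_factor s k) stab_st nz_a Ma).
  rewrite det_mulmx /tangent_weight.
  move: (\det _) (\det _) (mult_factor _ _) (mult_factor _ _) => u v p q.
  by rewrite exprMn invfM; ring.
by rewrite permM; apply: maps_to_comp Mt Ms.
Qed.

Lemma tangent_weight1 k : tangent_weight 1 k = 1.
Proof.
have [a nz_a Ma] := cfg_mx1.
rewrite (tangent_weightE (M := 1%:M) (c := 1) (a := a)) //.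
- by rewrite det1 expr1n divr1.
- exact: (group_setP stabG_group_set).1.
- by rewrite Ma scalemx1.
by rewrite perm1; split; rewrite ?oner_eq0 // mul1mx scale1r.
Qed.

(** Push-forward of tangent vectors: the one at [s k] is sent to [k]. *)
Definition tangent_mx s : 'M[C]_(3 + d) :=
  \matrix_(k, j) (tangent_weight s k *+ (j == s k)).

Lemma mul_tangent_mx s n (A : 'M[C]_(3 + d, n)) k j :
  (tangent_mx s *m A) k j = tangent_weight s k * A (s k) j.
Proof.
rewrite mxE (bigD1 (s k)) //= mxE eqxx mulr1n big1 ?addr0 // => j' /negPf nj'.
by rewrite mxE nj' mulr0n mul0r.
Qed.

Lemma tangent_mxM s t : s \in stabG l -> t \in stabG l ->
  tangent_mx (s * t)%g = tangent_mx s *m tangent_mx t.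
Proof.
move=> stab_s stab_t; apply/matrixP => k j.
by rewrite mul_tangent_mx !mxE permM tangent_weightM // mulrnAr.
Qed.

Lemma tangent_mx1 : tangent_mx 1 = 1%:M.
Proof.
by apply/matrixP => k j; rewrite !mxE tangent_weight1 perm1 eq_sym.
Qed.

(** A quadratic vector field is determined by its values at the first three
    marked points; [quad_mx] computes its values at the other ones. *)
Definition quad_mx : 'M[C]_(d, 3) :=
  \matrix_(i, j) nth 0 [:: 1 - l 0 i; l 0 i; l 0 i ^+ 2 - l 0 i] j.

(** In the tangent space of the marked points, the image of [field_mx] consists of
    the quadratic vector fields, and the one of [coord_mx] of the motions of the
    last marked points. These are complements, and [mod_fields_mx] is the
    projection along the first onto the coordinates in the second; its sign
    cancels the one of [coord_mx]. *)
Definition field_mx : 'M[C]_(3 + d, 3) := col_mx 1%:M quad_mx.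

Definition mod_fields_mx : 'M[C]_(d, 3 + d) := row_mx quad_mx (- 1%:M).

Definition coord_mx : 'M[C]_(3 + d, d) := col_mx 0 (- 1%:M).

(** The value at [p] of the vector field with coefficient a z^2 + b z + c, in
    homogeneous coordinates. *)
Definition quad_form (a b c : C) (p : option C) : C :=
  a * hx p ^+ 2 + b * (hx p * hy p) + c * hy p ^+ 2.

Lemma mod_fields_quad a b c :
  mod_fields_mx *m (\col_k quad_form a b c (zpt l k)) = 0.
Proof.
apply/colP => i; rewrite !mxE sum_marked_pt !mxE.
rewrite !zpt0 !zpt1 !zpt2 !split_lshift !mxE !inordK //=.
under eq_bigr do rewrite !mxE split_rshift !mxE zpt_coord.
rewrite (bigD1 i) //= eqxx big1 ?addr0 => [|j nji].
  by rewrite /quad_form /=; ring.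
by rewrite eq_sym (negPf nji) oppr0 mul0r.
Qed.

(** The Lagrange basis of the quadratic polynomials at 0, 1, infinity. *)
Definition elem_quad (j : 'I_3) : option C -> C :=
  nth (fun _ => 0) [:: quad_form 0 (- 1) 1; quad_form 0 1 0; quad_form 1 (- 1) 0] j.

Lemma field_mxE k j : field_mx k j = elem_quad j (zpt l k).
Proof.
rewrite /field_mx /elem_quad; move: k j; have ord3P (P : 'I_3 -> Prop) :
  P (inord 0) -> P (inord 1) -> P (inord 2) -> forall j, P j.
  move=> P0 P1 P2 [[|[|[|//]]] lt_j].
  - by rewrite (_ : Ordinal lt_j = inord 0) //; apply: val_inj; rewrite /= inordK.
  - by rewrite (_ : Ordinal lt_j = inord 1) //; apply: val_inj; rewrite /= inordK.
  - by rewrite (_ : Ordinal lt_j = inord 2) //; apply: val_inj; rewrite /= inordK.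
apply: marked_ptP => [|||i]; apply: ord3P;
  rewrite !mxE ?split_lshift ?split_rshift !mxE -?val_eqE /= ?inordK //=
   ?zpt0 ?zpt1 ?zpt2 ?zpt_coord /quad_form /=; ring.
Qed.

(** The quadratic vector fields are the global vector fields on the projective
    line, i.e. the Lie algebra of the group of transformations, which acts on them
    by its adjoint representation. *)
Lemma push_quad s a b c : s \in stabG l -> exists a' b' c',
  tangent_mx s *m (\col_k quad_form a b c (zpt l k)) =
  \col_k quad_form a' b' c' (zpt l k).
Proof.
move=> stab_s; set M := cfg_mx l s; set u := \det M.
have nz_u : u != 0 by rewrite -unitfE -unitmxE cfg_mx_unit.
exists ((a * M 1 1 ^+ 2 - b * (M 1 1 * M 1 0) + c * M 1 0 ^+ 2) / u).
exists ((- (2%:R * a * M 0 1 * M 1 1) + b * (M 0 0 * M 1 1 + M 0 1 * M 1 0)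
   - 2%:R * c * M 0 0 * M 1 0) / u).
exists ((a * M 0 1 ^+ 2 - b * (M 0 0 * M 0 1) + c * M 0 0 ^+ 2) / u).
apply/colP => k; rewrite mul_tangent_mx mxE [RHS]mxE /tangent_weight -/M -/u.
have Mk := cfg_maps_to k stab_s; have [nz_f _] := Mk.
have [hxE hyE] := maps_to_preim nz_u Mk; rewrite -/M -/u in hxE hyE.
by rewrite /quad_form hxE hyE; field; rewrite nz_f nz_u.
Qed.

(** The action on the tangent vectors of the marked points modulo the global vector
    fields, which is the tangent space of the moduli space of marked points. *)
Definition jac_mx s : 'M[C]_d := mod_fields_mx *m tangent_mx s *m coord_mx.

Lemma coord_mod_fields :
  coord_mx *m mod_fields_mx = 1%:M - field_mx *m row_mx 1%:M 0.
Proof.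
rewrite /coord_mx /mod_fields_mx /field_mx !mul_col_row !mul0mx !mulmx0.
rewrite (scalar_mx_block 3 d) opp_block_mx add_block_mx.
by rewrite !(mulmx1, mulNmx, mul1mx, mulmxN, opprK) !(subrr, subr0, sub0r).
Qed.

Lemma elem_quadE j : exists a b c, elem_quad j =1 quad_form a b c.
Proof. by case: j => [[|[|[|//]]] lt_j]; do 3 eexists. Qed.

Lemma mod_fields_push s : s \in stabG l ->
  mod_fields_mx *m tangent_mx s *m field_mx = 0.
Proof.
move=> stab_s; apply/matrixP => i j; have [a [b [c jE]]] := elem_quadE j.
have -> : (mod_fields_mx *m tangent_mx s *m field_mx) i j =
    (mod_fields_mx *m (tangent_mx s *m col j field_mx)) i 0.
  by rewrite colE !mulmxA -colE [RHS]mxE.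
have -> : col j field_mx = \col_k quad_form a b c (zpt l k).
  apply/colP => k; transitivity (field_mx k j); first by rewrite mxE.
  by rewrite field_mxE [RHS]mxE jE.
have [a' [b' [c' ->]]] := push_quad a b c stab_s.
by rewrite mod_fields_quad !mxE.
Qed.

(** The global vector fields are stable, so the action passes to the quotient. *)
Lemma jac_mxM s t : s \in stabG l -> t \in stabG l ->
  jac_mx (s * t)%g = jac_mx s *m jac_mx t.
Proof.
move=> stab_s stab_t; rewrite /jac_mx tangent_mxM // -!mulmxA.
rewrite (mulmxA coord_mx) coord_mod_fields mulmxBl mul1mx !mulmxBr.
rewrite -(mulmxA field_mx) (mulmxA (tangent_mx s) field_mx).
rewrite (mulmxA mod_fields_mx (tangent_mx s *m field_mx)).
by rewrite (mulmxA mod_fields_mx _ field_mx) mod_fields_push // mul0mx subr0.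
Qed.

Lemma jac_mx1 : jac_mx 1 = 1%:M.
Proof.
rewrite /jac_mx tangent_mx1 mulmx1 /mod_fields_mx /coord_mx mul_row_col.
by rewrite mulmx0 add0r mulmxN mulmx1 opprK.
Qed.

(** The trace on the tangent space of the moduli space is the trace on the
    tangent spaces of the marked points minus the trace on the Lie algebra of
    quadratic vector fields. *)
Lemma trace_jac_mx s : s \in stabG l ->
  \tr (jac_mx s) = \tr (tangent_mx s) - (multiplier_sum (cfg_mx l s) + 1).
Proof.
move=> stab_s.
have -> : \tr (jac_mx s) = \tr (tangent_mx s) -
    \tr (row_mx 1%:M 0 *m tangent_mx s *m field_mx).
  rewrite /jac_mx mxtrace_mulC mulmxA coord_mod_fields mulmxBl mul1mx raddfB /=.
  by congr (_ - _); rewrite -[X in \tr X = _]mulmxA mxtrace_mulC.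
suff -> : \tr (row_mx 1%:M 0 *m tangent_mx s *m field_mx) =
  multiplier_sum (cfg_mx l s) + 1 by [].
rewrite -mulmxA -[X in row_mx _ _ *m X]vsubmxK mul_row_col mul1mx.
rewrite mul0mx addr0 /mxtrace; under eq_bigr => j _.
  rewrite mxE -[lshift d j]/(lshift d j) mul_tangent_mx field_mxE; over.
set M := cfg_mx l s; set u := \det M.
have nz_u : u != 0 by rewrite -unitfE -unitmxE cfg_mx_unit.
have wE k : exists2 f, tangent_weight s k = u / f ^+ 2 & [/\ f != 0,
    hx (zpt l (s k)) = f * (M 1 1 * hx (zpt l k) - M 0 1 * hy (zpt l k)) / u
  & hy (zpt l (s k)) = f * (M 0 0 * hy (zpt l k) - M 1 0 * hx (zpt l k)) / u].
  exists (mult_factor s k) => //; have Mk := cfg_maps_to k stab_s.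
  by have [nz_f _] := Mk; have [hxE hyE] := maps_to_preim nz_u Mk; exact: And3 nz_f hxE hyE.
have ordE (j : nat) (i : 'I_3) : i = j :> nat -> lshift d i = base_pt j.
  by move=> <-; rewrite /base_pt inord_val.
rewrite !big_ord_recl big_ord0 /elem_quad /= (ordE 0%N) // (ordE 1%N) // (ordE 2%N) //.
have [f0 -> [nz0 hx0 hy0]] := wE (base_pt 0).
have [f1 -> [nz1 hx1 hy1]] := wE (base_pt 1).
have [f2 -> [nz2 hx2 hy2]] := wE (base_pt 2).
rewrite /quad_form hx0 hy0 hx1 hy1 hx2 hy2 zpt0 zpt1 zpt2 /=.
have uE : u = M 0 0 * M 1 1 - M 0 1 * M 1 0 by rewrite /u det_mx2.
transitivity (((M 0 0 + M 1 1) ^+ 2 - (M 0 0 * M 1 1 - M 0 1 * M 1 0)) / u).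
  by field; rewrite nz0 nz1 nz2 nz_u.
by rewrite -uE /multiplier_sum mxtrace2 -/u; field.
Qed.

(** ** The Jacobian matrix *)

(** The logarithmic derivative of the cross ratio of four points, for a
    transformation with determinant u that sends them to la, 0, 1, infinity with
    factors ca, cb, cc, ce: the hypotheses compute the brackets, and the result
    has the tangent weights u / c^2 as coefficients. *)
Lemma cross_ratio_differential (la xa ya xb yb xc yc xe ye ca cb cc ce u : C)
    (va vb vc ve : C)
    (br := fun x y x' y' : C => x * y' - x' * y)
    (dbr := fun v y v' y' : C => v * y' - v' * y) :
  ca != 0 -> cb != 0 -> cc != 0 -> ce != 0 -> u != 0 -> la != 0 ->
  u * br xa ya xb yb = ca * cb * la -> u * br xa ya xe ye = - (ca * ce) ->
  u * br xb yb xe ye = - (cb * ce) -> u * br xc yc xb yb = cc * cb ->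
  u * br xc yc xe ye = - (cc * ce) -> u * br xa ya xc yc = ca * cc * (la - 1) ->
  ya * va = va -> yb * vb = vb -> yc * vc = vc -> ye * ve = ve ->
  la * (dbr va ya vb yb / br xa ya xb yb + dbr vc yc ve ye / br xc yc xe ye
   - dbr vc yc vb yb / br xc yc xb yb - dbr va ya ve ye / br xa ya xe ye) =
  u / ca ^+ 2 * va - (1 - la) * (u / cb ^+ 2 * vb) - la * (u / cc ^+ 2 * vc)
   - (la ^+ 2 - la) * (u / ce ^+ 2 * ve).
Proof.
move=> nza nzb nzc nze nzu nzl Eab Eae Ebe Ecb Ece Eac Ea Eb Ec Ee.
have brE x y x' y' z : u * br x y x' y' = z -> br x y x' y' = z / u.
  by move=> <-; rewrite [u * _]mulrC mulfK.
have {}Eab := brE _ _ _ _ _ Eab. have {}Eae := brE _ _ _ _ _ Eae.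
have {}Ebe := brE _ _ _ _ _ Ebe. have {}Ecb := brE _ _ _ _ _ Ecb.
have {}Ece := brE _ _ _ _ _ Ece. have {}Eac := brE _ _ _ _ _ Eac.
(* Three-term relations between brackets merge the two terms of each velocity. *)
have ka : yb * br xa ya xe ye - ye * br xa ya xb yb = ya * br xb yb xe ye.
  by rewrite /br; ring.
have kb : yc * br xa ya xb yb - ya * br xc yc xb yb = yb * br xa ya xc yc.
  by rewrite /br; ring.
have kc : ye * br xc yc xb yb - yb * br xc yc xe ye = - (yc * br xb yb xe ye).
  by rewrite /br; ring.
have ke : ya * br xc yc xe ye - yc * br xa ya xe ye = - (ye * br xa ya xc yc).
  by rewrite /br; ring.
rewrite /dbr; move: (br xa ya xb yb) (br xa ya xe ye) (br xb yb xe ye)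
  (br xc yc xb yb) (br xc yc xe ye) (br xa ya xc yc) Eab Eae Ebe Ecb Ece Eac
  ka kb kc ke => Bab Bae Bbe Bcb Bce Bac Eab Eae Ebe Ecb Ece Eac ka kb kc ke.
have nzab : Bab != 0 by rewrite Eab !mulf_neq0 ?invr_eq0.
have nzae : Bae != 0 by rewrite Eae mulf_neq0 ?invr_eq0 // oppr_eq0 mulf_neq0.
have nzcb : Bcb != 0 by rewrite Ecb !mulf_neq0 ?invr_eq0.
have nzce : Bce != 0 by rewrite Ece mulf_neq0 ?invr_eq0 // oppr_eq0 mulf_neq0.
transitivity (la * (va * ((yb * Bae - ye * Bab) / (Bab * Bae))
   + vb * ((yc * Bab - ya * Bcb) / (Bab * Bcb))
   + vc * ((ye * Bcb - yb * Bce) / (Bce * Bcb))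
   + ve * ((ya * Bce - yc * Bae) / (Bce * Bae)))).
  by field; rewrite nzab nzae nzcb nzce.
rewrite ka kb kc ke -{2}Ea -{2}Eb -{2}Ec -{2}Ee Eab Eae Ebe Ecb Ece Eac.
by field; rewrite nza nzb nzc nze nzu nzl.
Qed.

Definition coord_of k : option 'I_d :=
  if fintype.split k is inr i then Some i else None.

Definition base_x k : C := hx (zpt 0 k).

Definition const_y k : C := hy (zpt 0 k).

Lemma hx_zpt l' k : hx (zpt l' k) = moving_x coord_of base_x k l'.
Proof. by rewrite /zpt /moving_x /coord_of /base_x /zpt; case: fintype.split. Qed.

Lemma hy_zpt l' k : hy (zpt l' k) = const_y k.
Proof. by rewrite /const_y /zpt; case: fintype.split. Qed.

Lemma zbracketE j k l' : zbracket j k l' = moving_bracket coord_of base_x const_y j k l'.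
Proof. by rewrite /zbracket /bracket !hx_zpt !hy_zpt. Qed.

(** The only point whose second coordinate is not 1 is infinity, which is fixed. *)
Lemma velocity_y v k : const_y k * velocity coord_of v k = velocity coord_of v k.
Proof.
rewrite /velocity /coord_of /const_y /zpt.
by case: fintype.split => [j|i] /=; rewrite ?mulr0 ?mul1r.
Qed.

Lemma mul_coord_mx (v : 'cV[C]_d) k :
  (coord_mx *m v) k 0 = - velocity coord_of v^T k.
Proof.
rewrite /coord_mx mul_col_mx mul0mx mulNmx mul1mx mxE /velocity /coord_of.
by case: fintype.split => [j|i]; rewrite !mxE ?oppr0.
Qed.

Lemma mul_jac_mx s (v : 'cV[C]_d) i (w := velocity coord_of v^T) :
  (jac_mx s *m v) i 0 =
    tangent_weight s (coordpt i) * w (s (coordpt i))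
    - (1 - l 0 i) * (tangent_weight s (base_pt 0) * w (s (base_pt 0)))
    - l 0 i * (tangent_weight s (base_pt 1) * w (s (base_pt 1)))
    - (l 0 i ^+ 2 - l 0 i) * (tangent_weight s (base_pt 2) * w (s (base_pt 2))).
Proof.
rewrite /jac_mx -!mulmxA mxE sum_marked_pt.
rewrite !mul_tangent_mx !mul_coord_mx -/w.
under eq_bigr do rewrite mul_tangent_mx mul_coord_mx -/w mxE split_rshift !mxE.
rewrite (bigD1 i) //= eqxx big1 ?addr0 => [|j nji]; last first.
  by rewrite eq_sym (negPf nji) oppr0 mul0r.
rewrite !mxE !split_lshift !mxE !inordK //=.
move: (tangent_weight s _) (tangent_weight s _) (tangent_weight s _) => t0 t1 t2.
move: (tangent_weight s _) (l 0 i) (w _) (w _) (w _) (w _) => t3 x w0 w1 w2 w3.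
by ring.
Qed.

End InjectivePoints.

(** Near [l] the points remain distinct, so the components of [G_elt s] are cross
    ratios and [cross_ratio_differential] applies to their derivatives at [l]. *)
Lemma X_mxE l s : injective (zpt l) -> s \in stabG l -> X_mx l s = jac_mx l s.
Proof.
move=> inj_l stab_s; apply: (can_inj trmxK); rewrite /X_mx trmxK.
apply/row_matrixP => j; rewrite rowE [RHS]rowE; set v := delta_mx 0 j.
apply/rowP => i; pose zb := moving_bracket coord_of base_x const_y.
have nz_zb s' j' k : j' != k -> zb (s' j') (s' k) l != 0.
  by move=> njk; rewrite /zb -zbracketE bracket_eq0; apply: zpt_perm_neq.
rewrite (@jacobian_moving_cross _ _ _ coord_of base_x const_y l (G_elt s)
  (fun i => s (coordpt i)) (fun=> s (base_pt 0)) (fun=> s (base_pt 1))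
  (fun=> s (base_pt 2))); first last.
- move=> i'; rewrite !(inj_eq perm_inj) !coordpt_neq base_pt_neq.
  by rewrite eq_sym base_pt_neq.
- move=> l' nz i'; rewrite -/zb in nz.
  have inj_l' : injective (zpt l').
    move=> j' k /eqP; rewrite -bracket_eq0 -/(zbracket j' k l') zbracketE.
    by apply: contraTeq; exact: nz.
  rewrite (G_elt_cross_ratio inj_l') /cross_ratio !zbracketE.
  by rewrite /moving_cross.
- by move=> j' k njk; have := nz_zb 1%g _ _ njk; rewrite !perm1.
have -> : (v *m (jac_mx l s)^T) 0 i = (jac_mx l s *m v^T) i 0.
  by rewrite -[v in LHS]trmxK -trmx_mul mxE.
rewrite mul_jac_mx trmxK.
have la_nz : l 0 i != 0.
  have := coordpt_neq i; case=> -[/negP n0 _] _; apply/negP => /eqP l0.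
  by apply/n0/eqP/inj_l; rewrite zpt_coord zpt0 l0.
have -> : moving_cross coord_of base_x const_y (s (coordpt i)) (s (base_pt 0))
    (s (base_pt 1)) (s (base_pt 2)) l = l 0 i.
  have /(stabGP inj_l)/(_ (coordpt i)) := stab_s.
  rewrite lft_coordpt // zpt_coord => -[<-].
  by rewrite /cross_ratio !zbracketE.
have M_ k := cfg_maps_to inj_l k stab_s; have nz_ k := (M_ k).1.
have nz_u : \det (cfg_mx l s) != 0 by rewrite -unitfE -unitmxE cfg_mx_unit //.
have brE j' k : \det (cfg_mx l s) *
    (moving_x coord_of base_x (s j') l * const_y (s k)
     - moving_x coord_of base_x (s k) l * const_y (s j')) =
    mult_factor l s j' * mult_factor l s k * bracket (zpt l j') (zpt l k).
  by rewrite -!hx_zpt -!(hy_zpt l); exact: bracket_maps_to.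
pose x k := moving_x coord_of base_x (s k) l; pose y k := const_y (s k).
apply: (@cross_ratio_differential (l 0 i)
  (x (coordpt i)) (y (coordpt i)) (x (base_pt 0)) (y (base_pt 0))
  (x (base_pt 1)) (y (base_pt 1)) (x (base_pt 2)) (y (base_pt 2))
  _ _ _ _ _ (velocity coord_of v (s (coordpt i)))
  (velocity coord_of v (s (base_pt 0))) (velocity coord_of v (s (base_pt 1)))
  (velocity coord_of v (s (base_pt 2))) (nz_ (coordpt i)) (nz_ (base_pt 0))
  (nz_ (base_pt 1)) (nz_ (base_pt 2)) nz_u la_nz); try exact: velocity_y.
all: by rewrite /x /y brE /bracket ?zpt0 ?zpt1 ?zpt2 ?zpt_coord /=; ring.
Qed.

End MarkedPoints.

(** * Representations of the icosahedral group *)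

Section IcosahedralGroup.
Variables (gT : finGroupType) (G : {group gT}) (f : {morphism G >-> 'S_5}).
Hypotheses (injf : ('injm f)%g) (imf : (f @* G = 'Alt_('I_5))%g).
Local Notation Alt5 := ('Alt_('I_5))%g.

Lemma im_Alt5 s : s \in G -> f s \in Alt5.
Proof. by move=> Gs; rewrite -imf mem_morphim. Qed.

Lemma preim_Alt5 t : t \in Alt5 -> exists2 s, s \in G & t = f s.
Proof. by rewrite -imf => /morphimP[s _ Gs ->]; exists s. Qed.

Lemma icosahedral_order s : s \in G -> #[s]%g \in [:: 1; 2; 3; 5]%N.
Proof. by move=> Gs; rewrite -(order_injm injf) // Alt5_order ?im_Alt5. Qed.

Lemma icosahedral_cases (P : gT -> Prop) :
    P 1%g -> (forall s, s \in G -> #[s]%g = 2%N -> P s) ->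
    (forall s, s \in G -> #[s]%g = 3%N -> P s) ->
    (forall s, s \in G -> #[s]%g = 5%N -> P s) ->
  forall s, s \in G -> P s.
Proof.
move=> P1 P2 P3 P5 s Gs; have := icosahedral_order Gs.
rewrite !inE => /or4P[] /eqP os; [|exact: P2|exact: P3|exact: P5].
by move/eqP: os; rewrite order_eq1 => /eqP->.
Qed.

Definition elts_of_order (k : nat) := [set s in G | #[s]%g == k]%SET.

Lemma card_elts_of_order (k : nat) :
  #|elts_of_order k| = count (fun c => code_order c == k) square_codes.
Proof.
rewrite -card_Alt5_order -(card_in_imset (f := f) (D := mem (elts_of_order k))).
  apply: eq_card => t; rewrite finset.in_set; apply/imsetP/andP.
    case=> s; rewrite finset.in_set => /andP[Gs /eqP os] ->.
    by rewrite im_Alt5 // order_injm // os.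
  case=> /preim_Alt5[s Gs ->]; rewrite order_injm // => os.
  by exists s => //; rewrite finset.in_set Gs.
move=> s t; rewrite !finset.in_set => /andP[Gs _] /andP[Gt _].
by move/injmP: injf; apply.
Qed.

Lemma card_elts_of_order5 : #|elts_of_order 5| = 24%N.
Proof. by rewrite card_elts_of_order. Qed.

Lemma card_icosahedral : #|G| = 60%N.
Proof.
have := @card_Alt 'I_5; rewrite card_ord => /(_ isT) cardA.
rewrite -(card_injm injf (subxx G)) imf; apply/eqP.
by rewrite -(eqn_pmul2l (_ : 0 < 2)%N) // cardA.
Qed.

Lemma sum_by_order (V : nmodType) (F : gT -> V) :
  \sum_(s in G) F s = F 1%g + \sum_(s in elts_of_order 2) F s +
    \sum_(s in elts_of_order 3) F s + \sum_(s in elts_of_order 5) F s.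
Proof.
pose part (k : nat) := \sum_(s in G | #[s]%g == k) F s.
have partE k : \sum_(s in elts_of_order k) F s = part k.
  by apply: eq_bigl => s; rewrite finset.in_set.
rewrite !partE; have -> : F 1%g = part 1%N.
  rewrite /part (big_pred1 1%g) // => s; rewrite order_eq1 andbC.
  by rewrite /=; case: (eqVneq s 1%g) => //= ->; rewrite group1.
rewrite (bigID (fun s => #[s]%g == 1%N)) -!addrA; congr (_ + _).
rewrite (bigID (fun s => #[s]%g == 2%N)); congr (_ + _).
  by apply: eq_bigl => s; case: (s \in G) => //=; case: eqP => [->|]; rewrite ?andbF.
rewrite (bigID (fun s => #[s]%g == 3%N)); congr (_ + _).
  apply: eq_bigl => s; case: (s \in G) => //=.
  by have [->|] := eqVneq #[s]%g 3%N; rewrite ?andbF.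
apply: eq_bigl => s; case Gs: (s \in G) => //=.
have := icosahedral_order Gs; rewrite !inE.
by move: (#[s]%g) => o /or4P[]/eqP->.
Qed.

Lemma icosahedral_involutions s t : s \in G -> t \in G ->
  #[s]%g = 2%N -> #[t]%g = 2%N -> exists2 c, c \in G & t = (s ^ c)%g.
Proof.
move=> Gs Gt os ot; have [c' Ac] : exists2 c, c \in Alt5 & f t = (f s ^ c)%g.
  by apply: Alt5_involutions_conj; rewrite ?im_Alt5 ?order_injm.
have [c Gc ->] := preim_Alt5 Ac; rewrite -morphJ // => fE.
by exists c => //; move/injmP: injf => /(_ t (s ^ c)%g); apply; rewrite ?groupJ.
Qed.

Definition transp : 'S_5 := tperm (inord 0) (inord 1).

(** The outer automorphism, from conjugation by a transposition. *)
Definition outer_aut (s : gT) : gT := invm injf (f s ^ transp)%g.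

Lemma conj_transp s : s \in G -> (f s ^ transp)%g \in (f @* G)%g.
Proof.
by move=> Gs; rewrite imf memJ_norm ?im_Alt5 // (fintype.subsetP (Alt_norm _)) // inE.
Qed.

Lemma f_outer_aut s : s \in G -> f (outer_aut s) = (f s ^ transp)%g.
Proof. by move=> Gs; rewrite /outer_aut invmK ?conj_transp. Qed.

Lemma outer_aut_in s : s \in G -> outer_aut s \in G.
Proof.
move=> Gs; have /morphimP[t _ Gt fE] := conj_transp Gs.
by rewrite /outer_aut fE invmE.
Qed.

Lemma outer_autM : {in G &, {morph outer_aut : s t / (s * t)%g}}.
Proof.
by move=> s t Gs Gt; rewrite /outer_aut morphM // conjMg morphM ?conj_transp.
Qed.

Lemma outer_aut1 : outer_aut 1 = 1%g.
Proof. by rewrite /outer_aut morph1 conj1g morph1. Qed.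

Lemma order_outer_aut s : s \in G -> #[outer_aut s]%g = #[s]%g.
Proof.
move=> Gs; rewrite -(order_injm injf) ?outer_aut_in // f_outer_aut //.
by rewrite orderJ order_injm.
Qed.

Lemma outer_aut5 s : s \in G -> #[s]%g = 5%N ->
  exists2 c, c \in G & outer_aut s = ((s ^+ 2) ^ c)%g.
Proof.
move=> Gs os; have [c' Ac] := Alt5_odd_conj_square (im_Alt5 Gs)
  (etrans (order_injm injf Gs) os).
have [c Gc ->] := preim_Alt5 Ac; rewrite -f_outer_aut // -morphX // -morphJ ?groupX //.
move=> fE; exists c => //; move/injmP: injf => /(_ (outer_aut s)); apply => //.
  exact: outer_aut_in.
by rewrite groupJ ?groupX.
Qed.

(** ** The irreducible representations *)

Variable F : numClosedFieldType.
Local Notation representation := (representation F G).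

(** The character table by the order of the element; for order 5 the parameter
    separates the two classes and stands for the sum of the multipliers. *)
Definition icosahedral_chars (o : nat) (y : F) : seq F :=
  match o with
  | 1 => [:: 1; 4%:R; 5%:R; 3%:R; 3%:R]
  | 2 => [:: 1; 0; 1; -1; -1]
  | 3 => [:: 1; 1; -1; 0; 0]
  | _ => [:: 1; -1; 0; y + 1; - y]
  end.

(** The action by conjugation on 2 x 2 matrices is a model of [A], and the sum of
    the multipliers is one of [y]. *)
Variables (n : nat) (A : mx_representation F G n) (y : gT -> F).
Hypotheses (chiA : {in G, forall s, chi_of A s = y s + 2%:R}) (y1 : y 1%g = 2%:R).
Hypotheses (y2 : {in G, forall s, #[s]%g = 2%N -> y s = - 2%:R}).
Hypotheses (y3 : {in G, forall s, #[s]%g = 3%N -> y s = -1}).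
Hypotheses (y5 : {in G, forall s, #[s]%g = 5%N -> y s ^+ 2 + y s = 1}).
Hypotheses (ysq : {in G, forall s, y (s ^+ 2)%g = y s ^+ 2 - 2%:R}).

Lemma dimA : n = 4%N.
Proof.
have := chiA (group1 G); rewrite /chi_of repr_mx1 mxtrace1 y1 -natrD => /eqP.
by rewrite eqr_nat => /eqP.
Qed.

(** Squaring exchanges the two roots of x^2 + x - 1, whose sum is -1. *)
Lemma y_sq5 s : s \in G -> #[s]%g = 5%N -> y (s ^+ 2)%g = -1 - y s.
Proof.
move=> Gs os; have y5s := y5 Gs os; rewrite ysq //.
have -> : y s ^+ 2 = 1 - y s by rewrite -y5s addrK.
by ring.
Qed.

Lemma order5_sq (s : gT) : #[s]%g = 5%N -> #[s ^+ 2]%g = 5%N.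
Proof. by move=> os; rewrite orderXgcd os. Qed.

Lemma y_inv s : s \in G -> y s^-1%g = y s.
Proof.
move: s; apply: icosahedral_cases => [|s Gs os|s Gs os|s Gs os].
- by rewrite invg1.
- by rewrite !y2 ?groupV ?orderV.
- by rewrite !y3 ?groupV ?orderV.
have s5 : (s ^+ 5 = 1)%g by rewrite -os expg_order.
have -> : (s^-1 = (s ^+ 2) ^+ 2)%g.
  by rewrite -expgM; apply: (mulIg s); rewrite mulVg -expgSr; apply/esym.
by rewrite !y_sq5 ?groupX ?order5_sq //; ring.
Qed.

(** Squaring permutes the elements of order 5, so the two roots, whose sum is -1,
    occur equally often among their 24 values. *)
Lemma sum_y_order5 : \sum_(s in elts_of_order 5) y s = - 12%:R.
Proof.
set S := \sum_(s in _) _.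
have SE : S = \sum_(s in elts_of_order 5) (-1 - y s).
  rewrite /S (reindex_onto (fun s => s ^+ 2)%g (fun s => s ^+ 3)%g) /=; last first.
    move=> s; rewrite finset.in_set => /andP[_ /eqP os].
    have s5 : (s ^+ 5 = 1)%g by rewrite -os expg_order.
    by rewrite -expgM (expgD s 5 1) s5 mul1g expg1.
  apply: eq_big => [s|s /andP[]]; rewrite !finset.in_set.
    apply/andP/andP => [[/andP[Gs2 os2] /eqP e]|[Gs /eqP os]].
      have Gs : s \in G by rewrite -e groupX.
      split=> //; rewrite -e orderXgcd (eqP os2) //.
    have s5 : (s ^+ 5 = 1)%g by rewrite -os expg_order.
    rewrite groupX // order5_sq // eqxx -expgM; split=> //.
    by rewrite (expgD s 5 1) s5 mul1g expg1.
  move=> /andP[Gs2 os2] /eqP e; have Gs : s \in G by rewrite -e groupX.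
  by rewrite y_sq5 // -e orderXgcd (eqP os2).
have : S + S = - 24%:R.
  rewrite {1}SE sumrB -/S subrK sumr_const card_elts_of_order.
  by rewrite mulNrn.
rewrite -mulr2n => eqS; apply: (mulIf (_ : 2%:R != 0)).
  by rewrite pnatr_eq0.
by rewrite [LHS]mulr_natr eqS mulNr -natrM.
Qed.

(** All five characters are real class functions, so their norms follow from
    the numbers of elements of each order. *)
Lemma class_char_dot (phi : gT -> F) (c2 c3 : F) (h : F -> F) :
    (forall s, s \in G -> #[s]%g = 2%N -> phi s = c2) ->
    (forall s, s \in G -> #[s]%g = 3%N -> phi s = c3) ->
    (forall s, s \in G -> #[s]%g = 5%N -> phi s = h (y s)) ->
  char_dot G phi phi = phi 1%g ^+ 2 + 15%:R * c2 ^+ 2 + 20%:R * c3 ^+ 2 +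
    \sum_(s in elts_of_order 5) h (y s) ^+ 2.
Proof.
move=> phi2 phi3 phi5; rewrite /char_dot sum_by_order invg1.
rewrite (eq_bigr (fun=> c2 ^+ 2)) => [|s]; last first.
  rewrite finset.in_set => /andP[Gs /eqP os].
  by rewrite !phi2 ?groupV ?orderV.
rewrite [X in _ + X + _](eq_bigr (fun=> c3 ^+ 2)) => [|s]; last first.
  rewrite finset.in_set => /andP[Gs /eqP os].
  by rewrite !phi3 ?groupV ?orderV.
rewrite [X in _ + X = _](eq_bigr (fun s => h (y s) ^+ 2)) => [|s]; last first.
  rewrite finset.in_set => /andP[Gs /eqP os].
  by rewrite !phi5 ?groupV ?orderV // y_inv.
rewrite !sumr_const !card_elts_of_order -[c2 ^+ 2 *+ _]mulr_natl.
by rewrite -[c3 ^+ 2 *+ _]mulr_natl.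
Qed.

(** A difference of two characters that has the values of a row of the table is an
    irreducible character as soon as the row has norm 1. *)
Lemma irr_by_order n1 n2 (rG1 : mx_representation F G n1)
    (rG2 : mx_representation F G n2) (i : nat) (h : F -> F) :
    (n2 < n1)%N ->
    {in G, forall s, chi_of rG1 s - chi_of rG2 s =
       nth 0 (icosahedral_chars #[s]%g (y s)) i} ->
    (forall z, nth 0 (icosahedral_chars 5 z) i = h z) ->
    nth 0 (icosahedral_chars 1 0) i ^+ 2 +
      15%:R * nth 0 (icosahedral_chars 2 0) i ^+ 2 +
      20%:R * nth 0 (icosahedral_chars 3 0) i ^+ 2 +
      \sum_(s in elts_of_order 5) h (y s) ^+ 2 = 60%:R ->
  exists Y : representation, mx_irreducible Y /\
    {in G, forall s, chi_of Y s = nth 0 (icosahedral_chars #[s]%g (y s)) i}.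
Proof.
move=> lt_n phiE hE norm_phi.
have [|//|Y [irrY chiY]] := @irr_of_virtual_char F _ G _ _ rG1 rG2.
  rewrite (@class_char_dot _ (nth 0 (icosahedral_chars 2 0) i)
     (nth 0 (icosahedral_chars 3 0) i) h) => [|s Gs os|s Gs os|s Gs os].
  - by rewrite phiE // order1 norm_phi card_icosahedral.
  - by rewrite phiE // os.
  - by rewrite phiE // os.
  - by rewrite phiE // os hE.
by exists Y; split=> // s Gs; rewrite chiY // phiE.
Qed.

Lemma triv_mx_repr : mx_repr G (fun _ : gT => 1%:M : 'M[F]_1).
Proof. by split=> // s t _ _; rewrite mulmx1. Qed.
Definition triv_repr := MxRepresentation triv_mx_repr.

Lemma chi_triv s : chi_of triv_repr s = 1.
Proof. by rewrite /chi_of mxtrace1. Qed.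

Lemma chi_grepr0 s : chi_of (@grepr0 F gT G) s = 0.
Proof. by rewrite /chi_of mxtrace1. Qed.

Lemma natural_mx_repr : mx_repr G (fun s => perm_mx (f s) : 'M[F]_5).
Proof.
by split=> [|s t Gs Gt]; rewrite ?morph1 ?perm_mx1 // morphM // perm_mxM.
Qed.
Definition natural_repr := MxRepresentation natural_mx_repr.

Lemma chi_natural s : s \in G ->
  chi_of natural_repr s = (nth 0 [:: 0; 5; 1; 2; 0; 0] #[s]%g)%N%:R.
Proof.
move=> Gs; rewrite -(order_injm injf Gs) -Alt5_fix ?im_Alt5 // /chi_of /mxtrace.
rewrite cardsE -sum1_card natr_sum [RHS]big_mkcond /=; apply: eq_bigr => i _.
rewrite !mxE [X in if X then _ else _](_ : _ = (f s i == i)) //.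
by case: eqP.
Qed.

Lemma outer_mx_repr : mx_repr G (fun s => A (outer_aut s)).
Proof.
split=> [|s t Gs Gt]; first by rewrite outer_aut1 repr_mx1.
by rewrite outer_autM // repr_mxM ?outer_aut_in.
Qed.
Definition outer_repr := MxRepresentation outer_mx_repr.

Lemma chi_conj (m : nat) (B : mx_representation F G m) s c :
  s \in G -> c \in G -> chi_of B (s ^ c)%g = chi_of B s.
Proof.
move=> Gs Gc; rewrite /chi_of conjgE !repr_mxM ?groupV ?groupM //.
by rewrite mxtrace_mulC -mulmxA -repr_mxM ?groupV // mulgV repr_mx1 mulmx1.
Qed.

Lemma chi_outer5 s : s \in G -> #[s]%g = 5%N -> chi_of outer_repr s = 1 - y s.
Proof.
move=> Gs os; have [c Gc oE] := outer_aut5 Gs os.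
rewrite -[LHS]/(chi_of A (outer_aut s)) oE chi_conj ?groupX //.
by rewrite chiA ?groupX // y_sq5 //; ring.
Qed.

Lemma icosahedral_irr1 : exists Y : representation, mx_irreducible Y /\
  {in G, forall s, chi_of Y s = nth 0 (icosahedral_chars #[s]%g (y s)) 0}.
Proof.
apply: (@irr_by_order _ _ triv_repr (@grepr0 F gT G) 0 (fun=> 1)) => //.
  apply: icosahedral_cases => [|s Gs os|s Gs os|s Gs os];
  by rewrite chi_triv chi_grepr0 subr0 ?order1 ?os.
by rewrite /= sumr_const card_elts_of_order5; ring.
Qed.

(** The permutation representation of degree 5, minus the trivial one. *)
Lemma icosahedral_irr2 : exists Y : representation, mx_irreducible Y /\
  {in G, forall s, chi_of Y s = nth 0 (icosahedral_chars #[s]%g (y s)) 1}.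
Proof.
apply: (@irr_by_order _ _ natural_repr triv_repr 1 (fun=> -1)) => //.
  apply: icosahedral_cases => [|s Gs os|s Gs os|s Gs os];
  by rewrite chi_natural // chi_triv ?order1 ?os /=; ring.
by rewrite /= sumr_const card_elts_of_order5 /=; ring.
Qed.

Lemma sum_sq_order5 (h : F -> F) : (forall z, z ^+ 2 + z = 1 -> h z ^+ 2 = z + 2%:R) ->
  \sum_(s in elts_of_order 5) h (y s) ^+ 2 = 36%:R.
Proof.
move=> hE; rewrite (eq_bigr (fun s => y s + 2%:R)) => [|s]; last first.
  by rewrite finset.in_set => /andP[Gs /eqP os]; rewrite hE ?y5.
rewrite big_split /= sum_y_order5 sumr_const card_elts_of_order5.
by ring.
Qed.

(** The representation [A] contains the trivial one, as the scalars among the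
    2 x 2 matrices. *)
Lemma icosahedral_irr4 : exists Y : representation, mx_irreducible Y /\
  {in G, forall s, chi_of Y s = nth 0 (icosahedral_chars #[s]%g (y s)) 3}.
Proof.
apply: (@irr_by_order _ _ A triv_repr 3 (fun z => z + 1)) => //.
- by rewrite dimA.
- apply: icosahedral_cases => [|s Gs os|s Gs os|s Gs os];
  rewrite chiA // chi_triv ?order1 ?os /= ?y1.
  + by ring.
  + by rewrite (y2 Gs os); ring.
  + by rewrite (y3 Gs os); ring.
  + by ring.
rewrite (sum_sq_order5 (h := fun z => z + 1)) /=; first by ring.
move=> z zE; transitivity (z ^+ 2 + z + z + 1); first by ring.
by rewrite zE; ring.
Qed.

(** The previous representation, twisted by the outer automorphism. *)
Lemma icosahedral_irr5 : exists Y : representation, mx_irreducible Y /\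
  {in G, forall s, chi_of Y s = nth 0 (icosahedral_chars #[s]%g (y s)) 4}.
Proof.
apply: (@irr_by_order _ _ outer_repr triv_repr 4 (fun z => - z)) => //.
- by rewrite dimA.
- apply: icosahedral_cases => [|s Gs os|s Gs os|s Gs os].
  + rewrite -[chi_of outer_repr _]/(chi_of A (outer_aut 1)) outer_aut1 chiA //.
    by rewrite chi_triv order1 y1 /=; ring.
  + rewrite -[chi_of outer_repr _]/(chi_of A (outer_aut s)) chiA ?outer_aut_in //.
    by rewrite chi_triv os y2 ?outer_aut_in ?order_outer_aut //=; ring.
  + rewrite -[chi_of outer_repr _]/(chi_of A (outer_aut s)) chiA ?outer_aut_in //.
    by rewrite chi_triv os y3 ?outer_aut_in ?order_outer_aut //=; ring.
  + by rewrite chi_outer5 // chi_triv os /=; ring.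
rewrite (eq_bigr (fun s => 1 - y s)) => [|s]; last first.
  rewrite finset.in_set => /andP[Gs /eqP os]; rewrite sqrrN -(y5 Gs os); ring.
rewrite sumrB sum_y_order5 sumr_const card_elts_of_order5 /=; ring.
Qed.

(** The tensor square of the representation of degree 3, minus itself and the
    trivial one. *)
Lemma icosahedral_irr3 : exists Y : representation, mx_irreducible Y /\
  {in G, forall s, chi_of Y s = nth 0 (icosahedral_chars #[s]%g (y s)) 2}.
Proof.
have [Y [irrY chiY]] := icosahedral_irr4.
have dimY : rdegree Y = 3%N.
  have := chiY _ (group1 G); rewrite order1 /chi_of repr_mx1 mxtrace1 /= => /eqP.
  by rewrite eqr_nat => /eqP.
pose Y1 := dadd_grepr Y (Representation triv_repr).
apply: (@irr_by_order _ _ (prod_repr Y Y) Y1 2 (fun=> 0)) => //.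
- by rewrite /= dimY.
- move=> s Gs; rewrite chi_of_dadd chi_triv.
  rewrite [X in X - _]/chi_of mxtrace_prod -/(chi_of Y s) chiY //.
  move: s Gs; apply: icosahedral_cases => [|s Gs os|s Gs os|s Gs os];
    rewrite ?order1 ?os /=; try ring.
  transitivity (y s ^+ 2 + y s - 1); first by ring.
  by rewrite (y5 Gs os) subrr.
by rewrite /= expr0n big1 // /=; ring.
Qed.

End IcosahedralGroup.

(** * Traces of the Jacobian representation *)

Section ConjugationTrace.
Variable F : fieldType.

Lemma mxtrace_lin_mx n m (g : {linear 'M[F]_(n, m) -> 'M[F]_(n, m)}) :
  \tr (lin_mx g) = \sum_i \sum_j g (delta_mx i j) i j.
Proof.
rewrite /mxtrace (reindex _ (curry_mxvec_bij _ _)) /= pair_big /=.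
by apply: eq_bigr => -[i j] _ /=; rewrite mxE /= vec_mx_delta mxvecE.
Qed.

Definition conj_mx n (M T : 'M[F]_n) : 'M[F]_n := invmx M *m T *m M.

Lemma conj_mx_is_linear n (M : 'M[F]_n) : linear (conj_mx M).
Proof.
by move=> a T U; rewrite /conj_mx mulmxDr mulmxDl -scalemxAr -scalemxAl.
Qed.

HB.instance Definition _ n (M : 'M[F]_n) :=
  GRing.isLinear.Build F 'M[F]_n 'M[F]_n *:%R (conj_mx M) (conj_mx_is_linear M).

(** Conjugation is a tensor product, so its trace is tr (M^-1) tr M, and tr (M^-1)
    is tr M / det M by Cayley-Hamilton. *)
Lemma trace_conj_mx (M : 'M[F]_2) : M \in unitmx ->
  \tr (lin_mx (conj_mx M)) = multiplier_sum M + 2%:R.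
Proof.
move=> Mu; have nz_u : \det M != 0 by rewrite -unitfE -unitmxE.
have trV : \tr (invmx M) = \tr M / \det M.
  have [MM _ _] := mx2_powers M; have := congr1 (mulmx (invmx M)) MM.
  rewrite mulKmx // mulmxBr -scalemxAr mulVmx // mul_mx_scalar.
  move=> /(congr1 mxtrace); rewrite raddfB /= scalemx1 mxtrace_scalar linearZ /= => tE.
  apply: (mulIf nz_u); rewrite divfK //.
  transitivity (\tr M *+ 2 - (\tr M *+ 2 - \det M * \tr (invmx M))).
    by rewrite opprB addrC subrK mulrC.
  by rewrite -tE mulr2n addrK.
transitivity (\tr (invmx M) * \tr M); last first.
  by rewrite trV /multiplier_sum; ring.
rewrite mxtrace_lin_mx /mxtrace big_distrlr /=.
apply: eq_bigr => i _; apply: eq_bigr => j _.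
rewrite /conj_mx mxE (bigD1 j) //= big1 ?addr0 => [|k nkj].
  rewrite mxE (bigD1 i) //= big1 ?addr0 => [|k nki].
    by rewrite mxE !eqxx mulr1.
  by rewrite mxE (negPf nki) mulr0.
rewrite mxE big1 ?mul0r // => k' _.
by rewrite mxE (negPf nkj) andbF mulr0.
Qed.

Lemma lin_conj_mx_scalar n (a : F) : a != 0 ->
  lin_mx (conj_mx (a%:M : 'M[F]_n)) = 1%:M.
Proof.
move=> nz_a; apply/row_matrixP => k; rewrite rowE [RHS]rowE mulmx1 mul_rV_lin /=.
rewrite /conj_mx invmx_scalar mul_scalar_mx mul_mx_scalar scalerA mulfV //.
by rewrite scale1r vec_mxK.
Qed.

(** Scalars cancel in a conjugation, so a projective representation induces a
    linear one on matrices. *)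
Lemma lin_conj_mxM n (M N : 'M[F]_n) a :
    a != 0 -> M \in unitmx -> N \in unitmx ->
  lin_mx (conj_mx (a *: (M *m N))) = lin_mx (conj_mx M) *m lin_mx (conj_mx N).
Proof.
move=> nz_a Mu Nu; have MNu : M *m N \in unitmx by rewrite unitmx_mul Mu.
apply/row_matrixP => k; rewrite rowE [RHS]rowE mulmxA !mul_rV_lin /= mxvecK.
congr mxvec; rewrite /conj_mx invmxZ ?unitmxZ ?unitfE //.
rewrite -!scalemxAl -!scalemxAr scalerA mulVf // scale1r.
have -> : invmx (M *m N) = invmx N *m invmx M.
  apply: (can_inj (mulKmx MNu)).
  by rewrite mulmxV // mulmxA mulmxK // mulmxV.
by rewrite !mulmxA.
Qed.

Lemma multiplier_sum_sq (M : 'M[F]_2) : \det M != 0 ->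
  multiplier_sum (M *m M) = multiplier_sum M ^+ 2 - 2%:R.
Proof.
move=> nz_u; have [MM _ _] := mx2_powers M; rewrite /multiplier_sum.
have -> : \tr (M *m M) = \tr M ^+ 2 - 2%:R * \det M.
  by rewrite MM raddfB /= linearZ /= mxtrace_scalar; ring.
by rewrite det_mulmx; field.
Qed.

Lemma multiplier_sum_scalar (a : F) : a != 0 -> multiplier_sum a%:M = 2%:R.
Proof.
move=> nz_a; rewrite /multiplier_sum mxtrace_scalar det_scalar.
by rewrite -mulr_natr; field.
Qed.

End ConjugationTrace.

Section IcosahedralConfiguration.
Variables (R : realType) (d : nat).
Local Notation C := R[i].
Variables (l : 'rV[C]_d) (G : {group 'S_(3 + d)}).
Hypotheses (inj_l : injective (zpt l)) (defG : stabG l = G :> {set _}).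

Let stab s : s \in G -> s \in stabG l. Proof. by rewrite defG. Qed.

Definition msum (s : 'S_(3 + d)) : C := multiplier_sum (cfg_mx l s).

Lemma det_cfg_mx s : \det (cfg_mx l s) != 0.
Proof. by rewrite -unitfE -unitmxE cfg_mx_unit. Qed.

Lemma jac_mx_repr : mx_repr G (X_mx l).
Proof.
split=> [|s t Gs Gt]; first by rewrite X_mxE ?jac_mx1 // stab.
by rewrite !X_mxE ?stab ?groupM // jac_mxM ?stab.
Qed.

Definition jac_repr := MxRepresentation jac_mx_repr.

Lemma adj_mx_repr : mx_repr G (fun s => lin_mx (conj_mx (cfg_mx l s))).
Proof.
split=> [|s t Gs Gt].
  by have [a nz_a ->] := cfg_mx1 inj_l; exact: lin_conj_mx_scalar.
have [a nz_a ->] := cfg_mxM inj_l (stab Gs) (stab Gt).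
exact: lin_conj_mxM (cfg_mx_unit inj_l s) (cfg_mx_unit inj_l t).
Qed.

Definition adj_repr := MxRepresentation adj_mx_repr.

Lemma chi_adj : {in G, forall s, chi_of adj_repr s = msum s + 2%:R}.
Proof. by move=> s Gs; apply: trace_conj_mx; exact: cfg_mx_unit. Qed.

Lemma msum1 : msum 1 = 2%:R.
Proof. by have [a nz_a E] := cfg_mx1 inj_l; rewrite /msum E multiplier_sum_scalar. Qed.

Lemma msum_sq : {in G, forall s, msum (s ^+ 2)%g = msum s ^+ 2 - 2%:R}.
Proof.
move=> s Gs; rewrite /msum expgS expg1.
have [a nz_a ->] := cfg_mxM inj_l (stab Gs) (stab Gs).
by rewrite multiplier_sum_scale // multiplier_sum_sq ?det_cfg_mx.
Qed.

Lemma cfg_mx_nonscalar s : s \in G -> (1 < #[s]%g)%N -> ~~ is_scalar_mx (cfg_mx l s).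
Proof.
move=> Gs; rewrite order_gt1; apply: contraNN => /(cfg_mx_scalar inj_l (stab Gs)).
by move=> ->.
Qed.

Lemma is_scalar_cfgM s t : s \in G -> t \in G ->
  exists2 a, a != 0 & cfg_mx l s *m cfg_mx l t = a *: cfg_mx l (s * t)%g.
Proof.
move=> Gs Gt; have [a nz_a ->] := cfg_mxM inj_l (stab Gs) (stab Gt).
by exists a^-1; rewrite ?invr_eq0 // scalerA mulVf ?scale1r.
Qed.

Lemma cfg_mx1_scalar a s : s = 1%g -> is_scalar_mx (a *: cfg_mx l s).
Proof.
move=> ->; have [b _ ->] := cfg_mx1 inj_l.
by rewrite scale_scalar_mx; exact: scalar_mx_is_scalar.
Qed.

Lemma msum2 : {in G, forall s, #[s]%g = 2%N -> msum s = - 2%:R}.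
Proof.
move=> s Gs os; apply: multiplier_sum2; rewrite ?det_cfg_mx //.
  by rewrite cfg_mx_nonscalar ?os.
have [a _ ->] := is_scalar_cfgM Gs Gs; apply: cfg_mx1_scalar.
by have := expg_order s; rewrite os.
Qed.

Lemma msum3 : {in G, forall s, #[s]%g = 3%N -> msum s = -1}.
Proof.
move=> s Gs os; apply: multiplier_sum3; rewrite ?det_cfg_mx //.
  by rewrite cfg_mx_nonscalar ?os.
have [a _ ->] := is_scalar_cfgM Gs Gs; rewrite -scalemxAr.
have [b _ ->] := is_scalar_cfgM Gs (groupM Gs Gs); rewrite scalerA.
by apply: cfg_mx1_scalar; have := expg_order s; rewrite os.
Qed.

Lemma msum5 : {in G, forall s, #[s]%g = 5%N -> msum s ^+ 2 + msum s = 1}.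
Proof.
move=> s Gs os; apply: multiplier_sum5; rewrite ?det_cfg_mx //.
  by rewrite cfg_mx_nonscalar ?os.
have [a _ ->] := is_scalar_cfgM Gs Gs; rewrite -scalemxAr.
have [b _ ->] := is_scalar_cfgM Gs (groupM Gs Gs); rewrite scalerA -scalemxAr.
have [c _ ->] := is_scalar_cfgM Gs (groupM Gs (groupM Gs Gs)).
rewrite scalerA -scalemxAr.
have [e _ ->] := is_scalar_cfgM Gs (groupM Gs (groupM Gs (groupM Gs Gs))).
by rewrite scalerA; apply: cfg_mx1_scalar; have := expg_order s; rewrite os.
Qed.

(** ** Marked fixed points *)

Definition fixed_marks (s : 'S_(3 + d)) := [set k | s k == k]%SET.

Lemma fixed_maps_to s k : s \in G -> k \in fixed_marks s ->
  maps_to (cfg_mx l s) (mult_factor l s k) (zpt l k) (zpt l k).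
Proof.
move=> Gs; rewrite finset.in_set => /eqP sk.
by have := cfg_maps_to inj_l k (stab Gs); rewrite sk.
Qed.

(** Three fixed points determine the transformation. *)
Lemma card_fixed_marks_le2 s : s \in G -> s != 1%g -> (#|fixed_marks s| <= 2)%N.
Proof.
move=> Gs; apply: contraR; rewrite -ltnNge => /card_gt2P[i [j [k]]].
case=> -[fi fj fk] [nij njk nki]; apply/eqP/(cfg_mx_scalar inj_l (stab Gs)).
rewrite (fixed3_scalar _ _ _ (fixed_maps_to Gs fi) (fixed_maps_to Gs fj)
  (fixed_maps_to Gs fk)) ?(inj_eq inj_l) ?scalar_mx_is_scalar //.
by rewrite eq_sym.
Qed.

Lemma trace_tangent_mx s : \tr (tangent_mx l s) =
  \sum_(k in fixed_marks s) tangent_weight l s k.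
Proof.
rewrite [RHS]big_mkcond; apply: eq_bigr => k _.
by rewrite mxE finset.in_set eq_sym; case: eqP.
Qed.

Lemma trace_jac0 s : s \in G -> #|fixed_marks s| = 0%N ->
  \tr (X_mx l s) = - (msum s + 1).
Proof.
move=> Gs /eqP; rewrite cards_eq0 => /eqP fix0.
rewrite X_mxE ?stab // trace_jac_mx ?stab // trace_tangent_mx fix0.
by rewrite big_set0 sub0r.
Qed.

(** The tangent weights at the two fixed points are the multipliers, and their sum
    cancels against the trace on the global vector fields. *)
Lemma trace_jac2 s : s \in G -> #|fixed_marks s| = 2%N -> \tr (X_mx l s) = -1.
Proof.
move=> Gs /eqP/cards2P[k [k' [nkk' fixE]]].
rewrite X_mxE ?stab // trace_jac_mx ?stab // trace_tangent_mx fixE.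
rewrite big_setU1 ?inE //= big_set1 opprD addrA.
rewrite /tangent_weight (fixed2_multiplier_sum (p := zpt l k) (q := zpt l k')).
- by rewrite subrr sub0r.
- by rewrite (inj_eq inj_l).
- by apply: fixed_maps_to => //; rewrite fixE !finset.inE eqxx.
- by apply: fixed_maps_to => //; rewrite fixE !finset.inE eqxx orbT.
Qed.

Variable (f : {morphism G >-> 'S_5}).
Hypotheses (injf : ('injm f)%g) (imf : (f @* G = 'Alt_('I_5))%g).

Lemma acts_marks (H : {group 'S_(3 + d)}) : [acts H, on [set: 'I_(3 + d)]%SET | 'P]%g.
Proof. by apply/actsP => s _ k; rewrite !finset.in_setT. Qed.

Lemma fix_marksE s : 'Fix_([set: 'I_(3 + d)]%SET | 'P)[s]%g = fixed_marks s.
Proof.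
by apply/finset.setP => k; rewrite finset.setTI [RHS]finset.in_set; apply/afix1P/eqP.
Qed.

(** The other orbits of the cyclic group have [p] elements. *)
Lemma fixed_marks_mod s p : prime p -> #[s]%g = p ->
  (3 + d = #|fixed_marks s| %[mod p])%N.
Proof.
move=> pr_p os; have pG : (p.-group <[s]>)%g by rewrite /pgroup -/(order s) os pnat_id.
have := pgroup_fix_mod pG (acts_marks _).
by rewrite cardsT card_ord afix_cycle fix_marksE.
Qed.

Lemma card_fixed_marksJ s c : #|fixed_marks (s ^ c)%g| = #|fixed_marks s|.
Proof.
rewrite -[RHS](card_imset _ (@perm_inj _ c)); apply: eq_card => k.
rewrite [LHS]finset.in_set; apply/eqP/imsetP => [sk|[k']].
  exists (c^-1%g k); rewrite ?permKV // finset.in_set.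
  by rewrite -(inj_eq (@perm_inj _ c)) permKV -{2}sk conjgE !permM.
rewrite finset.in_set => /eqP sk ->.
by rewrite conjgE !permM permK sk.
Qed.

(** Elements of order 3 or 5 have at most 2 fixed points, and a known number modulo
    their order. Involutions could have 0 or 2 by parity; being all conjugate, they
    have the same number, and only one value makes the number of orbits, given by
    Burnside's lemma, an integer. *)
Lemma card_fixed_marks (a b c : bool) m :
    (3 + d = 12 * a + 20 * b + 30 * c + 60 * m)%N ->
  [/\ {in G, forall s, #[s]%g = 5%N -> #|fixed_marks s| = (2 * a)%N},
      {in G, forall s, #[s]%g = 3%N -> #|fixed_marks s| = (2 * b)%N}
    & {in G, forall s, #[s]%g = 2%N -> #|fixed_marks s| = (2 * c)%N}].
Proof.
move=> nE.
have le2 s k : s \in G -> #[s]%g = k -> (1 < k)%N -> (#|fixed_marks s| <= 2)%N.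
  by move=> Gs <-; rewrite order_gt1; exact: card_fixed_marks_le2.
have fix5 : {in G, forall s, #[s]%g = 5%N -> #|fixed_marks s| = (2 * a)%N}.
  move=> s Gs os; have := le2 s _ Gs os isT.
  have := fixed_marks_mod (isT : prime 5) os.
  by move: #|fixed_marks s| nE => x; lia.
have fix3 : {in G, forall s, #[s]%g = 3%N -> #|fixed_marks s| = (2 * b)%N}.
  move=> s Gs os; have := le2 s _ Gs os isT.
  have := fixed_marks_mod (isT : prime 3) os.
  by move: #|fixed_marks s| nE => x; lia.
split=> // s Gs os; have := le2 s _ Gs os isT.
have fix2 t : t \in G -> #[t]%g = 2%N -> #|fixed_marks t| = #|fixed_marks s|.
  move=> Gt ot; have [e Ge ->] := icosahedral_involutions injf imf Gs Gt os ot.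
  by rewrite card_fixed_marksJ.
have := Frobenius_Cauchy (acts_marks G); set orbits := #|_|.
rewrite (card_icosahedral injf imf).
have -> : (\sum_(t in G) #|'Fix_([set: 'I_(3 + d)] | 'P)[t]%g| =
    (3 + d) + 15 * #|fixed_marks s| + 20 * (2 * b) + 24 * (2 * a))%N.
  have card_const k x : (forall t, t \in elts_of_order G k -> #|fixed_marks t| = x) ->
      (\sum_(t in elts_of_order G k) #|fixed_marks t|)%N = (#|elts_of_order G k| * x)%N.
    by move=> Fx; rewrite (eq_bigr (fun=> x)) // sum_nat_const.
  rewrite (eq_bigr (fun t => #|fixed_marks t|)) => [|t _]; last by rewrite fix_marksE.
  have := sum_by_order injf imf (fun t => #|fixed_marks t|).
  rewrite (card_const 2%N #|fixed_marks s|) => [|t]; last first.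
    by rewrite finset.in_set => /andP[Gt /eqP]; apply: fix2.
  rewrite (card_const 3%N (2 * b)%N) => [|t]; last first.
    by rewrite finset.in_set => /andP[Gt /eqP]; apply: fix3.
  rewrite (card_const 5%N (2 * a)%N) => [|t]; last first.
    by rewrite finset.in_set => /andP[Gt /eqP]; apply: fix5.
  have -> : #|fixed_marks 1| = (3 + d)%N.
    rewrite -[RHS]card_ord -cardsT; apply: eq_card => k.
    by rewrite !finset.in_set perm1 eqxx.
  by rewrite !(card_elts_of_order injf imf).
by move: #|fixed_marks s| orbits nE => x o; lia.
Qed.

End IcosahedralConfiguration.

(** * Rotations and their multiplier sums *)

Section Angles.
Variable R : realType.
Implicit Types t : R.

Lemma cos_twice t : cos (t + t) = cos t ^+ 2 *+ 2 - 1.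
Proof. by rewrite -mulr2n cos_mulr2n. Qed.

Lemma cos_thrice t : cos (t + t + t) = 4 * cos t ^+ 3 - 3 * cos t.
Proof.
rewrite cosD cos_twice sinD.
transitivity ((cos t ^+ 2 *+ 2 - 1) * cos t - 2 * sin t ^+ 2 * cos t); first by ring.
by rewrite sin2cos2; ring.
Qed.

Lemma cos_lt1 t : 0 < t <= pi -> cos t < 1.
Proof.
move=> /andP[t_gt0 t_le]; rewrite -[X in _ < X](@cos0 R) ltr_cos // in_itv /=.
  by rewrite lexx pi_ge0.
by rewrite t_le ltW.
Qed.

(** Such an angle satisfies cos (2 t) = cos t. *)
Lemma double_cos_third t : t = 2 * pi / 3 -> 2 * cos t = -1.
Proof.
move=> tE; have pi_gt0 := pi_gt0 R.
have c_lt1 : cos t < 1 by apply: cos_lt1; apply/andP; split; lra.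
have : cos (t + t) = cos t.
  by rewrite -(cosN t) -(cosD2pi (- t)); congr cos; lra.
rewrite cos_twice => cE.
have : (cos t - 1) * (2 * cos t + 1) = 0.
  transitivity (cos t ^+ 2 *+ 2 - 1 - cos t); first by ring.
  by rewrite cE subrr.
by move/eqP; rewrite mulf_eq0 => /orP[] /eqP; lra.
Qed.

(** The hypothesis holds for the multiples of 2 pi / 5, for which the double and
    the opposite of the triple differ by a full turn. *)
Lemma double_cos_fifth t : cos (t + t) = cos (t + t + t) -> cos t < 1 ->
  (2 * cos t) ^+ 2 + 2 * cos t = 1.
Proof.
rewrite cos_twice cos_thrice => cE c_lt1.
have : (cos t - 1) * ((2 * cos t) ^+ 2 + 2 * cos t - 1) = 0.
  transitivity (4 * cos t ^+ 3 - 3 * cos t - (cos t ^+ 2 *+ 2 - 1)); first by ring.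
  by rewrite cE subrr.
by move/eqP; rewrite mulf_eq0 => /orP[] /eqP; lra.
Qed.

Lemma golden_sq : golden R ^+ 2 = golden R + 1.
Proof.
have s5 : Num.sqrt 5 ^+ 2 = 5 :> R by rewrite sqr_sqrtr.
rewrite /golden; transitivity ((1 + 2 * Num.sqrt 5 + Num.sqrt 5 ^+ 2) / 4 : R).
  by field.
by rewrite s5; field.
Qed.

Lemma golden'E : golden' R = 1 - golden R.
Proof. by rewrite /golden' /golden; field. Qed.

Lemma golden_gt1 : 1 < golden R.
Proof.
have : 1 < Num.sqrt 5 :> R by rewrite -[X in X < _]sqrtr1 ltr_sqrt //; lra.
by rewrite /golden; lra.
Qed.

Lemma golden_roots (y : R) : y ^+ 2 + y = 1 ->
  (0 < y -> y = golden R - 1) /\ (y < 0 -> y = golden' R - 1).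
Proof.
move=> yE; have g1 := golden_gt1; have g2 := golden_sq.
have : (y - (golden R - 1)) * (y + golden R) = 0.
  transitivity (y ^+ 2 + y - (golden R ^+ 2 - golden R)); first by ring.
  by rewrite yE g2; ring.
rewrite golden'E => /eqP; rewrite mulf_eq0.
by case/orP => /eqP e; split => *; lra.
Qed.

Lemma double_cos_2pi5 t : t = 2 * pi / 5 -> 2 * cos t = golden R - 1.
Proof.
move=> tE; have pi_gt0 := pi_gt0 R.
have c_lt1 : cos t < 1 by apply: cos_lt1; apply/andP; split; lra.
have c_gt0 : 0 < cos t by apply: cos_gt0_pihalf; apply/andP; split; lra.
have [|gE _] := golden_roots (double_cos_fifth _ c_lt1); last by apply: gE; lra.
by rewrite -(cosN (t + t + t)) -(cosD2pi (- _)); congr cos; lra.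
Qed.

Lemma double_cos_4pi5 t : t = 4 * pi / 5 -> 2 * cos t = golden' R - 1.
Proof.
move=> tE; have pi_gt0 := pi_gt0 R.
have c_lt1 : cos t < 1 by apply: cos_lt1; apply/andP; split; lra.
have c_lt0 : cos t < 0.
  have := @cos_gt0_pihalf R (pi - t); rewrite addrC cosDpi cosN oppr_gt0.
  by apply; apply/andP; split; lra.
have [|_ gE] := golden_roots (double_cos_fifth _ c_lt1); last by apply: gE; lra.
rewrite -(cosN (t + t + t)) -(cosD2pi (- _)) -(cosD2pi (- _ + _)); congr cos; lra.
Qed.

(** ** Rotations *)

Definition rotation_mx t : 'M[R[i]]_2 :=
  \matrix_(i, j) if i == j then if i == 0 then (cos t +i* sin t) else 1 else 0.

Lemma det_rotation_mx t : \det (rotation_mx t) = cos t +i* sin t.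
Proof. by rewrite det_mx2 !mxE /= mulr1 mulr0 subr0. Qed.

Lemma rotation_mul_conj t : (cos t +i* sin t) * (cos t -i* sin t) = 1 :> R[i].
Proof.
apply/eqP; rewrite eq_complex /=; apply/andP; split; apply/eqP; last by ring.
by rewrite -(cos2Dsin2 t); ring.
Qed.

Lemma rotation_mx_unit t : rotation_mx t \in unitmx.
Proof.
rewrite unitmxE unitfE det_rotation_mx; apply/eqP => e0.
by have /eqP := rotation_mul_conj t; rewrite e0 mul0r eq_sym oner_eq0.
Qed.

Lemma rotationE t : rotation t = lft (rotation_mx t).
Proof.
apply/funext => -[z|] /=; rewrite !mxE /=; last by rewrite eqxx.
by rewrite mul0r add0r oner_eq0 addr0 divr1.
Qed.

Lemma multiplier_sum_rotation t : multiplier_sum (rotation_mx t) = (2 * cos t)%:C.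
Proof.
have e1 := rotation_mul_conj t.
have nz_e : (cos t +i* sin t) != 0 :> R[i].
  by have := rotation_mx_unit t; rewrite unitmxE unitfE det_rotation_mx.
rewrite /multiplier_sum det_rotation_mx mxtrace2 !mxE /=.
set e := _ +i* _ in e1 nz_e *; set e' := _ -i* _ in e1 *.
transitivity (e + e'); last first.
  by apply/eqP; rewrite eq_complex /=; apply/andP; split; apply/eqP; ring.
have -> : e' = e^-1 by rewrite -[e'](mulKf nz_e) e1 mulr1.
by field.
Qed.

Lemma multiplier_sum_conj (M N P : 'M[R[i]]_2) a : a != 0 ->
    P \in unitmx -> P *m M = a *: (N *m P) ->
  multiplier_sum M = multiplier_sum N.
Proof.
move=> nz_a Pu PM; have ME : M = a *: (invmx P *m (N *m P)).
  by rewrite scalemxAr -PM mulKmx.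
rewrite ME multiplier_sum_scale // /multiplier_sum.
rewrite mxtrace_mulC mulmxK // !det_mulmx det_inv.
have nz : \det P != 0 by rewrite -unitfE -unitmxE.
by rewrite [_ * \det P]mulrC mulKf.
Qed.

Lemma lft_conjugate_rotation (M : 'M[R[i]]_2) t : M \in unitmx ->
  lft_conjugate (lft M) (rotation t) -> multiplier_sum M = (2 * cos t)%:C.
Proof.
move=> Mu [h [P Pu ->]]; rewrite rotationE -!lftM ?rotation_mx_unit // => eq_lft.
have [||a nz_a E] := lft_eq_scale _ _ (esym eq_lft); rewrite ?unitmx_mul ?Mu ?Pu ?rotation_mx_unit //.
by rewrite (multiplier_sum_conj nz_a Pu E) multiplier_sum_rotation.
Qed.

End Angles.

(** * The multiplicity vector from the number of marked points *)

Section MultiplicityVector.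
Variables (R : realType) (d : nat).
Local Notation C := R[i].
Variables (l : 'rV[C]_d) (G : {group 'S_(3 + d)}).
Hypotheses (inj_l : injective (zpt l)) (defG : stabG l = G :> {set _}).
Variable (f : {morphism G >-> 'S_5}).
Hypotheses (injf : ('injm f)%g) (imf : (f @* G = 'Alt_('I_5))%g).

Lemma realC_nat n : (n%:R : C) = (n%:R : R)%:C.
Proof. by rewrite (rmorph_nat (real_complex R)). Qed.

Lemma realCN (x : R) : (- x)%:C = - x%:C.
Proof. by apply/eqP; rewrite eq_complex /= oppr0 !eqxx. Qed.

Lemma realCD (x y : R) : (x + y)%:C = x%:C + y%:C.
Proof. by apply/eqP; rewrite eq_complex /= addr0 !eqxx. Qed.

Lemma realCM (x y : R) : (x * y)%:C = x%:C * y%:C.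
Proof. by apply/eqP; rewrite eq_complex /= !(mulr0, mul0r, addr0, subr0) !eqxx. Qed.

Lemma realC_inj (x y : R) : x%:C = y%:C -> x = y.
Proof. by case. Qed.

(** A rotation angle determines the order, because the multiplier sums 2, -2, -1
    of elements of orders 1, 2, 3 and the two roots of x^2 + x - 1 are distinct. *)
Lemma msum_order s (r : R) : s \in G -> msum l s = r%:C ->
  [/\ #[s]%g = 1%N -> r = 2, #[s]%g = 2%N -> r = - 2, #[s]%g = 3%N -> r = - 1
    & #[s]%g = 5%N -> r ^+ 2 + r = 1].
Proof.
move=> Gs sE; split=> os; apply: realC_inj.
- by rewrite -sE -[RHS](realC_nat 2); move/eqP: os; rewrite order_eq1 => /eqP->; exact: msum1.
- by rewrite -sE realCN -[X in _ = - X](realC_nat 2); exact: msum2 Gs os.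
- by rewrite -sE realCN; exact: msum3 Gs os.
- by rewrite realCD expr2 realCM -sE -expr2; exact: msum5 Gs os.
Qed.

Lemma msum_in_class s t : s \in G -> lft_conjugate (Phi_ l s) (rotation t) ->
  msum l s = (2 * cos t)%:C.
Proof.
by move=> Gs; rewrite Phi_E //; apply: lft_conjugate_rotation; exact: cfg_mx_unit.
Qed.

(** The angle of a rotation determines the sum of its multipliers, and this number
    determines the order and the values of the characters. *)
Lemma in_class_chars s (i j : 'I_5) : in_class l j s ->
  nth 0 (icosahedral_chars #[s]%g (msum l s)) i = chi_I R i j.
Proof.
rewrite /in_class defG => -[Gs].
have g1 := golden_gt1 R; have g2 := golden_sq R; have g3 := golden'E R.
have gC : (golden R - 1)%:C + 1 = (golden R)%:C :> C by rewrite -[X in _ + X]/(1%:C) -realCD subrK.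
have order_cases (P : Prop) : (#[s]%g = 1%N -> P) -> (#[s]%g = 2%N -> P) ->
    (#[s]%g = 3%N -> P) -> (#[s]%g = 5%N -> P) -> P.
  move=> P1 P2 P3 P5; have := icosahedral_order injf imf Gs; rewrite !inE.
  by case/or4P => /eqP.
case: j => -[|[|[|[|[|//]]]]] /= lt_j.
- move=> ->; rewrite order1 /chi_I /=.
  by case: i => -[|[|[|[|[|//]]]]] /= _; rewrite ?realC_nat.
- move=> /(msum_in_class Gs); rewrite double_cos_2pi5 // => sE.
  have [r1 r2 r3 _] := msum_order Gs sE.
  apply: order_cases => [/r1|/r2|/r3|->]; try by move=> e; exfalso; nra.
  rewrite sE /chi_I; case: i => -[|[|[|[|[|//]]]]] /= _; rewrite ?realCN //.
  by rewrite g3 -realCN opprB.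
- move=> /(msum_in_class Gs); rewrite double_cos_4pi5 // => sE.
  have [r1 r2 r3 _] := msum_order Gs sE.
  apply: order_cases => [/r1|/r2|/r3|->]; try by move=> e; exfalso; nra.
  rewrite sE /chi_I; case: i => -[|[|[|[|[|//]]]]] /= _; rewrite ?realCN //.
    by rewrite -[X in _ + X]/(1%:C) -realCD subrK.
  by rewrite g3 -realCN; congr (_%:C); ring.
- move=> /(msum_in_class Gs); rewrite double_cos_third // => sE.
  have [r1 r2 _ r5] := msum_order Gs sE.
  apply: order_cases => [/r1|/r2|->|/r5]; try by move=> e; exfalso; nra.
  by rewrite /chi_I; case: i => -[|[|[|[|[|//]]]]] /= _; rewrite ?realCN.
- move=> /(msum_in_class Gs); rewrite cospi => sE.
  have [r1 _ r3 r5] := msum_order Gs sE.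
  apply: order_cases => [/r1|->|/r3|/r5]; try by move=> e; exfalso; nra.
  by rewrite /chi_I; case: i => -[|[|[|[|[|//]]]]] /= _; rewrite ?realCN.
Qed.

Lemma icosahedral_irr (i : 'I_5) : exists Y : representation C G, mx_irreducible Y /\
  {in G, forall s, chi_of Y s = nth 0 (icosahedral_chars #[s]%g (msum l s)) i}.
Proof.
have chiA := chi_adj inj_l defG; have y1 := msum1 inj_l.
have y2 := msum2 inj_l defG; have y3 := msum3 inj_l defG.
have y5 := msum5 inj_l defG; have ysq := msum_sq inj_l defG.
case: i => -[|[|[|[|[|//]]]]] /= _.
- exact: (icosahedral_irr1 injf imf).
- exact: (icosahedral_irr2 injf imf).
- exact: (icosahedral_irr3 injf imf chiA).
- exact: (icosahedral_irr4 injf imf chiA).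
- exact: (icosahedral_irr5 injf imf chiA).
Qed.

Lemma natr_subl (x y z : nat) : (y + x = z)%N -> x%:R = z%:R - y%:R :> C.
Proof. by move=> <-; rewrite natrD addrC addKr. Qed.

Lemma trace_cases s (a : bool) : s \in G -> #|fixed_marks s| = (2 * a)%N ->
  \tr (X_mx l s) = if a then - 1 else - (msum l s + 1).
Proof.
move=> Gs; case: a => fixs; first exact: (trace_jac2 inj_l defG).
exact: (trace_jac0 inj_l defG).
Qed.

(** The hypotheses on the multiplicities say that the characters agree: in degree,
    on the elements of order 5 (two equations, for the constants and the coefficients
    of [msum l s]), of order 3, and of order 2. The traces of the Jacobian matrices are
    known since the elements of order 5, 3, 2 fix [2 * a], [2 * b], [2 * c] marked
    points. *)
Lemma multiplicity_vector_of_card (a b c : bool) (m p1 p2 p3 p4 p5 : nat) :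
    (3 + d = 12 * a + 20 * b + 30 * c + 60 * m)%N ->
    (p1 + 4 * p2 + 5 * p3 + 3 * p4 + 3 * p5 = d)%N ->
    (p4 + 1 = p5 + a)%N -> (p1 + p4 + 1 = p2)%N -> (p1 + p2 + b = p3)%N ->
    (p1 + p3 + 2 * c = p4 + p5 + 1)%N ->
  has_multiplicity_vector l [tuple p1; p2; p3; p4; p5].
Proof.
move=> nE e1 e5 e5' e3 e2; have [Y Y_irr] := choice icosahedral_irr.
exists G, (jac_repr inj_l defG), Y; split=> //.
- by move=> i; have [] := Y_irr i.
- move=> i j s cl_s; rewrite -(in_class_chars _ cl_s).
  by have [_ chiY] := Y_irr i; apply: chiY; case: cl_s; rewrite defG.
apply: eq_chi_rsim => s Gs; rewrite chi_of_bigdadd.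
under eq_bigr => i _ do rewrite chi_of_muln (Y_irr i).2 // (tnth_nth 0%N).
rewrite !big_ord_recl big_ord0 /= addr0.
have [fix5 fix3 fix2] := card_fixed_marks inj_l defG injf imf nE.
have chiX t : chi_of (jac_repr inj_l defG) t = \tr (X_mx l t) by [].
move: s Gs; apply: (icosahedral_cases injf imf) => [|s Gs os|s Gs os|s Gs os].
- have dE : d%:R = (p1 + 4 * p2 + 5 * p3 + 3 * p4 + 3 * p5)%N%:R :> C by rewrite e1.
  rewrite order1 /chi_of repr_mx1 mxtrace1 dE /=.
  by ring.
- have p3E : p3%:R = (p4 + p5 + 1)%N%:R - (p1 + 2 * c)%N%:R :> C.
    by apply: natr_subl; lia.
  rewrite chiX (trace_cases Gs (fix2 s Gs os)) (msum2 inj_l defG Gs os) os /=.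
  by rewrite -[_ *+ p3]mulr_natr p3E !natrD; case: (c) => /=; ring.
- have p3E : p3%:R = (p1 + p2 + b)%N%:R :> C by rewrite e3.
  rewrite chiX (trace_cases Gs (fix3 s Gs os)) (msum3 inj_l defG Gs os) os /=.
  by rewrite -[_ *+ p3]mulr_natr p3E !natrD; case: (b) => /=; ring.
have p2E : p2%:R = (p1 + p4 + 1)%N%:R :> C by rewrite e5'.
have p4E : p4%:R = (p5 + a)%N%:R - 1 :> C by apply: (@natr_subl _ 1); lia.
rewrite chiX (trace_cases Gs (fix5 s Gs os)) os /=.
by rewrite -[_ *+ p2]mulr_natr -[_ *+ p4]mulr_natr p2E !natrD p4E natrD; case: (a) => /=; ring.
Qed.

End MultiplicityVector.

(** * Exact arithmetic with the golden ratio *)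

(** The pair [(a, b)] stands for [a + b * golden], so that statements about the
    dodecahedron can be decided by evaluation. *)
Section GoldenIntegers.

Definition gint : Type := (int * int)%type.
Definition gadd (x y : gint) : gint := (x.1 + y.1, x.2 + y.2).
Definition gopp (x : gint) : gint := (- x.1, - x.2).
Definition gmul (x y : gint) : gint :=
  (x.1 * y.1 + x.2 * y.2, x.1 * y.2 + x.2 * y.1 + x.2 * y.2).

(** A sufficient test, from the bounds 8/5 < golden < 13/8. *)
Definition gpos (x : gint) : bool :=
  if 0 <= x.2 then 0 < 5 * x.1 + 8 * x.2 else 0 < 8 * x.1 + 13 * x.2.

Definition gvec : Type := (gint * gint * gint)%type.
Definition vadd (u v : gvec) : gvec :=
  (gadd u.1.1 v.1.1, gadd u.1.2 v.1.2, gadd u.2 v.2).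
Definition vopp (u : gvec) : gvec := (gopp u.1.1, gopp u.1.2, gopp u.2).
Definition vscale (c : gint) (u : gvec) : gvec :=
  (gmul c u.1.1, gmul c u.1.2, gmul c u.2).
Definition vdot (u v : gvec) : gint :=
  gadd (gadd (gmul u.1.1 v.1.1) (gmul u.1.2 v.1.2)) (gmul u.2 v.2).
Definition vzero : gvec := ((0, 0), (0, 0), (0, 0)).
Definition vcross (u v : gvec) : gvec :=
  (gadd (gmul u.1.2 v.2) (gopp (gmul u.2 v.1.2)),
   gadd (gmul u.2 v.1.1) (gopp (gmul u.1.1 v.2)),
   gadd (gmul u.1.1 v.1.2) (gopp (gmul u.1.2 v.1.1))).
Definition vsum (s : seq gvec) : gvec := foldr vadd vzero s.

(** The norm, i.e. the product with the conjugate, is an integer. *)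
Definition gnonzero (x : gint) : bool := x.1 ^+ 2 + x.1 * x.2 - x.2 ^+ 2 != 0.

Definition vnonzero (u : gvec) : bool :=
  [|| gnonzero u.1.1, gnonzero u.1.2 | gnonzero u.2].

Variable R : realType.

Definition gval (x : gint) : R := x.1%:~R + x.2%:~R * golden R.
Definition vval (u : gvec) : 'rV[R]_3 := vec3 (gval u.1.1) (gval u.1.2) (gval u.2).

Lemma gval_add x y : gval (gadd x y) = gval x + gval y.
Proof. by rewrite /gval !rmorphD /=; ring. Qed.

Lemma gval_opp x : gval (gopp x) = - gval x.
Proof. by rewrite /gval !rmorphN /=; ring. Qed.

Lemma gval_mul x y : gval (gmul x y) = gval x * gval y.
Proof.
rewrite /gval !rmorphD !rmorphM /=.
transitivity (x.1%:~R * y.1%:~R + x.2%:~R * y.2%:~R * (golden R + 1) +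
  (x.1%:~R * y.2%:~R + x.2%:~R * y.1%:~R) * golden R : R); first by ring.
by rewrite -golden_sq; ring.
Qed.

Lemma gval0 : gval (0, 0) = 0.
Proof. by rewrite /gval mul0r addr0. Qed.

Lemma golden_bounds : 8 / 5 < golden R < 13 / 8.
Proof. by have := golden_sq R; have := golden_gt1 R => *; apply/andP; split; nra. Qed.

Lemma gposP x : gpos x -> 0 < gval x.
Proof.
have /andP[g1 g2] := golden_bounds; rewrite /gpos /gval.
case: ifP => [b_ge0|/negbT]; rewrite -?ltNge -?(ltr0z R) ?rmorphD ?rmorphM /=.
  by move: b_ge0; rewrite -(ler0z R) => b_ge0 h; nra.
by rewrite -(ltrz0 R) => b_lt0 h; nra.
Qed.

Lemma gnonzeroP x : gnonzero x -> gval x != 0.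
Proof.
apply: contraNneq => x0; rewrite -(intr_eq0 R) rmorphB rmorphD !rmorphXn rmorphM /=.
have x0' : gval x * (x.1%:~R + x.2%:~R * (1 - golden R)) = 0 by rewrite x0 mul0r.
apply/eqP; rewrite -[RHS]x0' /gval.
transitivity (x.1%:~R ^+ 2 + x.1%:~R * x.2%:~R + x.2%:~R ^+ 2 *
  (golden R - golden R ^+ 2) : R); last by ring.
by rewrite golden_sq; ring.
Qed.

Lemma vec3E (x y z : R) : ((vec3 x y z 0 0 = x) * (vec3 x y z 0 1 = y) *
  (vec3 x y z 0 (inord 2) = z))%type.
Proof. by rewrite /vec3 !mxE /= inordK. Qed.

Lemma row3P (u v : 'rV[R]_3) : u 0 0 = v 0 0 -> u 0 1 = v 0 1 ->
  u 0 (inord 2) = v 0 (inord 2) -> u = v.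
Proof.
move=> e0 e1 e2; apply/rowP => -[[|[|[|//]]] lt_j].
- by rewrite (_ : Ordinal lt_j = 0) //; apply: val_inj.
- by rewrite (_ : Ordinal lt_j = 1) //; apply: val_inj.
- by rewrite (_ : Ordinal lt_j = inord 2) //; apply: val_inj; rewrite /= inordK.
Qed.

Lemma sum3E (f : 'I_3 -> R) : \sum_j f j = f 0 + f 1 + f (inord 2).
Proof.
rewrite !big_ord_recl big_ord0 addr0 addrA.
by congr (f _ + f _ + f _); apply: val_inj; rewrite /= ?inordK.
Qed.

Lemma dotpE (u v : 'rV[R]_3) :
  dotp u v = u 0 0 * v 0 0 + u 0 1 * v 0 1 + u 0 (inord 2) * v 0 (inord 2).
Proof. by rewrite /dotp mxE sum3E !mxE. Qed.

Lemma vval_add u v : vval (vadd u v) = vval u + vval v.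
Proof. by apply: row3P; rewrite [RHS]mxE /vval !vec3E gval_add. Qed.

Lemma dotp_vval u v : dotp (vval u) (vval v) = gval (vdot u v).
Proof. by rewrite dotpE !vec3E /vdot !gval_add !gval_mul. Qed.

End GoldenIntegers.

(** * Faces, edges and vertices of the dodecahedron *)

Section DodecahedronFaces.

Let signs : seq int := [:: 1; -1].

(** The vertices, multiplied by the square root of 3; the inverse of the golden
    ratio is [(-1, 1)]. *)
Definition vertices : seq gvec :=
  [seq ((p.1, 0), (p.2, 0), (c, 0)) | p <- [seq (a, b) | a <- signs, b <- signs], c <- signs]
  ++ [seq ((0, 0), (- a, a), (0, b)) | a <- signs, b <- signs]
  ++ [seq ((0, b), (0, 0), (- a, a)) | a <- signs, b <- signs]
  ++ [seq ((- a, a), (0, b), (0, 0)) | a <- signs, b <- signs].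

(** The outer normals of the faces: the vertices of an icosahedron. *)
Definition normals : seq gvec :=
  [seq ((0, 0), (0, a), (b, 0)) | a <- signs, b <- signs]
  ++ [seq ((b, 0), (0, 0), (0, a)) | a <- signs, b <- signs]
  ++ [seq ((0, a), (b, 0), (0, 0)) | a <- signs, b <- signs].

(** The value of the normal of a face on its vertices. *)
Definition height : gint := (1, 1).

Definition gap (n t : gvec) : gint := gadd height (gopp (vdot n t)).

Definition on_face (n t : gvec) : bool := gap n t == (0, 0).

Definition face (S : seq gvec) : seq gvec :=
  [seq t <- vertices | all (fun n => on_face n t) S].

Definition normals_at (t : gvec) : seq gvec := [seq n <- normals | on_face n t].

Definition vsub (s t : gvec) : gvec := vadd s (vopp t).

(** The other end of the edge at [t] that does not lie on the face [n]. *)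
Definition neighbour (t n : gvec) : gvec :=
  head vzero [seq w <- vertices | ~~ on_face n w &&
     all (fun n' => (n' == n) || on_face n' w) (normals_at t)].

Definition gap_nonneg n t := (gap n t == (0, 0)) || gpos (gap n t).

Lemma gaps_nonneg : all (fun n => all (gap_nonneg n) vertices) normals.
Proof. by vm_compute. Qed.

Definition edge_length (t n : gvec) : gint := gap n (neighbour t n).

(** The edges at [t] are a basis, and every vertex [w] is reached from [t] by a
    combination of them with coefficients proportional to the distances [gap] of
    [w] to the opposite faces, which are nonnegative. Hence a linear form is maximal
    at [t] as soon as it does not increase along the three edges. *)
Definition vertex_ok (t : gvec) : bool :=
  match normals_at t with
  | [:: n1; n2; n3] =>
    let g := edge_length t n1 in
    [&& gpos g, all (fun n => neighbour t n \in vertices) [:: n1; n2; n3],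
        [&& size (face [:: n1; n2]) == 2, size (face [:: n1; n3]) == 2,
            size (face [:: n2; n3]) == 2 & size (face [:: n1; n2; n3]) == 1]
      & all (fun w => vscale g (vsub t w) ==
          vadd (vscale (gap n1 w) (vsub t (neighbour t n1)))
            (vadd (vscale (gap n2 w) (vsub t (neighbour t n2)))
                  (vscale (gap n3 w) (vsub t (neighbour t n3))))) vertices]%N
  | _ => false
  end.

Lemma vertices_ok : all vertex_ok vertices.
Proof. by vm_compute. Qed.

Definition face_dirs : seq gvec := [seq vsum (face [:: n]) | n <- normals].

Definition edges : seq (gvec * gvec) :=
  [seq p <- [seq (n, n') | n <- normals, n' <- normals]
   | size (face [:: p.1; p.2]) == 2%N].

Definition edge_dirs : seq gvec := undup [seq vsum (face [:: p.1; p.2]) | p <- edges].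

(** Sufficient for different radial projections. *)
Definition dir_sep (s t : gvec) : bool :=
  vnonzero (vcross s t) || gpos (gopp (vdot s t)).

Definition all_dirs := face_dirs ++ vertices ++ edge_dirs.

Lemma dirs_sep : pairwise dir_sep all_dirs.
Proof. by vm_compute. Qed.

Lemma dirs_nonzero : all (fun t => gpos (vdot t t)) all_dirs.
Proof. by vm_compute. Qed.

Lemma size_dirs : [/\ size face_dirs = 12%N, size vertices = 20%N & size edge_dirs = 30%N].
Proof. by split; vm_compute. Qed.

Lemma size_face1 : all (fun n => size (face [:: n]) == 5%N) normals.
Proof. by vm_compute. Qed.

Variable R : realType.
Local Notation vval := (vval R).
Local Notation gval := (gval R).

Definition circum : R := (Num.sqrt 3)^-1.

Lemma circum_gt0 : 0 < circum.
Proof. by rewrite invr_gt0 sqrtr_gt0. Qed.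

Lemma golden_inv : (golden R)^-1 = golden R - 1.
Proof.
have g1 := golden_gt1 R; have nz : golden R != 0 by apply/eqP; lra.
apply: (mulfI nz); rewrite mulfV // mulrBr -expr2 golden_sq; ring.
Qed.

Lemma dodecahedronE : dodecahedron R = [seq circum *: vval t | t <- vertices].
Proof.
rewrite /dodecahedron /= /circum /vval /=.
do 20! (congr cons;
  first by congr (_ *: _); congr vec3; rewrite /gval ?golden_inv /=; ring).
Qed.

Lemma dotpC (u v : 'rV[R]_3) : dotp u v = dotp v u.
Proof. by rewrite !dotpE; ring. Qed.

Lemma dotpDr (u v w : 'rV[R]_3) : dotp u (v + w) = dotp u v + dotp u w.
Proof. by rewrite !dotpE !mxE; ring. Qed.

Lemma dotpBr (u v w : 'rV[R]_3) : dotp u (v - w) = dotp u v - dotp u w.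
Proof. by rewrite !dotpE !mxE; ring. Qed.

Lemma dotpZr (u v : 'rV[R]_3) c : dotp u (c *: v) = c * dotp u v.
Proof. by rewrite !dotpE !mxE; ring. Qed.

Lemma dotpDl (u v w : 'rV[R]_3) : dotp (v + w) u = dotp v u + dotp w u.
Proof. by rewrite !(dotpC _ u) dotpDr. Qed.

Lemma vval_scale c t : vval (vscale c t) = gval c *: vval t.
Proof. by apply: row3P; rewrite [RHS]mxE !vec3E gval_mul. Qed.

Lemma vval_sub s t : vval (vsub s t) = vval s - vval t.
Proof.
rewrite vval_add; congr (_ + _).
by apply: row3P; rewrite [RHS]mxE !vec3E gval_opp.
Qed.

(* The conversion test must not evaluate these lists. *)
#[global] Opaque vertices normals dodecahedron neighbour.

Definition max_vertices (u : 'rV[R]_3) : seq gvec :=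
  [seq t <- vertices | all (fun s => dotp u (vval s) <= dotp u (vval t)) vertices].

Lemma maximizers_map u (D : seq 'rV[R]_3) (L : seq gvec) :
  D = [seq circum *: vval t | t <- L] ->
  [seq v <- D | all (fun w => dotp u w <= dotp u v) D] =
  [seq circum *: vval t | t <-
    [seq t <- L | all (fun s => dotp u (vval s) <= dotp u (vval t)) L]].
Proof.
move=> ->; rewrite filter_map; congr map; apply: eq_filter => t /=.
rewrite all_map; apply: eq_all => s /=.
by rewrite !dotpZr ler_pM2l ?circum_gt0.
Qed.

Lemma exposedE u : exposed u = [seq circum *: vval t | t <- max_vertices u].
Proof. exact: maximizers_map dodecahedronE. Qed.

Lemma max_vertices_neq0 u : exists2 t, t \in vertices &
  {in vertices, forall s, dotp u (vval s) <= dotp u (vval t)}.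
Proof.
have : vertices != [::] by [].
elim: vertices => // t s IHs _; have [->|s_neq0] := eqVneq s [::].
  by exists t; rewrite ?mem_head // => w; rewrite inE => /eqP->.
have [t' s_t' max_t'] := IHs s_neq0.
have [le_tt'|lt_t't] := lerP (dotp u (vval t)) (dotp u (vval t')).
  exists t'; rewrite ?inE ?s_t' ?orbT // => w.
  by rewrite inE => /predU1P[->|/max_t'].
exists t; rewrite ?mem_head // => w.
by rewrite inE => /predU1P[->//|/max_t' le_wt']; apply: le_trans le_wt' (ltW _).
Qed.

Lemma on_faceP n t : on_face n t -> gval (gap n t) = 0.
Proof. by move/eqP->; rewrite gval0. Qed.

Lemma gap_ge0 n t : n \in normals -> t \in vertices ->
  0 <= gval (gap n t) ?= iff on_face n t.
Proof.
move=> Nn Vt; have /allP/(_ t Vt) := allP gaps_nonneg n Nn.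
rewrite /gap_nonneg -/(on_face n t) => /orP[on_nt|pos].
  by apply/leifP; rewrite on_nt (on_faceP on_nt).
apply/leifP; case: ifP => [/on_faceP ->//|_]; exact: gposP.
Qed.

(** A linear form that is constant on the vertices vanishes, since the vertices
    contain a basis and their opposites. *)
Lemma const_on_vertices (u : 'rV[R]_3) (c : R) :
  {in vertices, forall t, dotp u (vval t) = c} -> u = 0.
Proof.
move=> uc; have := (uc ((1, 0), (1, 0), (1, 0)) isT).
have := (uc ((-1, 0), (1, 0), (1, 0)) isT); have := (uc ((1, 0), (-1, 0), (1, 0)) isT).
have := (uc ((1, 0), (1, 0), (-1, 0)) isT); have := (uc ((-1, 0), (-1, 0), (-1, 0)) isT).
rewrite !dotpE !vec3E /gval /= => e1 e2 e3 e4 e5.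
by apply: row3P; rewrite mxE; lra.
Qed.

(** Take a vertex [t] where [u] is maximal. By [vertex_ok], another vertex [w] is
    maximal exactly when, for each of the three edges along which [u] decreases, it
    lies on the face opposite to that edge at [t]. *)
Lemma max_verticesP u : u != 0 -> exists2 t, t \in vertices &
  exists n1 n2 n3 (c1 c2 c3 : bool), [/\ normals_at t = [:: n1; n2; n3],
    [|| c1, c2 | c3] &
    max_vertices u = [seq w <- vertices |
      [&& c1 ==> on_face n1 w, c2 ==> on_face n2 w & c3 ==> on_face n3 w]]].
Proof.
move=> nz_u; have [t Vt max_t] := max_vertices_neq0 u; exists t => //.
have := allP vertices_ok t Vt; rewrite /vertex_ok.
case nsE: (normals_at t) => [|n1 [|n2 [|n3 [|//]]]] //.
set g := edge_length t n1; case/and4P => g_pos /and4P[Vw1 Vw2 Vw3 _] _ /allP decomp.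
have mem_n n : n \in [:: n1; n2; n3] -> n \in normals.
  by rewrite -nsE mem_filter => /andP[].
pose a n := dotp u (vval t) - dotp u (vval (neighbour t n)).
have a_ge0 n : neighbour t n \in vertices -> 0 <= a n.
  by move=> Vw; rewrite subr_ge0 max_t.
have dE w : w \in vertices -> gval g * (dotp u (vval t) - dotp u (vval w)) =
    gval (gap n1 w) * a n1 + (gval (gap n2 w) * a n2 + gval (gap n3 w) * a n3).
  move=> Vw; have /eqP/(congr1 vval) := decomp w Vw.
  rewrite !vval_add !vval_scale !vval_sub => /(congr1 (dotp u)).
  by rewrite !dotpDr !dotpZr !dotpBr.
clearbody a; exists n1, n2, n3, (0 < a n1), (0 < a n2), (0 < a n3); split=> //.
  apply: contraNT nz_u; rewrite !negb_or -!leNgt => /and3P[a1 a2 a3]; apply/eqP.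
  have a0 n : neighbour t n \in vertices -> a n <= 0 -> a n = 0.
    by move=> Vw an; apply: le_anti; rewrite an a_ge0.
  apply: (@const_on_vertices _ (dotp u (vval t))) => w Vw.
  have := dE w Vw; rewrite (a0 _ Vw1 a1) (a0 _ Vw2 a2) (a0 _ Vw3 a3) !mulr0 !addr0 => /eqP.
  by rewrite mulf_eq0 gt_eqF ?gposP //= subr_eq0 => /eqP.
apply: eq_in_filter => w Vw.
have max_w : all (fun s => dotp u (vval s) <= dotp u (vval w)) vertices =
    (dotp u (vval t) - dotp u (vval w) == 0).
  rewrite subr_eq0 eq_le max_t // andbT.
  apply/allP/idP => [/(_ t Vt)//|le_tw s Vs]; exact: le_trans (max_t s Vs) le_tw.
rewrite {}max_w -(mulrI_eq0 _ (mulfI (_ : gval g != 0))); last by rewrite gt_eqF ?gposP.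
have term n : n \in normals -> neighbour t n \in vertices ->
    (0 <= gval (gap n w) * a n) * ((gval (gap n w) * a n == 0) = ((0 < a n) ==> on_face n w)).
  move=> Nn Vn; have [ge0 eq0] := gap_ge0 Nn Vw; have an := a_ge0 n Vn.
  split; first exact: mulr_ge0.
  rewrite mulf_eq0 [gval _ == 0]eq_sym eq0 orbC implybE lt_neqAle an andbT negbK.
  by rewrite [0 == _]eq_sym.
have N1 : n1 \in normals by rewrite mem_n ?mem_head.
have N2 : n2 \in normals by rewrite mem_n // !inE eqxx orbT.
have N3 : n3 \in normals by rewrite mem_n // !inE eqxx !orbT.
have [g1 e1] := term n1 N1 Vw1; have [g2 e2] := term n2 N2 Vw2.
have [g3 e3] := term n3 N3 Vw3.
by rewrite (dE w Vw) !paddr_eq0 ?addr_ge0 // e1 e2 e3.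
Qed.

Lemma face_size n : n \in normals -> size (face [:: n]) = 5%N.
Proof. by move=> Nn; apply/eqP; exact: (allP size_face1). Qed.

(** The seven nonempty sets of faces at a vertex give the three faces, the three
    edges and the vertex. *)
Lemma max_vertices_cases u : u != 0 ->
  [\/ exists2 n, n \in normals & max_vertices u = face [:: n],
      exists2 p, p \in edges & max_vertices u = face [:: p.1; p.2]
    | size (max_vertices u) = 1%N].
Proof.
case/max_verticesP => t Vt [n1 [n2 [n3 [c1 [c2 [c3 [nsE c_neq0 ->]]]]]]].
have := allP vertices_ok t Vt; rewrite /vertex_ok nsE.
case/and4P => _ _ /and4P[/eqP s12 /eqP s13 /eqP s23 /eqP s123] _.
have mem_n n : n \in [:: n1; n2; n3] -> n \in normals.
  by rewrite -nsE mem_filter => /andP[].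
have N1 : n1 \in normals by rewrite mem_n ?mem_head.
have N2 : n2 \in normals by rewrite mem_n // !inE eqxx orbT.
have N3 : n3 \in normals by rewrite mem_n // !inE eqxx !orbT.
have edge n n' : n \in normals -> n' \in normals ->
    size (face [:: n; n']) = 2%N -> (n, n') \in edges.
  move=> Nn Nn' s2; rewrite mem_filter s2 eqxx /=.
  by apply/allpairsP; exists (n, n').
have faceE S P : (fun w => all (fun n => on_face n w) S) =1 P ->
    [seq w <- vertices | P w] = face S.
  by move=> eqP; rewrite /face; apply: eq_filter => w; rewrite eqP.
case: c1 c2 c3 c_neq0 => -[] [] // _.
- rewrite (faceE [:: n1; n2; n3]) => [|w /=]; last by rewrite andbT.
  exact: Or33.
- rewrite (faceE [:: n1; n2]) => [|w /=]; last by rewrite andbT.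
  exact: Or32 (ex_intro2 _ _ (n1, n2) (edge _ _ N1 N2 s12) erefl).
- rewrite (faceE [:: n1; n3]) => [|w /=]; last by rewrite andbT.
  exact: Or32 (ex_intro2 _ _ (n1, n3) (edge _ _ N1 N3 s13) erefl).
- rewrite (faceE [:: n1]) => [|w /=]; last by rewrite !andbT.
  exact: Or31 (ex_intro2 _ _ n1 N1 erefl).
- rewrite (faceE [:: n2; n3]) => [|w /=]; last by rewrite andbT.
  exact: Or32 (ex_intro2 _ _ (n2, n3) (edge _ _ N2 N3 s23) erefl).
- rewrite (faceE [:: n2]) => [|w /=]; last by rewrite !andbT.
  exact: Or31 (ex_intro2 _ _ n2 N2 erefl).
- rewrite (faceE [:: n3]) => [|w /=]; last by rewrite !andbT.
  exact: Or31 (ex_intro2 _ _ n3 N3 erefl).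
Qed.

Lemma sum_gaps_ge0 (S : seq gvec) t : {subset S <= normals} -> t \in vertices ->
  0 <= \sum_(n <- S) gval (gap n t) ?= iff all (fun n => on_face n t) S.
Proof.
move=> NS Vt; elim: S NS => [|n S IHS] NS; first by rewrite big_nil; split; rewrite ?lexx ?eqxx.
have Nn : n \in normals by apply: NS; rewrite mem_head.
have NS' : {subset S <= normals} by move=> n' Sn'; apply: NS; rewrite inE Sn' orbT.
have := leifD (gap_ge0 Nn Vt) (IHS NS').
by rewrite addr0 big_cons.
Qed.

(** Conversely, each normal is maximal exactly on its face, and their sum exactly
    on the intersection, if this is not empty. *)
Lemma max_vertices_face (S : seq gvec) : {subset S <= normals} -> face S != [::] ->
  max_vertices (\sum_(n <- S) vval n) = face S.
Proof.
move=> NS face_neq0; set u := \sum_(n <- S) _.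
have [t0 on_t0 Vt0] : exists2 t0, all (fun n => on_face n t0) S & t0 \in vertices.
  have [t0] : exists t0, t0 \in face S.
    by case: (face S) face_neq0 => // t0 L _; exists t0; rewrite mem_head.
  by rewrite mem_filter => /andP[]; exists t0.
have [c dotE] : exists c, forall t, dotp u (vval t) = c - \sum_(n <- S) gval (gap n t).
  exists (\sum_(n <- S) gval height) => t; rewrite -sumrB /u.
  elim: (S) => [|n S' IHS]; first by rewrite !big_nil dotpE !mxE !mul0r !addr0.
  rewrite !big_cons dotpDl IHS dotp_vval; congr (_ + _).
  by rewrite /gap gval_add gval_opp; ring.
rewrite /max_vertices /face; apply: eq_in_filter => t Vt.
have [D_ge0 D_eq0] := sum_gaps_ge0 NS Vt.
apply/allP/idP => [max_t|on_t s Vs].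
  have := max_t t0 Vt0; rewrite !dotE.
  have [_] := sum_gaps_ge0 NS Vt0; rewrite on_t0 => /eqP <-.
  by rewrite -D_eq0 => le_t0; apply/eqP; apply: le_anti; apply/andP; split; lra.
rewrite on_t in D_eq0; rewrite !dotE; move/eqP: D_eq0 => <-.
by have [Ds_ge0 _] := sum_gaps_ge0 NS Vs; lra.
Qed.

(** ** The sets of vertices, edges and faces *)

Lemma radialZ c (v : 'rV[R]_3) : 0 < c -> radial (c *: v) = radial v.
Proof.
move=> c_gt0; rewrite /radial dotpZr dotpC dotpZr mulrA -expr2 scalerA.
rewrite sqrtrM ?sqr_ge0 // sqrtr_sqr gtr0_norm // invfM mulrC mulrA mulfV ?mul1r //.
by rewrite gt_eqF.
Qed.

Lemma barycenterE L : radial (barycenter [seq circum *: vval t | t <- L]) =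
  if L is [::] then radial 0 else radial (vval (vsum L)).
Proof.
have sumE : \sum_(v <- [seq circum *: vval t | t <- L]) v = circum *: vval (vsum L).
  rewrite big_map; elim: L => [|t L IHL] /=.
    rewrite big_nil; apply: row3P; rewrite !mxE /= ?inordK //=;
    by rewrite gval0 mulr0.
  by rewrite big_cons IHL vval_add scalerDr.
rewrite /barycenter size_map sumE; case: L {sumE} => [|t L].
  by rewrite invr0 scale0r.
by rewrite scalerA radialZ // mulr_gt0 ?circum_gt0 ?invr_gt0 ?ltr0n.
Qed.

Definition dir (t : gvec) : 'rV[R]_3 := radial (vval t).

Lemma dotp_ge0 (v : 'rV[R]_3) : 0 <= dotp v v.
Proof. by rewrite dotpE -!expr2 !addr_ge0 ?sqr_ge0. Qed.

Lemma dir_S2 t : gpos (vdot t t) -> Defs.S2 (dir t).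
Proof.
move=> pos; rewrite /Defs.S2 /= /dir /radial dotpZr dotpC dotpZr.
have dot_gt0 : 0 < dotp (vval t) (vval t) by rewrite dotp_vval; exact: gposP.
rewrite mulrA -expr2 exprVn sqr_sqrtr ?dotp_ge0 // mulVf //.
by rewrite gt_eqF.
Qed.

(** Vectors with the same radial projection are positively proportional, so their
    cross product is null and their inner product is positive. *)
Lemma dir_sep_neq s t : gpos (vdot s s) -> gpos (vdot t t) -> dir_sep s t ->
  dir s != dir t.
Proof.
move=> s_pos t_pos; apply: contraTneq; rewrite /dir /radial.
have r_gt0 v : gpos (vdot v v) -> 0 < (Num.sqrt (dotp (vval v) (vval v)))^-1 :> R.
  by move=> pos; rewrite invr_gt0 sqrtr_gt0 dotp_vval; exact: gposP.
move: (_^-1) (r_gt0 s s_pos) (_^-1) (r_gt0 t t_pos) => a a_gt0 b b_gt0 eq_st.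
have ratio : vval s = (b / a) *: vval t.
  by rewrite mulrC -scalerA -eq_st scalerA mulVf ?scale1r // gt_eqF.
have r_pos : 0 < b / a by rewrite divr_gt0.
move: (b / a) r_pos ratio => r r_pos ratio.
have [e0 e1 e2] : [/\ gval s.1.1 = r * gval t.1.1, gval s.1.2 = r * gval t.1.2 &
    gval s.2 = r * gval t.2].
  move: ratio => /rowP E; have := (E 0, E 1, E (inord 2)).
  by rewrite !mxE /= inordK //= => -[[-> ->] ->].
rewrite negb_or; apply/andP; split.
  have minor0 x y x' y' : gval x = r * gval x' -> gval y = r * gval y' ->
      ~~ gnonzero (gadd (gmul x y') (gopp (gmul y x'))).
    move=> ex ey; apply/negP => /(gnonzeroP R).
    by rewrite gval_add gval_opp !gval_mul ex ey => /eqP; apply; ring.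
  by rewrite /vnonzero !negb_or; apply/and3P; split; exact: minor0.
apply/negP => /(gposP R); rewrite gval_opp -dotp_vval ratio dotpC dotpZr.
have := gposP R t_pos; rewrite -dotp_vval => dot_gt0.
by rewrite oppr_gt0 pmulr_rlt0 // => /(lt_trans dot_gt0); rewrite ltxx.
Qed.

Lemma uniq_dirs : uniq [seq dir t | t <- all_dirs].
Proof.
rewrite uniq_pairwise pairwise_map.
have := dirs_sep; have := dirs_nonzero; elim: all_dirs => //= t L IHL.
case/andP=> t_pos L_pos /andP[t_sep L_sep]; rewrite IHL // andbT.
apply/allP => s Ls; apply: dir_sep_neq => //; first exact: (allP L_pos).
exact: (allP t_sep).
Qed.

Lemma uniq_cat3 (T : eqType) (a b c : seq T) : uniq (a ++ b ++ c) ->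
  [/\ uniq a, uniq b, uniq c & [/\ uniq (a ++ b), uniq (b ++ c) & uniq (c ++ a)]].
Proof.
move=> uniq_abc; have sub s : subseq s (a ++ b ++ c) -> uniq s.
  by move=> /subseq_uniq; apply.
have uniq_ca : uniq (c ++ a).
  by rewrite uniq_catC sub // cat_subseq // suffix_subseq.
split; last split=> //.
- by move: uniq_ca; rewrite cat_uniq => /and3P[].
- by move: (uniq_abc); rewrite !cat_uniq => /and3P[_ _ /and3P[]].
- by move: uniq_ca; rewrite cat_uniq => /and3P[].
- by apply: sub; rewrite catA prefix_subseq.
- by apply: sub; rewrite suffix_subseq.
Qed.

Lemma map_cat3 (T U : Type) (h : T -> U) a b c :
  [seq h t | t <- a ++ b ++ c] =
  [seq h t | t <- a] ++ [seq h t | t <- b] ++ [seq h t | t <- c].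
Proof. by rewrite !map_cat. Qed.

Definition F_dirs := [seq dir t | t <- face_dirs].
Definition V_dirs := [seq dir t | t <- vertices].
Definition E_dirs := [seq dir t | t <- edge_dirs].

Lemma uniq_FVE : uniq (F_dirs ++ V_dirs ++ E_dirs).
Proof. by rewrite -map_cat3; exact: uniq_dirs. Qed.

Lemma size_FVE : [/\ size F_dirs = 12%N, size V_dirs = 20%N & size E_dirs = 30%N].
Proof.
have [sF sV sE] := size_dirs; split.
- by rewrite /F_dirs; move: face_dirs sF => L <-; rewrite size_map.
- by rewrite /V_dirs; move: vertices sV => L <-; rewrite size_map.
- by rewrite /E_dirs; move: edge_dirs sE => L <-; rewrite size_map.
Qed.

Lemma dirs_S2 v : v \in F_dirs ++ V_dirs ++ E_dirs -> Defs.S2 v.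
Proof.
rewrite -map_cat3 => /mapP[t t_dir ->]; apply: dir_S2.
exact: (allP dirs_nonzero).
Qed.

Lemma dir_vertex t : t \in vertices -> circum *: vval t = dir t.
Proof.
move=> Vt; have norm_t : dotp (vval t) (vval t) = 3.
  have : all (fun t => vdot t t == (3, 0)) vertices by vm_compute.
  move=> /allP/(_ t Vt)/eqP; rewrite dotp_vval => ->.
  by rewrite /gval /=; ring.
by rewrite /dir /radial norm_t.
Qed.

Lemma dodecahedron_dirs : dodecahedron R = V_dirs.
Proof. by rewrite dodecahedronE; apply/eq_in_map => t; exact: dir_vertex. Qed.

Lemma uniq_dodecahedron : uniq (dodecahedron R).
Proof. by rewrite dodecahedron_dirs; have [] := uniq_cat3 uniq_FVE. Qed.

Lemma V_IE : V_I = [set` V_dirs] :> set 'rV[R]_3.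
Proof. by rewrite /V_I dodecahedron_dirs. Qed.

(** The null vector would expose all 20 vertices. *)
Lemma face_exposed (S : seq gvec) : {subset S <= normals} -> (0 < size (face S) < 20)%N ->
  exists2 u, u != 0 & max_vertices u = face S.
Proof.
move=> NS /andP[s_gt0 s_lt20]; exists (\sum_(n <- S) vval n).
  apply: contraTneq s_lt20 => u0; rewrite -leqNgt -max_vertices_face //; last first.
    by rewrite -size_eq0 -lt0n.
  rewrite u0 /max_vertices; have [_ <- _] := size_dirs.
  rewrite (_ : seq.filter _ _ = vertices) // -[RHS]filter_predT.
  by apply: eq_filter => t; apply/allP => s _; rewrite !dotpE !mxE !mul0r.
by apply: max_vertices_face => //; rewrite -size_eq0 -lt0n.
Qed.

Lemma dir_barycenter u : (0 < size (max_vertices u))%N ->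
  radial (barycenter (exposed u)) = dir (vsum (max_vertices u)).
Proof. by rewrite exposedE barycenterE; case: (max_vertices u). Qed.

Lemma F_IE : F_I = [set` F_dirs] :> set 'rV[R]_3.
Proof.
apply/seteqP; split=> x /=.
  case=> u [u_neq0]; rewrite exposedE size_map => size_u <-.
  have s_gt0 : (0 < size (max_vertices u))%N by rewrite (leq_trans _ size_u).
  rewrite -exposedE (dir_barycenter s_gt0).
  have [[n Nn ->]|[p Ep uE]|s1] := max_vertices_cases u_neq0; first last.
  - by exfalso; rewrite s1 in size_u.
  - exfalso; move: Ep; rewrite mem_filter -uE => /andP[/eqP s2 _].
    by rewrite s2 in size_u.
  by apply: map_f; apply: (map_f (fun n => vsum (face [:: n]))).
case/mapP => f /mapP[n Nn ->] ->; have size_n := face_size Nn.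
have [u u_neq0 uE] : exists2 u, u != 0 & max_vertices u = face [:: n].
  by apply: face_exposed; rewrite ?size_n // => m; rewrite inE => /eqP->.
exists u; last by rewrite dir_barycenter uE ?size_n.
by split; rewrite // exposedE size_map uE size_n.
Qed.

Lemma E_IE : E_I = [set` E_dirs] :> set 'rV[R]_3.
Proof.
apply/seteqP; split=> x /=.
  case=> u [u_neq0]; rewrite exposedE size_map => size_u <-.
  have s_gt0 : (0 < size (max_vertices u))%N by rewrite size_u.
  rewrite -exposedE (dir_barycenter s_gt0).
  have [[n Nn uE]|[p Ep ->]|s1] := max_vertices_cases u_neq0.
  - by exfalso; have := face_size Nn; rewrite -uE size_u.
  - apply: map_f; rewrite mem_undup.
    exact: (map_f (fun p => vsum (face [:: p.1; p.2]))).
  - by exfalso; have := s1; rewrite size_u.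
case/mapP => f; rewrite mem_undup => /mapP[p Ep ->] ->.
have /andP[/eqP size_p Np] : (size (face [:: p.1; p.2]) == 2%N) &&
    (p \in [seq (n, n') | n <- normals, n' <- normals]).
  by move: Ep; rewrite /edges mem_filter.
have [N1 N2] : p.1 \in normals /\ p.2 \in normals.
  by case/allpairsP: Np => q [Nq1 Nq2 ->]; split.
have [u u_neq0 uE] : exists2 u, u != 0 & max_vertices u = face [:: p.1; p.2].
  apply: face_exposed; rewrite ?size_p // => m.
  by rewrite in_cons mem_seq1 => /orP[] /eqP ->.
exists u; last by rewrite dir_barycenter uE ?size_p.
by split; rewrite // exposedE size_map uE size_p.
Qed.

End DodecahedronFaces.

(** * Rotations of the dodecahedron and their orbits *)

Section RotationGroup.
Variable R : realType.
Implicit Types (A : 'M[R]_3) (u v : 'rV[R]_3).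
Local Notation rot := (@rotation_group R).

Lemma rotation_groupM A A' : rot A -> rot A' -> rot (A *m A').
Proof.
case=> oA dA VA [oA' dA' VA']; split.
- by rewrite trmx_mul mulmxA -(mulmxA A) oA' mulmx1.
- by rewrite det_mulmx dA dA' mulr1.
apply/seteqP; split=> v /=.
  case=> w Vw <-; rewrite mulmxA -VA' /=; exists (w *m A) => //.
  by rewrite -VA; exists w.
rewrite -{1}VA' => -[w Vw <-]; move: Vw; rewrite -{1}VA => -[w' Vw' <-].
by exists w'; rewrite ?mulmxA.
Qed.

Lemma rotation_groupV A : rot A -> rot A^T.
Proof.
case=> oA dA VA; have oA' := mulmx1C oA; split; rewrite ?trmxK ?det_tr //.
apply/seteqP; split=> v /=.
  case=> w; rewrite -{1}VA => -[w' Vw' <-] <-.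
  by rewrite -mulmxA oA mulmx1.
move=> Vv; exists (v *m A); last by rewrite -mulmxA oA mulmx1.
by rewrite -VA; exists v.
Qed.

Lemma dotp_rot A u v : rot A -> dotp (u *m A) (v *m A) = dotp u v.
Proof. by case=> oA _ _; rewrite /dotp trmx_mul mulmxA -(mulmxA u) oA mulmx1. Qed.

Lemma perm_dodecahedron A : rot A ->
  perm_eq [seq v *m A | v <- dodecahedron R] (dodecahedron R).
Proof.
case=> oA _ VA; apply: uniq_perm; rewrite ?uniq_dodecahedron //.
  rewrite map_inj_uniq ?uniq_dodecahedron // => u v /(congr1 (mulmx^~ A^T)) /=.
  by rewrite -!mulmxA oA !mulmx1.
move=> v; apply/mapP/idP => [[w Vw ->]|Vv].
  by have : V_I (w *m A) by rewrite -VA; exists w.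
have : V_I v by []. rewrite -{1}VA => -[w Vw <-].
by exists w.
Qed.

Lemma perm_exposed A u : rot A ->
  perm_eq (exposed (u *m A)) [seq v *m A | v <- exposed u].
Proof.
move=> rA; have permA := perm_dodecahedron rA.
pose P v := all (fun w => dotp (u *m A) w <= dotp (u *m A) v) (dodecahedron R).
have -> : exposed (u *m A) = [seq v <- dodecahedron R | P v] by [].
have -> : exposed u = [seq v <- dodecahedron R | preim (mulmx^~ A) P v].
  apply: eq_filter => v /=; rewrite /P -[RHS](perm_all _ permA) [RHS]all_map.
  by apply: eq_all => w /=; rewrite !(dotp_rot _ _ rA).
rewrite -filter_map; apply: perm_filter; by rewrite perm_sym.
Qed.

(* The conversion test must not evaluate the exposed vertices. *)
#[local] Opaque exposed.

Lemma radial_rot A v : rot A -> radial (v *m A) = radial v *m A.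
Proof. by move=> rA; rewrite /radial dotp_rot // scalemxAl. Qed.

Lemma barycenter_perm A (s s' : seq 'rV[R]_3) :
  perm_eq s' [seq v *m A | v <- s] -> barycenter s' = barycenter s *m A.
Proof.
move=> perm_s; rewrite /barycenter (perm_size perm_s) size_map (perm_big _ perm_s).
by rewrite big_map -scalemxAl mulmx_suml.
Qed.

Lemma barycenter_rot A u : rot A ->
  barycenter (exposed (u *m A)) = barycenter (exposed u) *m A.
Proof. by move=> rA; exact: barycenter_perm (perm_exposed u rA). Qed.

Lemma size_exposed_rot A u : rot A -> size (exposed (u *m A)) = size (exposed u).
Proof.
move=> rA; exact: etrans (perm_size (perm_exposed u rA)) (size_map _ _).
Qed.

Definition rot_stable (P : set 'rV[R]_3) := forall A v, rot A -> P v -> P (v *m A).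

(** A rotation permutes the vertices and preserves inner products, so it carries the
    vertices exposed by [u] to those exposed by its image. *)
Lemma exposed_stable (Q : pred nat) : rot_stable
  [set radial (barycenter (exposed u)) | u in [set u | u != 0 /\ Q (size (exposed u))]].
Proof.
move=> A _ rA [u [u_neq0 Qu] <-]; exists (u *m A); last first.
  by have := congr1 (@radial R) (barycenter_rot u rA); rewrite radial_rot.
split; last by rewrite (size_exposed_rot u rA).
apply: contraNneq u_neq0 => uA0; have [oA _ _] := rA.
by rewrite -[u]mulmx1 -oA mulmxA uA0 mul0mx.
Qed.

Lemma F_stable : rot_stable F_I.
Proof.
have -> : F_I = [set radial (barycenter (exposed u)) | u in
    [set u | u != 0 /\ (leq 3) (size (exposed u))]] :> set 'rV[R]_3 by [].
exact: exposed_stable.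
Qed.

Lemma E_stable : rot_stable E_I.
Proof.
have -> : E_I = [set radial (barycenter (exposed u)) | u in
    [set u | u != 0 /\ (pred1 2%N) (size (exposed u))]] :> set 'rV[R]_3.
  by apply/seteqP; split=> x [u [u0 /eqP su] <-]; exists u => //; split=> //; apply/eqP.
exact: exposed_stable.
Qed.

Lemma V_stable : rot_stable V_I.
Proof. by move=> A v [_ _ VA] Vv; rewrite -VA; exists v. Qed.

(** ** Orbits *)

Lemma B_I_eq a v : B_I a v -> B_I v = B_I a.
Proof.
case=> A rA <-; apply/seteqP; split=> x [A' rA' <-].
  by exists (A *m A'); [exact: rotation_groupM | rewrite mulmxA].
exists (A^T *m A'); first by apply: rotation_groupM => //; exact: rotation_groupV.
by have [oA _ _] := rA; rewrite mulmxA -(mulmxA a) oA mulmx1.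
Qed.

Lemma B_I_S2 a v : Defs.S2 a -> B_I a v -> Defs.S2 v.
Proof. by rewrite /Defs.S2 /= => Sa [A rA <-]; rewrite dotp_rot. Qed.

Lemma B_I_enum a : (B_I a #= `I_60)%card ->
  exists e : 'I_60 -> 'rV[R]_3, injective e /\ range e = B_I a.
Proof.
case/card_set_bijP => f [f_fun f_inj f_surj].
have ex (k : 'I_60) : exists v, B_I a v /\ f v = k.
  by have [v Bv fv] := f_surj k (ltn_ord k); exists v.
have [e eP] := choice ex; exists e; split=> [j k ejk|].
  by apply: val_inj; rewrite /= -(eP j).2 -(eP k).2 ejk.
apply/seteqP; split=> v; first by case=> k _ <-; exact: (eP k).1.
move=> Bv; have lt_fv : (f v < 60)%N := f_fun v Bv.
exists (Ordinal lt_fv) => //; have [Be fe] := eP (Ordinal lt_fv).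
by apply: f_inj; rewrite ?inE.
Qed.

(** A stable set that meets an orbit contains it. *)
Lemma small_stable_disjoint (L : seq 'rV[R]_3) a v : rot_stable [set` L] ->
  (size L < 60)%N -> (B_I a #= `I_60)%card -> v \in L -> ~ B_I a v.
Proof.
move=> stable lt_L60 /B_I_enum[e [e_inj e_range]] Lv Bv.
have e_L k : e k \in L.
  have : range e (e k) by exists k.
  by rewrite e_range -(B_I_eq Bv) => -[A rA <-]; apply: stable.
have : (size [seq e k | k <- enum 'I_60] <= size L)%N.
  apply: uniq_leq_size => [|x /mapP[k _ ->]]; last exact: e_L.
  by rewrite map_inj_uniq ?enum_uniq.
by rewrite size_map size_enum_ord leqNgt lt_L60.
Qed.

(** ** Stereographic projection *)

Lemma stereo_inj u v : Defs.S2 u -> Defs.S2 v -> stereo u = stereo v -> u = v.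
Proof.
rewrite /Defs.S2 /= !dotpE /stereo => Su Sv eq_uv.
suff [e0 e1 e2] : [/\ u 0 0 = v 0 0, u 0 1 = v 0 1 & u 0 (inord 2) = v 0 (inord 2)].
  exact: row3P.
move: (u 0 0) (u 0 1) (u 0 (inord 2)) (v 0 0) (v 0 1) (v 0 (inord 2)) Su Sv eq_uv.
move=> x y z x' y' z' Su Sv.
case: (eqVneq z 1) => [z1|nz1]; case: (eqVneq z' 1) => [z'1|nz'1] //.
  move=> _; rewrite z1 z'1 in Su Sv *.
  have x0 : x = 0 by nra.
  have y0 : y = 0 by nra.
  have x'0 : x' = 0 by nra.
  have y'0 : y' = 0 by nra.
  by rewrite x0 y0 x'0 y'0.
case=> ex ey; have d1 : 1 - z != 0 by rewrite subr_eq0 eq_sym.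
have d2 : 1 - z' != 0 by rewrite subr_eq0 eq_sym.
have lift (a b c : R) : a * a + b * b + c * c = 1 -> 1 - c != 0 ->
    (a / (1 - c)) ^+ 2 + (b / (1 - c)) ^+ 2 = 2 / (1 - c) - 1.
  move=> S d; have -> : (a / (1 - c)) ^+ 2 + (b / (1 - c)) ^+ 2 =
      (a * a + b * b) / (1 - c) ^+ 2 by field.
  have -> : a * a + b * b = 1 - c * c by rewrite -S addrK.
  by field.
have ez : z = z'.
  have := lift x y z Su d1; rewrite ex ey (lift x' y' z' Sv d2).
  move/(addIr _)/(mulfI (_ : 2 != 0)); rewrite pnatr_eq0 => /(_ isT)/invr_inj.
  by move/(addrI _)/oppr_inj.
rewrite -ez in ex ey d2; split=> //.
  by apply: (mulIf (_ : (1 - z)^-1 != 0)); rewrite ?invr_eq0.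
by apply: (mulIf (_ : (1 - z)^-1 != 0)); rewrite ?invr_eq0.
Qed.

(** ** The number of marked points *)

Lemma card_range_eq (I J : finType) (T : Type) (g : I -> T) (h : J -> T) :
  injective g -> injective h -> range g = range h -> #|I| = #|J|.
Proof.
have le (I' J' : finType) (g' : I' -> T) (h' : J' -> T) :
    injective g' -> range g' `<=` range h' -> (#|I'| <= #|J'|)%N.
  move=> g_inj sub; have ex (i : I') : exists j : J', h' j = g' i.
    by have [|j _ <-] := sub (g' i); [exists i | exists j].
  have [e eP] := choice ex; apply: (leq_card e) => i i' eq_e.
  by apply: g_inj; rewrite -!eP eq_e.
move=> g_inj h_inj eq_gh; apply/eqP; rewrite eqn_leq.
by rewrite (le _ _ g h) ?(le _ _ h g) ?eq_gh.
Qed.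

(** Transformations and stereographic projection are injective, and the orbits are
    disjoint from each other and from [L], so the points can be counted. *)
Lemma has_type_card (L : seq 'rV[R]_3) m d (l : 'rV[R[i]]_d) :
    injective (zpt l) -> uniq L -> (forall v, v \in L -> Defs.S2 v) ->
    (forall a v, (B_I a #= `I_60)%card -> v \in L -> ~ B_I a v) ->
    has_type [set` L] m l ->
  (3 + d = size L + 60 * m)%N.
Proof.
move=> inj_l uniq_L L_S2 L_B [a [a_S2 a_60 a_inj [h [M Mu ->] hE]]].
have [e eP] := choice (fun i => B_I_enum (a_60 i)).
pose pt (x : 'I_(size L) + 'I_m * 'I_60) : 'rV[R]_3 :=
  match x with inl j => nth 0 L j | inr p => e p.1 p.2 end.
have e_B i k : B_I (a i) (e i k) by have [_ <-] := eP i; exists k.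
have pt_S2 x : Defs.S2 (pt x).
  case: x => [j|[i k]] /=; first by apply: L_S2; rewrite mem_nth.
  by apply: B_I_S2 (a_S2 i) _.
have pt_inj : injective pt.
  move=> [j|[i k]] [j'|[i' k']] /=.
  - by move/eqP; rewrite nth_uniq // => /eqP/val_inj->.
  - move=> eq_pt; have := L_B (a i') (nth 0 L j) (a_60 i') (mem_nth _ (ltn_ord j)).
    by rewrite eq_pt; case; exact: e_B.
  - move=> eq_pt; have := L_B (a i) (nth 0 L j') (a_60 i) (mem_nth _ (ltn_ord j')).
    by rewrite -eq_pt; case; exact: e_B.
  move=> eq_pt; have ii' : i = i'.
    apply: a_inj; rewrite -(B_I_eq (e_B i k)) eq_pt; exact: B_I_eq.
  rewrite -ii' in eq_pt *; have [e_inj _] := eP i.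
  by rewrite (e_inj _ _ eq_pt).
have := @card_range_eq _ _ _ (lft M \o zpt l) (@stereo R \o pt).
rewrite card_sum card_prod !card_ord (mulnC m); apply.
- by move=> k k' /(lft_inj Mu)/inj_l.
- by move=> x y /stereo_inj eq_xy; apply: pt_inj; apply: eq_xy.
transitivity (lft M @` zset l).
  apply/seteqP; split=> p /=; first by case=> k _ <-; exists (zpt l k) => //; exists k.
  by case=> q [k _ <-] <-; exists k.
rewrite hE; apply/seteqP; split=> p /=.
  case=> v [Lv|[i _ Bv]] <-.
    have lt_v : (index v L < size L)%N by rewrite index_mem.
    by exists (inl (Ordinal lt_v)) => //=; rewrite nth_index.
  have [_ e_range] := eP i; move: Bv; rewrite -e_range => -[k _ <-].
  by exists (inr (i, k)).
case=> [[j|[i k]]] _ <- /=; first by exists (nth 0 L j) => //; left; exact: mem_nth.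
by exists (e i k) => //; right; exists i.
Qed.

End RotationGroup.

(** * The multiplicity vectors by type *)

Lemma mem_cat3 (T : eqType) (A B C : seq T) x :
  x \in A ++ B ++ C -> [\/ x \in A, x \in B | x \in C].
Proof. by rewrite !mem_cat => /or3P[]; [constructor 1 | constructor 2 | constructor 3]. Qed.

Lemma sub_cat3 (T : eqType) (A B C : seq T) :
  [/\ {subset A <= A ++ B ++ C}, {subset B <= A ++ B ++ C}
    & {subset C <= A ++ B ++ C}].
Proof. by split=> x x_in; rewrite !mem_cat x_in ?orbT. Qed.

Lemma sub_cat (T : eqType) (A B S : seq T) :
  {subset A <= S} -> {subset B <= S} -> {subset A ++ B <= S}.
Proof. by move=> subA subB x; rewrite mem_cat => /orP[/subA | /subB]. Qed.

Section MarkedDirections.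
Variable R : realType.

(** The sets of 12, 20 and 30 directions are stable under rotations and too small to
    meet an orbit of order 60. *)
Lemma subset_FVE_card (L : seq 'rV[R]_3) m d (l : 'rV[R[i]]_d) :
    injective (zpt l) -> uniq L ->
    {subset L <= F_dirs R ++ V_dirs R ++ E_dirs R} ->
  has_type [set` L] m l -> (3 + d = size L + 60 * m)%N.
Proof.
move=> inj_l uniq_L subL; apply: has_type_card => // [v /subL/dirs_S2 //|].
have [sF sV sE] := size_FVE R.
have stF := @F_stable R; have stV := @V_stable R; have stE := @E_stable R.
rewrite F_IE in stF; rewrite V_IE in stV; rewrite E_IE in stE.
have small n k : n = k -> (k < 60)%N -> (n < 60)%N by move=> ->.
move=> a v a60 /subL/mem_cat3[].
- exact: (small_stable_disjoint stF (small _ _ sF isT) a60).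
- exact: (small_stable_disjoint stV (small _ _ sV isT) a60).
- exact: (small_stable_disjoint stE (small _ _ sE isT) a60).
Qed.

Lemma set_cat (A B : seq 'rV[R]_3) : [set` A] `|` [set` B] = [set` A ++ B].
Proof.
apply/seteqP; split=> v /=.
  by rewrite mem_cat; case=> ->; rewrite ?orbT.
by rewrite mem_cat => /orP[]; [left | right].
Qed.

Lemma set_nil : [set` [::]] = set0 :> set 'rV[R]_3.
Proof. by apply/seteqP; split=> v. Qed.

End MarkedDirections.

Theorem theorem16 (R : realType) (d : nat) (hn : (5 <= 3 + d)%N)
    (l : 'rV[R[i]]_d) (hl : Kn l) (hI : stabG l \isog 'Alt_('I_5)) (m : nat) :
  [/\ has_type F_I m l -> has_multiplicity_vector l
        [tuple m; 1 + 4 * m; 1 + 5 * m; 3 * m; 3 * m]%N,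
      has_type V_I m l -> has_multiplicity_vector l
        [tuple m; 1 + 4 * m; 2 + 5 * m; 3 * m; 1 + 3 * m]%N,
      has_type E_I m l -> has_multiplicity_vector l
        [tuple m; 2 + 4 * m; 2 + 5 * m; 1 + 3 * m; 2 + 3 * m]%N
    & has_type (F_I `|` V_I) m l -> has_multiplicity_vector l
        [tuple m; 2 + 4 * m; 3 + 5 * m; 1 + 3 * m; 1 + 3 * m]%N] /\
  [/\ has_type (V_I `|` E_I) m l -> has_multiplicity_vector l
        [tuple m; 3 + 4 * m; 4 + 5 * m; 2 + 3 * m; 3 + 3 * m]%N,
      has_type (E_I `|` F_I) m l -> has_multiplicity_vector l
        [tuple m; 3 + 4 * m; 3 + 5 * m; 2 + 3 * m; 2 + 3 * m]%N,
      has_type (F_I `|` V_I `|` E_I) m l -> has_multiplicity_vector l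
        [tuple m; 4 + 4 * m; 5 + 5 * m; 3 + 3 * m; 3 + 3 * m]%N
    & has_type set0 m.+1 l -> has_multiplicity_vector l
        [tuple 1 + m; 4 + 4 * m; 5 + 5 * m; 2 + 3 * m; 3 + 3 * m]%N].
Proof.
have inj_l := zpt_inj hl.
pose G := Group (stabG_group_set inj_l).
have /isogP[f injf imf] : G \isog 'Alt_('I_5) := hI.
have vec := multiplicity_vector_of_card inj_l (erefl : stabG l = G :> {set _}) injf imf.
have [uF uV uE [uFV uVE uEF]] := uniq_cat3 (uniq_FVE R).
have [sF sV sE] := size_FVE R.
have [subF subV subE] := sub_cat3 (F_dirs R) (V_dirs R) (E_dirs R).
have card L k := @subset_FVE_card R L k d l inj_l.
rewrite F_IE V_IE E_IE.
(* The flags say which of the face, vertex and edge directions are present. *)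
split; split.
- move=> /(card _ _ uF subF); rewrite sF => n_eq.
  by apply: (vec true false false m); clear -n_eq; lia.
- move=> /(card _ _ uV subV); rewrite sV => n_eq.
  by apply: (vec false true false m); clear -n_eq; lia.
- move=> /(card _ _ uE subE); rewrite sE => n_eq.
  by apply: (vec false false true m); clear -n_eq; lia.
- rewrite set_cat => /(card _ _ uFV (sub_cat subF subV)).
  rewrite size_cat sF sV => n_eq.
  by apply: (vec true true false m); clear -n_eq; lia.
- rewrite set_cat => /(card _ _ uVE (sub_cat subV subE)).
  rewrite size_cat sV sE => n_eq.
  by apply: (vec false true true m); clear -n_eq; lia.
- rewrite set_cat => /(card _ _ uEF (sub_cat subE subF)).
  rewrite size_cat sE sF => n_eq.
  by apply: (vec true false true m); clear -n_eq; lia.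
- rewrite -setUA !set_cat => /(card _ _ (uniq_FVE R) (sub_cat subF (sub_cat subV subE))).
  rewrite 2!size_cat sF sV sE => n_eq.
  by apply: (vec true true true m); clear -n_eq; lia.
- have sub0 : {subset [::] <= F_dirs R ++ V_dirs R ++ E_dirs R} by [].
  have := card [::] m.+1 isT sub0; rewrite set_nil => /[apply]; rewrite add0n => n_eq.
  by apply: (vec false false false m.+1); clear -n_eq; lia.
Qed.
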